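(* Let $s\in\mathbb{C}_2$ with $|s|<4$ and $2s\notin\mathbb{Z}_2^\times$. Put $\kappa=\langle\cdot\rangle^{-12s}$, $\nu=\nu(2s)$ and $r=\frac{3+\nu}{12}$. Let $G=q+\cdots\in\mathbb{C}_2[[q]]$ (zero constant term and $q$-coefficient $1$) be an overconvergent form of weight $\kappa$, i.e. $G\in M_\kappa[\rho]$ for some sufficiently small rational $\rho>0$. If $UG=0$, then $F:=h^sG\in M_0[\rho]$ does not extend to an element of $M_0[r]$; equivalently, $G\notin M_\kappa[r]$.
   Context: $\mathbb{C}_2$ is the completion of an algebraic closure of $\mathbb{Q}_2$, with $|2|=1/2$ and valuation $v$ with $v(2)=1$, $v(0)=+\infty$. For $x\in\mathbb{C}_2$ let $\beta(x)=\sup\{v(x-n):n\in\mathbb{Z}_2\}$ (with $\beta=+\infty$ if $x\in\mathbb{Z}_2$), and define $\nu(x)$ by: $\nu=\beta$ if $\beta\le0$; $\nu=\sum_{k=1}^n 2^{-k}+(\beta-n)/2^{n+1}$ if $n\le\beta\le n+1$ for an integer $n\ge0$ (so $\nu=\beta/2$ for $0\le\beta\le1$); $\nu=1$ if $\beta=+\infty$. For $t\in\mathbb{C}_2$, $|t|<2$, $\langle\cdot\rangle^t:\mathbb{Z}_2^\times\to\mathbb{C}_2^\times$ is the continuous character with $-1\mapsto1$ and $5\mapsto\exp(t\log 5)$. For $r\in\mathbb{Q}$, $0<r<2/3$, $X[r]$ is the closed subdisc $|j|\ge2^{-12r}$ of the $j$-line over $\mathbb{C}_2$, and $M_0[r]$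 is the space of rigid functions on $X[r]$, identified with their $q$-expansions at the cusp $\infty$. For $r'<r$, restriction gives $M_0[r]\subset M_0[r']$. Let $h=\prod_{n\ge1}\left(\frac{1-q^n}{1+q^n}\right)^{24}$ and $h^{1/8}=\prod_{n\ge1}\left(\frac{1-q^n}{1+q^n}\right)^3=1+2qg$ with $g\in\mathbb{Z}[[q]]$. For $|s|<8$, $h^s:=(1+2qg)^{8s}$ by the binomial expansion, a power series in $q$ over $\mathbb{C}_2$. Let $\mu(s)=\min\{v(s),0\}$. Let $\mathcal{X}$ be the set of pairs $(\kappa,r)$ with $r\in\mathbb{Q}$ and $\kappa=\langle\cdot\rangle^{-12s}$ for some $s\in\mathbb{C}_2$ with $|s|<8$ and $0<r<1/2+\mu(s)/6$. For $(\kappa,r)\in\mathcal{X}$, $M_\kappa[r]$ is the space of $F\in\mathbb{C}_2[[q]]$ such that $Fh^s$ is the $q$-expansion of an element of $M_0[r]$. Under the hypotheses of the statement, $(\kappa,\frac{3+\nu}{12})\in\mathcal{X}$. $U(\sum a_nq^n)=\sum a_{2n}q^n$. *)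

(* Defs.v *)
From HB Require Import structures.
From mathcomp Require Import all_boot all_order all_algebra.
From mathcomp Require Import all_classical all_reals all_analysis.

Set Implicit Arguments.
Unset Strict Implicit.
Unset Printing Implicit Defensive.

Import Order.TTheory GRing.Theory Num.Theory.
Import numFieldNormedType.Exports.

Local Open Scope classical_set_scope.
Local Open Scope ring_scope.

(** * Formal power series, with the Cauchy product *)

Record fps (K : Type) := Fps { fps_coef :> nat -> K }.

HB.instance Definition _ (K : Type) := gen_eqMixin (fps K).
HB.instance Definition _ (K : Type) := gen_choiceMixin (fps K).

Lemma fpsP (K : Type) (f g : fps K) : (forall n, f n = g n) -> f = g.
Proof. by case: f g => [f] [g] /= fg; congr Fps; apply/funext. Qed.

Section FpsRing.
Variable K : comNzRingType.
Implicit Types f g h : fps K.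

Definition fps_zero : fps K := Fps (fun _ => 0).
Definition fps_one : fps K := Fps (fun n => (n == 0)%:R).
Definition fps_opp f : fps K := Fps (fun n => - f n).
Definition fps_add f g : fps K := Fps (fun n => f n + g n).
Definition fps_mul f g : fps K :=
  Fps (fun n => \sum_(i < n.+1) f i * g (n - i)%N).

Fact fps_addA : associative fps_add.
Proof. by move=> f g h; apply: fpsP => n /=; rewrite addrA. Qed.
Fact fps_addC : commutative fps_add.
Proof. by move=> f g; apply: fpsP => n /=; rewrite addrC. Qed.
Fact fps_add0 : left_id fps_zero fps_add.
Proof. by move=> f; apply: fpsP => n /=; rewrite add0r. Qed.
Fact fps_addN : left_inverse fps_zero fps_opp fps_add.
Proof. by move=> f; apply: fpsP => n /=; rewrite addNr. Qed.

HB.instance Definition _ :=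
  GRing.isZmodule.Build (fps K) fps_addA fps_addC fps_add0 fps_addN.

Definition fps_trunc (m : nat) f : {poly K} := \poly_(i < m.+1) f i.

Lemma fps_mulE m n f g :
  (n <= m)%N -> fps_mul f g n = (fps_trunc m f * fps_trunc m g)`_n.
Proof.
move=> nm; rewrite coefM /=; apply: eq_bigr => i _.
have im : (i < m.+1)%N by rewrite (leq_trans (ltn_ord i)) ?ltnS.
have nim : (n - i < m.+1)%N by rewrite ltnS (leq_trans (leq_subr i n)).
by rewrite !coef_poly im nim.
Qed.

Fact fps_mulC : commutative fps_mul.
Proof. by move=> f g; apply: fpsP => n; rewrite !(@fps_mulE n)// mulrC. Qed.

Fact fps_mulA : associative fps_mul.
Proof.
move=> f g h; apply: fpsP => n.
transitivity ((fps_trunc n f * (fps_trunc n g * fps_trunc n h))`_n).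
  rewrite coefM; apply: eq_bigr => i _.
  by rewrite coef_poly ltn_ord (@fps_mulE n)// leq_subr.
rewrite mulrA coefM; apply: eq_bigr => i _.
rewrite coef_poly ltnS leq_subr (@fps_mulE n)//.
by rewrite -ltnS.
Qed.

Fact fps_mul1 : left_id fps_one fps_mul.
Proof.
move=> f; apply: fpsP => n /=.
rewrite big_ord_recl /= subn0 mul1r big1 ?addr0// => i _.
by rewrite /= mul0r.
Qed.

Fact fps_mulDl : left_distributive fps_mul fps_add.
Proof.
move=> f g h; apply: fpsP => n /=; rewrite -big_split /=.
by apply: eq_bigr => i _; rewrite mulrDl.
Qed.

Fact fps_oner_neq0 : fps_one != fps_zero.
Proof.
apply/eqP => /(congr1 (fun f : fps K => f 0%N)) /= /eqP.
by rewrite oner_eq0.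
Qed.

HB.instance Definition _ := GRing.Zmodule_isComNzRing.Build (fps K)
  fps_mulA fps_mulC fps_mul1 fps_mulDl fps_oner_neq0.

Definition fpsX : fps K := Fps (fun n => (n == 1)%:R).

(* The substitution \sum_k a_k f^k, for f with zero constant term: the terms
   with k > n do not contribute to the coefficient of q^n. *)
Definition fps_subst (a : nat -> K) f : fps K :=
  Fps (fun n => \sum_(k < n.+1) a k * (f ^+ k) n).

(* The inverse of a series f with constant term 1, as \sum_k (1 - f)^k. *)
Definition fps_inv f : fps K := fps_subst (fun _ => 1) (1 - f).

(* The infinite product \prod_(n >= 1) F n, for F n = 1 + O(q^n): the factors
   F k with k > n do not contribute to the coefficient of q^n. *)
Definition fps_prod (F : nat -> fps K) : fps K :=
  Fps (fun n => (\prod_(1 <= k < n.+1) F k) n).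

(** * q-expansions *)

Definition E4 : fps K :=
  1 + 240%:R * Fps (fun n => if n is 0 then 0
                             else (\sum_(d <- divisors n) d ^ 3)%N%:R).

Definition Delta : fps K :=
  fpsX * fps_prod (fun n => (1 - fpsX ^+ n) ^+ 24).

(* 1/j = Delta / E4^3 = q - 744 q^2 + ... *)
Definition jinv : fps K := Delta * fps_inv (E4 ^+ 3).

(* h^{1/8} = 1 + 2 q g *)
Definition h_root8 : fps K :=
  fps_prod (fun n => ((1 - fpsX ^+ n) * fps_inv (1 + fpsX ^+ n)) ^+ 3).

Definition Uop f : fps K := Fps (fun n => f (2 * n)%N).

End FpsRing.

Arguments fpsX {K}.
Arguments E4 {K}.
Arguments Delta {K}.
Arguments jinv {K}.
Arguments h_root8 {K}.

(** * The field C_2 *)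

Section C2.
Variables (R : realType) (C : closedFieldType) (nrm : C -> R).
Implicit Types (s t x y : C) (F G : fps C) (kappa : C -> C).

Definition cvgC (u : nat -> C) (l : C) : Prop :=
  (fun n => nrm (u n - l)) @ \oo --> (0 : R).

Definition cauchyC (u : nat -> C) : Prop :=
  forall e : R, 0 < e -> exists N : nat, forall m n : nat,
    (N <= m)%N -> (N <= n)%N -> nrm (u m - u n) < e.

(* In a complete ultrametric field with |2| = 1/2, the closure of the prime
   field is Q_2. *)
Definition Q2 : set C :=
  [set x | forall e : R, 0 < e -> exists a : rat, nrm (x - ratr a) < e].

Definition Z2 : set C := [set x | Q2 x /\ nrm x <= 1].

Definition Z2unit : set C := [set x | Q2 x /\ nrm x = 1].

Definition algebraic_over_Q2 x : Prop :=
  exists p : {poly C}, [/\ p != 0, forall i, Q2 p`_i & root p x].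

(* (C, nrm) is the completion of an algebraic closure of Q_2. Since C is
   algebraically closed, the elements of C algebraic over Q_2 form an algebraic
   closure of Q_2; C is its completion when C is complete and this subfield is
   dense. These conditions determine (C, nrm) up to isometric isomorphism. *)
Record is_C2 : Prop := {
  nrm_ge0 : forall x, 0 <= nrm x ;
  nrm_eq0 : forall x, nrm x = 0 <-> x = 0 ;
  nrmM : forall x y, nrm (x * y) = nrm x * nrm y ;
  nrmD_max : forall x y, nrm (x + y) <= Num.max (nrm x) (nrm y) ;
  nrm2 : nrm 2%:R = 2^-1 ;
  C2_complete : forall u : nat -> C, cauchyC u -> exists l : C, cvgC u l ;
  C2_dense : forall x (e : R), 0 < e ->
    exists y : C, algebraic_over_Q2 y /\ nrm (x - y) < e
}.

Definition valC x : \bar R :=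
  if x == 0 then +oo%E else (- (ln (nrm x) / ln 2))%:E.

Definition beta x : \bar R := ereal_sup [set valC (x - n) | n in Z2].

Definition nu x : R :=
  match beta x with
  | EFin b =>
      if b <= 0 then b
      else let n := Num.truncn b in
           \sum_(1 <= k < n.+1) 2^-1 ^+ k + (b - n%:R) / 2 ^+ n.+1
  | +oo%E => 1
  | -oo%E => 0 (* never occurs *)
  end.

Definition mu s : R := fine (Order.min (valC s) 0%E).

(** * The characters <.>^t *)

Definition is_exp x y : Prop :=
  cvgC (fun n => \sum_(0 <= k < n) x ^+ k / (k`!)%:R) y.

(* y = log (1 + x) *)
Definition is_log1p x y : Prop :=
  cvgC (fun n => \sum_(1 <= k < n) (-1) ^+ k.+1 * x ^+ k / k%:R) y.

(* kappa is a continuous character Z_2^* -> C^*; its values outside of Z_2^*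
   are irrelevant. *)
Definition is_character kappa : Prop :=
  [/\ forall x, Z2unit x -> kappa x != 0,
      forall x y, Z2unit x -> Z2unit y -> kappa (x * y) = kappa x * kappa y &
      forall x, Z2unit x -> forall e : R, 0 < e -> exists2 d : R, 0 < d &
        forall y, Z2unit y -> nrm (x - y) < d -> nrm (kappa x - kappa y) < e].

(* kappa = <.>^t; -1 and 5 generate a dense subgroup of Z_2^*, so this
   determines kappa on Z_2^*. *)
Definition is_bracket t kappa : Prop :=
  [/\ nrm t < 2, is_character kappa, kappa (-1) = 1 &
      exists2 l : C, is_log1p 4%:R l & is_exp (t * l) (kappa 5%:R)].

(** * Overconvergent forms *)

(* h^s = (1 + 2 q g)^(8 s) *)
Definition binomC (x : C) (k : nat) : C :=
  (\prod_(0 <= i < k) (x - i%:R)) / (k`!)%:R.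

Definition hpow s : fps C := fps_subst (binomC (8%:R * s)) (h_root8 - 1).

(* \sum_n a_n z^n is a rigid function on the closed disc |z| <= rho, i.e. an
   element of its Tate algebra. *)
Definition rigid_on_disc (rho : R) (a : nat -> C) : Prop :=
  (fun n => nrm (a n) * rho ^+ n) @ \oo --> (0 : R).

(* X[r] is the closed disc |z| <= 2^{12 r} in the coordinate z = 1/j, centred
   at the cusp z = 0; the q-expansion of \sum_n a_n z^n is obtained by
   substituting for z the q-expansion of 1/j. *)
Definition M0 (r : R) F : Prop :=
  exists2 a : nat -> C, rigid_on_disc (2 `^ (12 * r)) a & F = fps_subst a jinv.

(* (kappa, r) belongs to the set \mathcal{X} *)
Definition weightX kappa (r : rat) : Prop :=
  exists s, [/\ nrm s < 8, is_bracket (- 12%:R * s) kappa &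
                0 < (ratr r : R) < 2^-1 + mu s / 6].

(* s is determined by kappa: exp is injective on the disc |x| < 1/2. *)
Definition Mk kappa (r : R) F : Prop :=
  exists s, [/\ nrm s < 8, is_bracket (- 12%:R * s) kappa &
                M0 r (F * hpow s)].

End C2.

(* Main.v *)
(* Let g = (eta(q^4)/eta(q))^8 and u = 1 + 16 g; then Delta(q^2)/Delta(q) = g u
   is a Hauptmodul f of X_0(2), 1/j = f / (1 + 256 f)^3, and q -> -q acts on u
   by u -> 1/u. Since h(q^2) = u^3 h(q), the series h(q^2)^s G = u^(3s) F is odd
   in q when U G = 0. Hence if F = Phi(w), w = u - 1, then, as formal power
   series in w,
       Phi(1/u - 1) = - u^(6s) Phi(u - 1).          (1)
   If F were in M_0[r], then Phi would be a series in w + w^2 = 16 f that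
   converges on the closed disc |w| <= R = 2^(nu - 1) <= 1.

   If 2s is not in Z_2, choose a natural number m closest to 2s, so that
   |6s - 3m| = 2^(-beta). The coefficients e_n of (1 + w)^(6s - 3m) satisfy
   |e_n| R^n <= 1/2 for n > 0, with equality for n = 2^k large, and with strict
   inequality when n is not a power of 2. Because of these gaps
   ((1 + w)^(6s - 3m) - 1) (1 + w)^(3m) Phi does not converge for |w| = R,
   whereas by (1) it is a difference of two series that do.

   If 2s is in Z_2, then R = 1. Reducing (1) modulo the maximal ideal shows that
   6s is an integer, which is even since 2s is not a unit. Now (1) holds for all
   |u| = 1, and together with the invariance of Phi under u -> 1 - u it shows
   that 2 Phi vanishes where |u| = |1 - u| = 1.

   The q-expansion identities are obtained from Ramanujan's equation
   12 q dE2/dq = E2^2 - E4 and from the action of T_2 on E2 and E4: they express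
   the derivatives of the Eisenstein series of weight 2 and level 4 as
   quadratic polynomials in them, and identities between eta quotients are then
   checked on logarithmic derivatives. *)

Require Import Defs.
From HB Require Import structures.
From mathcomp Require Import all_boot all_order all_algebra.
From mathcomp Require Import all_classical all_reals all_analysis.
From mathcomp Require Import ring lra zify.

Set Implicit Arguments.
Unset Strict Implicit.
Unset Printing Implicit Defensive.

Import Order.TTheory GRing.Theory Num.Theory.
Import numFieldNormedType.Exports.
Local Open Scope ring_scope.

(** * Formal power series *)

(** The value of [r] is read off in the coordinate y = w + w^2 = 16 f: there 1/j = (y/16) / (1 + 16
    y)^3, so |1/j| = 16 |y| as soon as |y| <= 1, and the disc |1/j| <= 2^(12 r) = 2^(3 + nu) is the
    disc |y| <= R.

    The function [nu] is an average. For c = 6s - 3m and a natural number i one has v(c - i) =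
    min(v(i), beta), and nu is the mean of min(v(i), beta) over Z_2. Hence the product of the |c -
    i| for i < n is at most 2^(-n nu), with equality for n = 2^k large, and |e_n| R^n is at most
    2^(-n) / |n!|, which is 2^(-d) with d the number of binary digits 1 of n. This singles out the
    powers of 2.

    For R = 1 the expansion of 1/u - 1 in powers of w does not converge for |w| = 1, so (1) cannot
    be read as an identity between convergent series. The series in y is then truncated to a
    polynomial and (1) is multiplied by a power of u, which turns its left side into a polynomial up
    to a small error. *)

Section FpsTheory.
Variable K : comNzRingType.
Implicit Types (f g y : fps K) (c : K) (a b : nat -> K).

Lemma fps1E n : (1 : fps K) n = (n == 0%N)%:R. Proof. by []. Qed.
Lemma fpsDE f g n : (f + g) n = f n + g n. Proof. by []. Qed.
Lemma fpsNE f n : (- f) n = - f n. Proof. by []. Qed.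
Lemma fpsBE f g n : (f - g) n = f n - g n. Proof. by []. Qed.
Lemma fpsME f g n : (f * g) n = \sum_(i < n.+1) f i * g (n - i)%N.
Proof. by []. Qed.

Lemma fps_sumE (I : Type) (r : seq I) (P : pred I) (F : I -> fps K) n :
  (\sum_(i <- r | P i) F i) n = \sum_(i <- r | P i) F i n.
Proof. by elim/big_rec2: _ => // i x y _ <-. Qed.

Lemma fps_coef0M f g : (f * g) 0%N = f 0%N * g 0%N.
Proof. by rewrite fpsME big_ord1. Qed.

Lemma fps_coef0X f k : (f ^+ k) 0%N = f 0%N ^+ k.
Proof. by elim: k => // k IH; rewrite !exprS fps_coef0M IH. Qed.

Definition fpsC c : fps K := Fps (fun n => if n == 0%N then c else 0).

Lemma fpsCM c f n : (fpsC c * f) n = c * f n.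
Proof.
rewrite fpsME big_ord_recl /= subn0 big1 ?addr0 // => i _.
by rewrite mul0r.
Qed.

Fact fpsC_additive : zmod_morphism fpsC.
Proof. by move=> c d; apply: fpsP => -[|n] /=; rewrite ?subr0. Qed.
Fact fpsC_multiplicative : monoid_morphism fpsC.
Proof.
split; first by apply: fpsP => -[|n].
by move=> c d; apply: fpsP => n; rewrite fpsCM; case: n => [|n] //=; rewrite mulr0.
Qed.
HB.instance Definition _ := GRing.isZmodMorphism.Build K (fps K) fpsC fpsC_additive.
HB.instance Definition _ :=
  GRing.isMonoidMorphism.Build K (fps K) fpsC fpsC_multiplicative.

Definition fps_eqto n f g := forall i, (i <= n)%N -> f i = g i.

Lemma fps_eqtoM n f f' g g' :
  fps_eqto n f f' -> fps_eqto n g g' -> fps_eqto n (f * g) (f' * g').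
Proof.
move=> ff gg i lin; rewrite !fpsME; apply: eq_bigr => j _.
rewrite ff ?gg //; first by rewrite (leq_trans (leq_subr _ _)).
by rewrite (leq_trans _ lin) // -ltnS.
Qed.

Definition fps_lowz m f := forall i, (i < m)%N -> f i = 0.

Lemma fps_lowzM m n f g : fps_lowz m f -> fps_lowz n g -> fps_lowz (m + n) (f * g).
Proof.
move=> fm gn i imn; rewrite fpsME big1 // => j _.
have [jm|mj] := ltnP j m; first by rewrite fm ?mul0r.
by rewrite gn ?mulr0 // ltn_subLR ?(leq_trans imn) ?leq_add2r // -ltnS.
Qed.

Lemma fps_lowzX y k : y 0%N = 0 -> fps_lowz k (y ^+ k).
Proof.
move=> y0; elim: k => [|k IH] // ; rewrite exprS -add1n.
by apply: fps_lowzM => // -[].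
Qed.

Lemma fps_XnE k n : (fpsX ^+ k : fps K) n = (n == k)%:R.
Proof.
elim: k n => [|k IH] n //; rewrite exprS fpsME.
case: n => [|n]; first by rewrite big_ord1 mul0r.
rewrite big_ord_recl mul0r add0r big_ord_recl mul1r IH big1 ?addr0 //=.
  by rewrite /bump /= subn1.
by move=> i _; rewrite mul0r.
Qed.

Lemma fps_XnM k f n : (fpsX ^+ k * f) n = if (n < k)%N then 0 else f (n - k)%N.
Proof.
rewrite fpsME; case: ltnP => kn.
  rewrite big1 // => i _; rewrite fps_XnE; case: eqP => [ik|]; rewrite ?mul0r //.
  by have := ltn_ord i; rewrite ik ltnS leqNgt kn.
rewrite (bigD1 (inord k)) //= inordK ?ltnS // fps_XnE eqxx mul1r big1 ?addr0 //.
move=> i /eqP ik; rewrite fps_XnE; case: eqP => [e|]; rewrite ?mul0r //.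
by case: ik; apply: val_inj => /=; rewrite inordK ?ltnS.
Qed.

Lemma fps_lowzP m f : fps_lowz m f -> exists g, f = fpsX ^+ m * g.
Proof.
move=> fm; exists (Fps (fun n => f (n + m)%N)); apply: fpsP => n.
rewrite fps_XnM; case: ltnP => mn; first exact: fm.
by rewrite /= subnK.
Qed.

Lemma fps_substE a y n M : y 0%N = 0 -> (n <= M)%N ->
  fps_subst a y n = \sum_(k < M.+1) a k * (y ^+ k) n.
Proof.
move=> y0 nM /=; rewrite -!(big_mkord xpredT (fun k => a k * (y ^+ k) n)).
rewrite [RHS](big_cat_nat (n := n.+1)) //= [X in _ + X]big1_seq ?addr0 // => k.
rewrite mem_index_iota => /andP[_ /andP[nk _]].
by rewrite fps_lowzX ?mulr0.
Qed.

Lemma coef_map_fpsC (p : {poly K}) k : (map_poly fpsC p)`_k = fpsC p`_k.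
Proof. exact: coef_map. Qed.

Lemma fps_subst_poly a y n M : y 0%N = 0 -> (n <= M)%N ->
  fps_subst a y n = (map_poly fpsC (\poly_(k < M.+1) a k)).[y] n.
Proof.
move=> y0 nM; rewrite (@fps_substE _ _ _ M) // (@horner_coef_wide _ M.+1).
  rewrite fps_sumE; apply: eq_bigr => k _.
  by rewrite coef_map_fpsC coef_poly ltn_ord fpsCM.
by rewrite /map_poly (leq_trans (size_poly _ _)) ?size_poly.
Qed.

Lemma fps_substD a b y :
  fps_subst (fun k => a k + b k) y = fps_subst a y + fps_subst b y.
Proof.
apply: fpsP => n; rewrite fpsDE /= -big_split /=.
by apply: eq_bigr => k _; rewrite mulrDl.
Qed.

Lemma fps_substM f g y : y 0%N = 0 ->
  fps_subst (f * g) y = fps_subst f y * fps_subst g y.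
Proof.
move=> y0; apply: fpsP => n.
transitivity (((map_poly fpsC (fps_trunc n f)).[y] *
               (map_poly fpsC (fps_trunc n g)).[y]) n); last first.
  by symmetry; apply: (@fps_eqtoM n) => // i lin; apply: fps_subst_poly.
rewrite (@fps_substE _ y n n) // -hornerM -rmorphM.
set p := fps_trunc n f * fps_trunc n g.
rewrite (@horner_coef_wide _ (size p + n.+1)); last first.
  by rewrite /map_poly (leq_trans (size_poly _ _)) ?leq_addr.
rewrite fps_sumE.
rewrite -(big_mkord xpredT (fun k => (f * g) k * (y ^+ k) n)).
rewrite -(big_mkord xpredT (fun k => ((map_poly fpsC p)`_k * y ^+ k) n)).
rewrite [RHS](big_cat_nat (n := n.+1)) ?leq_addl //.
rewrite -[RHS]/(_ + _).
rewrite [X in _ + X]big1_seq ?addr0; last first.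
  move=> k; rewrite mem_index_iota => /andP[_ /andP[nk _]].
  by rewrite coef_map_fpsC fpsCM fps_lowzX ?mulr0.
rewrite !big_mkord; apply: eq_bigr => k _; rewrite coef_map_fpsC fpsCM.
by rewrite -(@fps_mulE _ n k) // -ltnS.
Qed.

Lemma fps_subst_coef0 a y : fps_subst a y 0%N = a 0%N.
Proof. by rewrite /= big_ord1 expr0 mulr1. Qed.

Lemma fps_substC c y : fps_subst (fpsC c) y = fpsC c.
Proof.
apply: fpsP => n /=; rewrite big_ord_recl /= big1 ?addr0.
  by case: n => [|n]; rewrite ?mulr1 ?mulr0.
by move=> i _; rewrite mul0r.
Qed.

Lemma fps_subst1 y : fps_subst (1 : fps K) y = 1.
Proof. by have := fps_substC 1 y; rewrite rmorph1. Qed.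

Lemma fps_subst0 y : fps_subst (0 : fps K) y = 0.
Proof. by have := fps_substC 0 y; rewrite rmorph0. Qed.

Lemma fps_subst_add f g y :
  fps_subst (f + g) y = fps_subst f y + fps_subst g y.
Proof. exact: fps_substD. Qed.

Lemma fps_subst_opp f y : fps_subst (- f) y = - fps_subst f y.
Proof.
apply: fpsP => n; rewrite fpsNE /= -sumrN.
by apply: eq_bigr => k _; rewrite mulNr.
Qed.

Lemma fps_subst_sub f g y :
  fps_subst (f - g) y = fps_subst f y - fps_subst g y.
Proof. by rewrite fps_subst_add fps_subst_opp. Qed.

Lemma fps_subst_nat (n : nat) y : fps_subst (n%:R : fps K) y = n%:R.
Proof. by have := fps_substC n%:R y; rewrite rmorph_nat. Qed.

Lemma fps_subst_exp f y k : y 0%N = 0 -> fps_subst (f ^+ k) y = fps_subst f y ^+ k.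
Proof.
by move=> y0; elim: k => [|k IH]; rewrite ?fps_subst1 // !exprS fps_substM ?IH.
Qed.

Lemma fps_subst_X y : y 0%N = 0 -> fps_subst (fpsX : fps K) y = y.
Proof.
move=> y0; apply: fpsP => n; rewrite (@fps_substE _ _ _ n.+1) //.
rewrite big_ord_recl mul0r add0r big_ord_recl mul1r big1 ?addr0 //=.
by move=> i _; rewrite mul0r.
Qed.

Lemma fps_subst_comp a f y : f 0%N = 0 -> y 0%N = 0 ->
  fps_subst a (fps_subst f y) = fps_subst (fps_subst a f) y.
Proof.
move=> f0 y0; apply: fpsP => n.
have z0 : fps_subst f y 0%N = 0 by rewrite fps_subst_coef0.
rewrite (@fps_substE _ _ _ n) //.
transitivity (\sum_(k < n.+1) \sum_(l < n.+1) a k * (f ^+ k) l * (y ^+ l) n).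
  apply: eq_bigr => k _; rewrite -fps_subst_exp // (@fps_substE _ y n n) // mulr_sumr.
  by apply: eq_bigr => l _; rewrite mulrA.
rewrite exchange_big (@fps_substE _ y n n) //; apply: eq_bigr => l _.
by rewrite -mulr_suml -(@fps_substE a f l n) // -ltnS.
Qed.

Lemma fps_subst_id f : fps_subst f fpsX = f.
Proof.
apply: fpsP => n /=; rewrite big_ord_recr /= fps_XnE eqxx mulr1 big1 ?add0r //.
by move=> i _; rewrite fps_XnE gtn_eqF ?mulr0.
Qed.

(** Geometric series: [f] is 1 - X at X = 1 - f, and [fps_inv f] is the sum of the X^k at the same
    place. *)
Lemma fps_mulVl f : f 0%N = 1 -> f * fps_inv f = 1.
Proof.
move=> f0; have y0 : (1 - f) 0%N = 0 by rewrite fpsBE fps1E f0 subrr.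
have {1}-> : f = fps_subst (1 - fpsX : fps K) (1 - f).
  by rewrite fps_subst_sub fps_subst1 fps_subst_X // subKr.
rewrite /fps_inv -[X in _ * fps_subst X _]/(fps_coef (Fps (fun=> 1))) -fps_substM //.
rewrite (_ : (1 - fpsX) * _ = 1) ?fps_subst1 //.
apply: fpsP => n; rewrite mulrBl mul1r fpsBE -[fpsX]expr1 fps_XnM /=.
by case: n => [|n]; rewrite ?subr0 ?subrr.
Qed.

Lemma fps_inv0 f : fps_inv f 0%N = 1.
Proof. by rewrite /fps_inv fps_subst_coef0. Qed.

Lemma fps_mulrI f g h : f 0%N = 1 -> f * g = f * h -> g = h.
Proof.
move=> f0 e; rewrite -[g]mul1r -[h]mul1r -(@fps_mulVl f) //.
by rewrite [f * _]mulrC -!mulrA e.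
Qed.

Lemma fps_subst_inv f y : f 0%N = 1 -> y 0%N = 0 ->
  fps_subst (fps_inv f) y = fps_inv (fps_subst f y).
Proof.
move=> f0 y0; have z0 : fps_subst f y 0%N = 1 by rewrite fps_subst_coef0.
by apply: (@fps_mulrI (fps_subst f y)) => //; rewrite -fps_substM // !fps_mulVl // fps_subst1.
Qed.

Lemma fps_inv_eq f g : f 0%N = 1 -> f * g = 1 -> fps_inv f = g.
Proof. by move=> f0 fg; apply: (@fps_mulrI f); rewrite ?fps_mulVl. Qed.

End FpsTheory.

(** * Derivation, q -> q^2, q -> -q and logarithmic derivatives *)

Section FpsOperators.
Variable K : fieldType.
Implicit Types (f g l m y : fps K).

Lemma fps_subst_eqto (a : nat -> K) y n : y 0%N = 0 ->
  fps_eqto n (fps_subst a y) (\sum_(k < n.+1) fpsC (a k) * y ^+ k).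
Proof.
move=> y0 i lin; rewrite (@fps_substE _ _ _ _ n) // fps_sumE.
by apply: eq_bigr => k _; rewrite fpsCM.
Qed.

Definition fpsD f : fps K := Fps (fun n => n%:R * f n).
Definition fpsV f : fps K := fps_subst f (fpsX ^+ 2).
Definition fpsN f : fps K := fps_subst f (- fpsX).

Lemma fpsV_coef f n : fpsV f n = if odd n then 0 else f n./2.
Proof.
rewrite /fpsV (@fps_substE _ _ _ _ n) ?fps_XnE //.
have XE k : (((fpsX : fps K) ^+ 2) ^+ k) n = (n == k.*2)%:R.
  by rewrite -exprM mul2n fps_XnE.
case: ifPn => [on|en].
  rewrite big1 // => k _; rewrite XE; case: eqP => [nk|]; rewrite ?mulr0 //.
  by rewrite nk odd_double in on.
have n2n : (n./2 < n.+1)%N by lia.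
rewrite (bigD1 (inord n./2)) //= XE inordK //.
have -> : (n == n./2.*2) by rewrite even_halfK.
rewrite mulr1 big1 ?addr0 // => k /eqP kn; rewrite XE.
case: eqP => [nk|]; rewrite ?mulr0 //; case: kn; apply: val_inj => /=.
have kE : n./2 = k by have := congr1 half nk; rewrite doubleK.
by rewrite -kE inordK.
Qed.

Lemma fpsN_coef f n : fpsN f n = (-1) ^+ n * f n.
Proof.
rewrite /fpsN (@fps_substE _ _ _ _ n) ?fpsNE ?oppr0 //.
have XE k : ((- fpsX : fps K) ^+ k) n = (-1) ^+ k * (n == k)%:R.
  rewrite -[- fpsX]mulN1r exprMn -fps_XnE.
  rewrite (_ : (-1) ^+ k = fpsC ((-1) ^+ k) :> fps K) ?fpsCM //.
  by rewrite rmorphXn rmorphN1.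
rewrite big_ord_recr big1 /= ?XE ?eqxx ?mulr1 ?add0r 1?mulrC // => k _.
by rewrite XE gtn_eqF ?mulr0.
Qed.

Lemma fpsX2_0 : ((fpsX : fps K) ^+ 2) 0%N = 0. Proof. by rewrite fps_XnE. Qed.
Lemma fpsNX_0 : (- (fpsX : fps K)) 0%N = 0. Proof. by rewrite fpsNE /= oppr0. Qed.

Lemma fpsV_mul f g : fpsV (f * g) = fpsV f * fpsV g.
Proof. by rewrite /fpsV fps_substM ?fpsX2_0. Qed.
Lemma fpsV_add f g : fpsV (f + g) = fpsV f + fpsV g.
Proof. exact: fps_subst_add. Qed.
Lemma fpsV_sub f g : fpsV (f - g) = fpsV f - fpsV g.
Proof. exact: fps_subst_sub. Qed.
Lemma fpsV_opp f : fpsV (- f) = - fpsV f.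
Proof. exact: fps_subst_opp. Qed.
Lemma fpsV_exp f k : fpsV (f ^+ k) = fpsV f ^+ k.
Proof. by rewrite /fpsV fps_subst_exp ?fpsX2_0. Qed.
Lemma fpsV_nat (n : nat) : fpsV n%:R = n%:R. Proof. exact: fps_subst_nat. Qed.
Lemma fpsV1 : fpsV 1 = 1. Proof. exact: fps_subst1. Qed.
Lemma fpsV_coef0 f : fpsV f 0%N = f 0%N. Proof. by rewrite fpsV_coef. Qed.
Lemma fpsV_C c : fpsV (fpsC c) = fpsC c. Proof. exact: fps_substC. Qed.
Lemma fpsV_inj : injective fpsV.
Proof.
move=> f g fg; apply: fpsP => n; have := congr1 (fun h : fps K => h n.*2) fg.
by rewrite !fpsV_coef odd_double doubleK.
Qed.

Lemma fpsN_mul f g : fpsN (f * g) = fpsN f * fpsN g.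
Proof. by rewrite /fpsN fps_substM ?fpsNX_0. Qed.
Lemma fpsN_add f g : fpsN (f + g) = fpsN f + fpsN g.
Proof. exact: fps_subst_add. Qed.
Lemma fpsN_sub f g : fpsN (f - g) = fpsN f - fpsN g.
Proof. exact: fps_subst_sub. Qed.
Lemma fpsN_exp f k : fpsN (f ^+ k) = fpsN f ^+ k.
Proof. by rewrite /fpsN fps_subst_exp ?fpsNX_0. Qed.
Lemma fpsN_nat (n : nat) : fpsN n%:R = n%:R. Proof. exact: fps_subst_nat. Qed.
Lemma fpsN_coef0 f : fpsN f 0%N = f 0%N. Proof. by rewrite fpsN_coef mul1r. Qed.
Lemma fpsN_C c : fpsN (fpsC c) = fpsC c. Proof. exact: fps_substC. Qed.
Lemma fpsNV f : fpsN (fpsV f) = fpsV f.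
Proof.
apply: fpsP => n; rewrite fpsN_coef fpsV_coef -signr_odd.
by case: ifP => _; rewrite ?mulr0 ?mul1r.
Qed.
Lemma fpsD_coef f n : fpsD f n = n%:R * f n. Proof. by []. Qed.
Lemma fpsD_add f g : fpsD (f + g) = fpsD f + fpsD g.
Proof. by apply: fpsP => n /=; rewrite mulrDr. Qed.
Lemma fpsD_opp f : fpsD (- f) = - fpsD f.
Proof. by apply: fpsP => n /=; rewrite mulrN. Qed.
Lemma fpsD_sub f g : fpsD (f - g) = fpsD f - fpsD g.
Proof. by rewrite fpsD_add fpsD_opp. Qed.
Lemma fpsD_mul f g : fpsD (f * g) = fpsD f * g + f * fpsD g.
Proof.
apply: fpsP => n; rewrite fpsDE !fpsME /= mulr_sumr -big_split /=.
apply: eq_bigr => i _; have -> : n%:R = i%:R + (n - i)%:R :> K.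
  by rewrite -natrD subnKC // -ltnS.
by ring.
Qed.
Lemma fpsD_C c : fpsD (fpsC c) = 0.
Proof. by apply: fpsP => -[|n] /=; rewrite ?mul0r ?mulr0. Qed.
Lemma fpsD_nat (n : nat) : fpsD n%:R = 0.
Proof. by rewrite -(rmorph_nat (@fpsC K)) fpsD_C. Qed.
Lemma fpsD1 : fpsD 1 = 0. Proof. exact: (fpsD_nat 1). Qed.
Lemma fpsD_natM (n : nat) f : fpsD (n%:R * f) = n%:R * fpsD f.
Proof. by rewrite fpsD_mul fpsD_nat mul0r add0r. Qed.
Lemma fpsD_Xn k : fpsD (fpsX ^+ k) = k%:R * fpsX ^+ k.
Proof.
apply: fpsP => n; rewrite -(rmorph_nat (@fpsC K)) fpsCM /= fps_XnE.
by case: eqP => [->|_]; rewrite ?mulr0.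
Qed.
Lemma fpsD_V f : fpsD (fpsV f) = 2%:R * fpsV (fpsD f).
Proof.
apply: fpsP => n; rewrite -(rmorph_nat (@fpsC K)) fpsCM fpsD_coef !fpsV_coef fpsD_coef.
case: ifPn => [|en]; first by rewrite !mulr0.
by rewrite mulrA -natrM mul2n -{1}[n]odd_double_half (negPf en).
Qed.
Lemma fpsD_N f : fpsD (fpsN f) = fpsN (fpsD f).
Proof. by apply: fpsP => n; rewrite fpsD_coef !fpsN_coef fpsD_coef mulrCA. Qed.

Lemma fpsD_exp f k : fpsD (f ^+ k) = k%:R * f ^+ k.-1 * fpsD f.
Proof.
elim: k => [|k IH]; first by rewrite fpsD1 !mul0r.
rewrite exprS fpsD_mul IH; case: k {IH} => [|k] /=.
  by rewrite !mul0r mulr0 addr0 expr0 !mul1r mulr1.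
by rewrite exprS (natrD _ 1 k.+1); ring.
Qed.

Lemma fpsD_subst f y : y 0%N = 0 ->
  fpsD (fps_subst f y) =
  fps_subst (fun n => n.+1%:R * f n.+1) y * fpsD y.
Proof.
move=> y0; apply: fpsP => n.
rewrite (_ : fpsD _ n = n%:R * fps_subst f y n) //.
rewrite (@fps_substE _ _ _ _ n.+1) // mulr_sumr big_ord_recl.
rewrite (_ : n%:R * _ = 0) ?add0r; last first.
  by rewrite expr0 fps1E; case: n => [|n]; rewrite ?mul0r ?mulr0.
have /(@fps_eqtoM _ n _ _ (fpsD y) (fpsD y)) -> // :=
  @fps_subst_eqto (fun n => n.+1%:R * f n.+1) y n y0.
rewrite mulr_suml fps_sumE; apply: eq_bigr => k _.
rewrite lift0 mulrCA -[n%:R * _]/(fpsD (y ^+ k.+1) n) fpsD_exp -[k.+1.-1]/(k : nat).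
by rewrite -!mulrA -(rmorph_nat (@fpsC K)) !fpsCM; ring.
Qed.

(** A relation rather than a quotient, so that series without constant term, such as [fpsX], have a
    logarithmic derivative too. *)
Definition dlog f l := fpsD f = l * f.

Lemma dlog1 : dlog 1 0. Proof. by rewrite /dlog fpsD1 mul0r. Qed.
Lemma dlogX : dlog fpsX 1.
Proof. by rewrite /dlog -[fpsX]expr1 fpsD_Xn. Qed.
Lemma dlogM f g l m : dlog f l -> dlog g m -> dlog (f * g) (l + m).
Proof. by rewrite /dlog fpsD_mul => -> ->; ring. Qed.
Lemma dlog_exp f l k : dlog f l -> dlog (f ^+ k) (k%:R * l).
Proof.
rewrite /dlog fpsD_exp => ->; case: k => [|k] /=; first by rewrite !mul0r.
by rewrite exprS; ring.
Qed.
Lemma dlogV f l : dlog f l -> dlog (fpsV f) (2%:R * fpsV l).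
Proof. by rewrite /dlog fpsD_V => ->; rewrite fpsV_mul mulrA. Qed.
Lemma dlogN f l : dlog f l -> dlog (fpsN f) (fpsN l).
Proof. by rewrite /dlog fpsD_N => ->; rewrite fpsN_mul. Qed.
Lemma dlog_inv f l : f 0%N = 1 -> dlog f l -> dlog (fps_inv f) (- l).
Proof.
move=> f0 fl; apply: (@fps_mulrI _ f) => //; apply/eqP; rewrite -subr_eq0.
have /eqP := fpsD1; rewrite -(@fps_mulVl _ f) // fpsD_mul fl => /eqP e.
by apply/eqP; rewrite -[RHS]e; ring.
Qed.
Lemma dlog_ex f : f 0%N = 1 -> dlog f (fpsD f * fps_inv f).
Proof. by move=> f0; rewrite /dlog -mulrA [_ * f]mulrC fps_mulVl ?mulr1. Qed.

Hypothesis char0 : forall n : nat, n.+1%:R != 0 :> K.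

Lemma fps_natI (n : nat) f g : n.+1%:R * f = n.+1%:R * g -> f = g.
Proof.
move=> e; apply: fpsP => i; have := congr1 (fun h : fps K => h i) e.
by rewrite -(rmorph_nat (@fpsC K)) !fpsCM => /(mulfI (char0 n)).
Qed.

Lemma fpsD_eq0 f : fpsD f = 0 -> f = fpsC (f 0%N).
Proof.
move=> Df; apply: fpsP => -[|n] //=; have := congr1 (fun h : fps K => h n.+1) Df.
by move=> /eqP /=; rewrite mulf_eq0 (negPf (char0 n)) => /eqP.
Qed.

(** The quotient f/g has derivative 0, so it is constant in characteristic 0. *)
Lemma dlog_uniq f g l : f 0%N = 1 -> g 0%N = 1 -> dlog f l -> dlog g l -> f = g.
Proof.
move=> f0 g0 fl gl.
have /fpsD_eq0 : fpsD (f * fps_inv g) = 0.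
  by rewrite (dlogM fl (dlog_inv g0 gl)) subrr mul0r.
rewrite fps_coef0M f0 fps_inv0 mulr1 rmorph1 => e.
by rewrite -[g]mul1r -e -mulrA [_ * g]mulrC fps_mulVl ?mulr1.
Qed.

(** Modulo q^(n+1) only the factors and summands of index at most n matter, and for these the rule
    is [dlogM]. *)
Lemma dlog_fps_prod (F l : nat -> fps K) :
  (forall n, (0 < n)%N -> dlog (F n) (l n)) ->
  (forall n, (0 < n)%N -> fps_lowz n (F n - 1)) ->
  (forall n, (0 < n)%N -> fps_lowz n (l n)) ->
  dlog (fps_prod F) (Fps (fun n => (\sum_(1 <= k < n.+1) l k) n)).
Proof.
move=> Fl F1 l0.
have Fin1 i n : (i <= n)%N ->
    fps_eqto i (\prod_(1 <= k < i.+1) F k) (\prod_(1 <= k < n.+1) F k).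
  move=> lin; rewrite [X in fps_eqto _ _ X](@big_cat_nat _ _ _ i.+1) //.
  rewrite -[X in fps_eqto _ _ X]/(_ * _) -[X in fps_eqto _ X](mulr1 _).
  apply: fps_eqtoM => //; rewrite big_nat.
  elim/big_rec: _ => // k x /andP[ik _] ex.
  rewrite -[X in fps_eqto _ X](mulr1 1); apply: fps_eqtoM => // j ji.
  apply/eqP; rewrite eq_sym -subr_eq0 -fpsBE F1 //; first exact: leq_trans ik.
  exact: leq_trans ik.
have Feq n : fps_eqto n (fps_prod F) (\prod_(1 <= k < n.+1) F k).
  by move=> i lin; rewrite -(Fin1 i n lin).
have leq n : fps_eqto n (Fps (fun n => (\sum_(1 <= k < n.+1) l k) n))
                        (\sum_(1 <= k < n.+1) l k).
  move=> i lin; rewrite -[LHS]/((\sum_(1 <= k < i.+1) l k) i) !fps_sumE.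
  rewrite [RHS](@big_cat_nat _ _ _ i.+1) // -[RHS]/(_ + _).
  rewrite [X in _ + X]big_nat [X in _ + X]big1 ?addr0 // => k /andP[ik _].
  by rewrite l0 //; apply: leq_trans ik.
have Fin n : dlog (\prod_(1 <= k < n.+1) F k) (\sum_(1 <= k < n.+1) l k).
  elim: n => [|n IH]; first by rewrite !big_geq //; apply: dlog1.
  by rewrite big_nat_recr // [X in dlog _ X]big_nat_recr //; apply: dlogM => //; apply: Fl.
apply: fpsP => n; rewrite (fps_eqtoM (leq n) (Feq n)) // -Fin /=.
by rewrite -(Feq n).
Qed.

End FpsOperators.

(** * Ramanujan's differential equation for E2 *)

Lemma sum_square_split (V : nmodType) (F : nat -> nat -> V) M :
  \sum_(1 <= m < M.+1) \sum_(1 <= n < M.+1) F m n =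
  \sum_(1 <= n < M.+1) (\sum_(1 <= m < n) (F m n + F n m) + F n n).
Proof.
elim: M => [|M IH]; first by rewrite !big_geq.
rewrite big_nat_recr //= [RHS]big_nat_recr //= -IH.
under eq_bigr do rewrite big_nat_recr //=.
rewrite big_split [X in _ + X](@big_nat_recr _ _ _ M.+1) //= -!addrA; congr (_ + _).
by rewrite addrA -big_split.
Qed.

Lemma sum_triangle (V : nmodType) (F : nat -> nat -> V) M :
  (forall m n, (M < m + n)%N -> F m n = 0) ->
  \sum_(1 <= m < M.+1) \sum_(1 <= n < M.+1) F m n =
  \sum_(1 <= N < M.+1) \sum_(1 <= m < N) F m (N - m)%N.
Proof.
move=> F0.
transitivity (\sum_(1 <= m < M.+1) \sum_(m.+1 <= N < M.+1) F m (N - m)%N).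
  apply: eq_big_nat => m /andP[m0 mM].
  rewrite -[m.+1]add1n -{2}(subnK mM) big_addn.
  rewrite (_ : M.+1 - m.+1 + m.+1 - m = (M.+1 - m))%N; last by lia.
  rewrite [LHS](@big_cat_nat _ _ _ (M.+1 - m)) //=; [|lia|lia].
  rewrite [X in _ + X]big_nat [X in _ + X]big1 ?addr0; last first.
    by move=> n /andP[n1 n2]; rewrite F0 //; lia.
  by apply: eq_big_nat => n _; rewrite addnK.
transitivity (\sum_(1 <= m < M.+1) \sum_(1 <= N < M.+1 | (m < N)%N) F m (N - m)%N).
  by apply: eq_bigr => m _; rewrite (@big_nat_widenl _ _ _ m.+1 1).
rewrite (exchange_big_dep_nat (fun=> true)) //=; apply: eq_big_nat => N /andP[_ NM].
by rewrite (@big_nat_widen _ _ _ _ N M.+1) //= ltnW.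
Qed.

Section Ramanujan.
Variable K : fieldType.

(* [lambert n = q^n / (1 - q^n)]. *)
Definition lambert (n : nat) : fps K := Fps (fun k => ((0 < k)%N && (n %| k)%N)%:R).

Definition sigma_fps (r : nat) : fps K :=
  Fps (fun n => if n is 0 then 0 else (\sum_(d <- divisors n) d ^ r)%N%:R).

Lemma lambert_lowz n : (0 < n)%N -> fps_lowz n (lambert n).
Proof.
move=> n0 i lin /=; case: i lin => [|i] lin //=.
by rewrite gtnNdvd.
Qed.

Lemma lambertE n : (0 < n)%N -> lambert n * (1 - fpsX ^+ n) = fpsX ^+ n.
Proof.
move=> n0; apply: fpsP => k.
rewrite mulrBr mulr1 mulrC fpsBE fps_XnM fps_XnE.
case: (ltngtP k n) => [kn|nk|->]; first by rewrite lambert_lowz ?subr0.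
  have k0 : (0 < k)%N by apply: leq_ltn_trans nk.
  have dE : (n %| k - n)%N = (n %| k)%N by rewrite dvdn_subl // ltnW.
  by rewrite /= subn_gt0 nk k0 dE subrr.
by rewrite subnn /= dvdnn n0 subr0.
Qed.

Lemma subXn_coef0 n : (0 < n)%N -> (1 - fpsX ^+ n : fps K) 0%N = 1.
Proof. by case: n => // n _; rewrite fpsBE fps1E fps_XnE subr0. Qed.

Lemma lambertM m n : (0 < m)%N -> (0 < n)%N ->
  lambert m * lambert n = lambert (m + n) * (1 + lambert m + lambert n).
Proof.
move=> m0 n0; have mn0 : (0 < m + n)%N by rewrite addn_gt0 m0.
have := lambertE mn0; have := lambertE n0; have := lambertE m0.
have c0 := subXn_coef0 mn0.
have : ((1 - fpsX ^+ m) * (1 - fpsX ^+ n) * (1 - fpsX ^+ (m + n)) : fps K) 0%N = 1.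
  by rewrite !fps_coef0M !subXn_coef0 // !mulr1.
rewrite exprD; move: (fpsX ^+ m) (fpsX ^+ n) (lambert m) (lambert n) (lambert (m + n)).
move=> a b x y z u xE yE zE; apply: (fps_mulrI u).
have -> : (1 - a) * (1 - b) * (1 - a * b) * (x * y) =
  (x * (1 - a)) * (y * (1 - b)) * (1 - a * b) by ring.
have -> : (1 - a) * (1 - b) * (1 - a * b) * (z * (1 + x + y)) =
  (z * (1 - a * b)) * ((1 - a) * (1 - b) + x * (1 - a) * (1 - b) + y * (1 - b) * (1 - a)).
  by ring.
by rewrite xE yE zE; ring.
Qed.

Lemma fpsD_lambert n : (0 < n)%N -> fpsD (lambert n) = n%:R * (lambert n + lambert n ^+ 2).
Proof.
move=> n0; have e := lambertE n0; have := congr1 (@fpsD K) e.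
have := subXn_coef0 n0.
rewrite fpsD_mul fpsD_sub fpsD1 fpsD_Xn; move: e.
move: (fpsX ^+ n) (lambert n) (fpsD _) => a x d xE u dE.
apply: (fps_mulrI u).
transitivity (d * (1 - a) + x * (0 - n%:R * a) + x * (n%:R * a)); first by ring.
rewrite dE.
have -> : (1 - a) * (n%:R * (x + x ^+ 2)) = n%:R * (x * (1 - a)) * (1 + x) by ring.
by rewrite xE; ring.
Qed.

Lemma sum_divisors (F : nat -> nat) n M : (0 < n)%N -> (n <= M)%N ->
  (\sum_(d <- divisors n) F d)%N = (\sum_(1 <= d < M.+1 | d %| n) F d)%N.
Proof.
move=> n0 nM; rewrite -[RHS]big_filter; apply: perm_big; apply: uniq_perm.
- exact: divisors_uniq.
- by rewrite filter_uniq ?iota_uniq.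
move=> d; rewrite -dvdn_divisors // mem_filter mem_index_iota.
case: (boolP (d %| n)%N) => //= dn; symmetry; apply/andP; split.
  exact: dvdn_gt0 dn.
by rewrite ltnS; apply: leq_trans nM; apply: dvdn_leq.
Qed.

Lemma sigma_fps_eqto r M :
  fps_eqto M (sigma_fps r) (\sum_(1 <= d < M.+1) (d ^ r)%:R * lambert d).
Proof.
move=> i lin; rewrite fps_sumE.
under eq_bigr do rewrite -(rmorph_nat (@fpsC K)) fpsCM.
case: i lin => [|i] iM /=; first by rewrite big1 // => d _; rewrite mulr0.
rewrite (sum_divisors _ _ iM) // natr_sum big_mkcond /=.
by apply: eq_bigr => d _; case: ifP; rewrite ?mulr1 ?mulr0.
Qed.

(** For N = k + 1 the right side is 5 N^3 - 6 N^2 + N, the origin of the coefficients of [S 3],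
    [S 2] and [S 1] in the next lemma. *)
Lemma sum_quadratic (A : comNzRingType) (N : A) k :
  6%:R * \sum_(1 <= m < k.+1) (N ^+ 2 - m%:R * N + m%:R ^+ 2) =
  6%:R * N ^+ 2 * k%:R - 3%:R * N * (k%:R * (k%:R + 1))
    + k%:R * (k%:R + 1) * (2%:R * k%:R + 1).
Proof.
elim: k => [|k IH]; first by rewrite big_geq //; ring.
by rewrite big_nat_recr //= mulrDr IH -natr1; ring.
Qed.

(* Expand the sum of (m^2 + mn + n^2) x_m x_n, with x_n = q^n / (1 - q^n), in
   two ways: splitting along the diagonal, and through the partial fractions
   x_m x_n = x_(m+n) (1 + x_m + x_n). With this weight all off-diagonal sums
   except that of mn x_m x_n cancel. *)
Lemma sigma_sq_eqto M :
  let S r := \sum_(1 <= m < M.+1) (m ^ r)%:R * lambert m in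
  fps_eqto M (12%:R * S 1 ^+ 2 + 6%:R * \sum_(1 <= m < M.+1) (m%:R * lambert m) ^+ 2)
             (5%:R * S 3 - 6%:R * S 2 + S 1).
Proof.
move=> S.
pose x n : fps K := lambert n; pose w (m n : nat) : fps K := m%:R ^+ 2 + m%:R * n%:R + n%:R ^+ 2.
set Delta := \sum_(1 <= m < M.+1) _.
pose T := \sum_(1 <= N < M.+1) \sum_(1 <= m < N) (m%:R * N%:R) * (x m * x N).
pose c (N : nat) : fps K := \sum_(1 <= m < N) (N%:R ^+ 2 - m%:R * N%:R + m%:R ^+ 2).
pose T' := \sum_(1 <= N < M.+1) \sum_(1 <= m < N)
   (N%:R ^+ 2 - m%:R * N%:R + m%:R ^+ 2) * (x m * x N).
pose P := \sum_(1 <= m < M.+1) \sum_(1 <= n < M.+1) w m n * (x m * x n).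
have S1E : S 1%N ^+ 2 = 2%:R * T + Delta.
  rewrite expr2 [LHS]mulr_suml.
  under eq_bigr do rewrite mulr_sumr.
  rewrite sum_square_split big_split /=; congr (_ + _).
    rewrite /T mulr_sumr; apply: eq_bigr => N _; rewrite mulr_sumr.
    by apply: eq_bigr => m _; rewrite !expn1 -/(x m) -/(x N); ring.
have PE : P = 4%:R * T + 2%:R * T' + 3%:R * Delta.
  rewrite /P sum_square_split big_split /=; congr (_ + _).
    rewrite /T /T' !mulr_sumr -big_split /=; apply: eq_bigr => N _.
    rewrite !mulr_sumr -big_split /=; apply: eq_bigr => m _.
    by rewrite /w; ring.
  by rewrite /Delta mulr_sumr; apply: eq_bigr => m _; rewrite /w /x; ring.
have PE' : fps_eqto M P (\sum_(1 <= N < M.+1) c N * x N + 2%:R * T').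
  move=> i iM; transitivity ((\sum_(1 <= N < M.+1) \sum_(1 <= m < N)
      w m (N - m)%N * (x m * x (N - m)%N)) i).
    rewrite /P !fps_sumE; under eq_bigr do rewrite fps_sumE.
    under [RHS]eq_bigr do rewrite fps_sumE.
    pose F m n := if (0 < m)%N && (0 < n)%N then (w m n * (x m * x n)) i else 0.
    transitivity (\sum_(1 <= m < M.+1) \sum_(1 <= n < M.+1) F m n).
      apply: eq_big_nat => m /andP[m0 _]; apply: eq_big_nat => n /andP[n0 _].
      by rewrite /F m0 n0.
    rewrite sum_triangle.
      apply: eq_big_nat => N /andP[N0 _]; apply: eq_big_nat => m /andP[m0 mN].
      by rewrite /F m0 subn_gt0 mN.
    move=> m n mn; rewrite /F; case: ifP => // /andP[m0 n0].
    have -> : w m n = fpsC (m%:R ^+ 2 + m%:R * n%:R + n%:R ^+ 2).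
      by rewrite !rmorphD !rmorphXn rmorphM /= !rmorph_nat.
    rewrite fpsCM (fps_lowzM (lambert_lowz m0) (lambert_lowz n0)) ?mulr0 //.
    exact: leq_ltn_trans mn.
  congr (fps_coef _ i); rewrite /T' mulr_sumr -big_split /=.
  apply: eq_big_nat => N /andP[N0 _].
  pose v (m : nat) : fps K := N%:R ^+ 2 - m%:R * N%:R + m%:R ^+ 2.
  (* The weight [v] is invariant under m -> N - m, so the products of [x N] with [x m] and with
     [x (N - m)] contribute equally; this is the factor 2 in front of [T']. *)
  have rev : \sum_(1 <= m < N) v m * (x (N - m)%N * x N) =
             \sum_(1 <= m < N) v m * (x m * x N).
    rewrite big_nat_rev /=; apply: eq_big_nat => m /andP[m0 mN].
    rewrite (_ : 1 + N - m.+1 = N - m)%N; last by lia.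
    rewrite subKn 1?ltnW // /v natrB 1?ltnW //; congr (_ * _); ring.
  rewrite mulr2n mulrDl mul1r -{1}rev /c mulr_suml -!big_split /=.
  apply: eq_big_nat => m /andP[m0 mN]; rewrite /x lambertM ?subn_gt0 //.
  by rewrite subnKC 1?ltnW // /w /v natrB 1?ltnW //; ring.
have cE : 6%:R * \sum_(1 <= N < M.+1) c N * x N = 5%:R * S 3%N - 6%:R * S 2%N + S 1%N.
  rewrite !mulr_sumr -sumrB -big_split /=; apply: eq_big_nat => N /andP[N0 _].
  rewrite /c mulrA; case: N N0 => // N _.
  by rewrite sum_quadratic -/(x _) !natrX -natr1; ring.
move=> i iM; have := PE' i iM.
rewrite -cE S1E PE => e; pose six : K := 6%:R.
transitivity ((fpsC six * (4%:R * T + 2%:R * T' + 3%:R * Delta)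
   - fpsC six * (2%:R * T')) i).
  congr (fps_coef _ i); rewrite /six rmorph_nat; ring.
rewrite -mulrBr !fpsCM !fpsBE e fpsDE addrK -fpsCM /six rmorph_nat //.
Qed.

(** With x_m = q^m / (1 - q^m), D x_m = m (x_m + x_m^2), so the diagonal sum of the previous lemma
    is D(S 1) - S 2, and S 2 cancels. *)
Lemma ramanujan_sigma :
  12%:R * sigma_fps 1 ^+ 2 = 5%:R * sigma_fps 3 + sigma_fps 1 - 6%:R * fpsD (sigma_fps 1).
Proof.
apply: fpsP => M; have E r := @sigma_fps_eqto r M.
pose S r : fps K := \sum_(1 <= m < M.+1) (m ^ r)%:R * lambert m.
have C2 : \sum_(1 <= m < M.+1) (m%:R * lambert m) ^+ 2 = fpsD (S 1%N) - S 2%N.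
  rewrite /S (_ : fpsD _ = \sum_(1 <= m < M.+1) fpsD ((m ^ 1)%:R * lambert m)).
    rewrite -sumrB; apply: eq_big_nat => m /andP[m0 _].
    by rewrite fpsD_natM fpsD_lambert // expn1 natrX; ring.
  elim/big_rec2: _ => [|m y1 y2 _ <-]; [exact: (fpsD_nat _ 0) | exact: fpsD_add].
have := @sigma_sq_eqto M M (leqnn M); cbv zeta; rewrite C2 -/(S 1%N) -/(S 2%N) -/(S 3%N).
set c12 := (12%:R : fps K); set c5 := (5%:R : fps K); set c6 := (6%:R : fps K) => e.
have eM c f g : fps_eqto M f g -> (c * f) M = (c * g) M.
  by move=> fg; apply: (fps_eqtoM _ fg (leqnn M)).
transitivity ((c12 * S 1%N ^+ 2) M).
  by rewrite !expr2; apply: eM; apply: fps_eqtoM.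
transitivity ((c5 * S 3%N + S 1%N - c6 * fpsD (S 1%N)) M).
  apply/eqP; rewrite -subr_eq0 -fpsBE; move/eqP: e; rewrite -subr_eq0 -fpsBE.
  congr (fps_coef _ M == 0); ring.
symmetry; rewrite !fpsBE !fpsDE; congr (_ + _ - _).
- exact: eM.
- exact: E.
- by apply: eM => i iM; rewrite !fpsD_coef E.
Qed.

End Ramanujan.

(** * The Hecke operator T_2 on divisor sums *)

Lemma sum_even_odd (F : nat -> nat) M :
  (\sum_(1 <= d < M.*2.+1) F d =
   \sum_(1 <= d < M.+1) F d.*2 + \sum_(0 <= d < M) F d.*2.+1)%N.
Proof.
elim: M => [|M IH]; first by rewrite !big_geq.
rewrite doubleS (@big_nat_recr _ _ _ M.*2.+2) // (@big_nat_recr _ _ _ M.*2.+1) // IH.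
rewrite (@big_nat_recr _ _ _ M.+1 1 (fun d => F d.*2)) //.
rewrite (@big_nat_recr _ _ _ M 0 (fun d => F d.*2.+1)) //=.
by rewrite -addnA [RHS]addnACA [X in (_ + X = _)%N]addnC.
Qed.

(** Separate even and odd divisors: the even divisors of 2m are the doubles of the divisors of m,
    those of m the doubles of the divisors of m/2, and m and 2m have the same odd divisors. *)
Lemma sum_divisors_double r m : (0 < m)%N ->
  (\sum_(d <- divisors m.*2) d ^ r
   + 2 ^ r * (if odd m then 0 else \sum_(d <- divisors m./2) d ^ r) =
   (1 + 2 ^ r) * \sum_(d <- divisors m) d ^ r)%N.
Proof.
move=> m0.
have E n M : (0 < n <= M.*2)%N ->
    (\sum_(d <- divisors n) d ^ r =
     2 ^ r * (\sum_(1 <= d < M.+1 | d.*2 %| n) d ^ r)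
     + \sum_(0 <= d < M | d.*2.+1 %| n) d.*2.+1 ^ r)%N.
  move=> /andP[n0 nM]; rewrite (sum_divisors _ n0 nM) big_mkcond sum_even_odd /=.
  rewrite -!big_mkcond big_distrr /=; congr (_ + _)%N.
  by apply: eq_bigr => d _; rewrite -mul2n expnMn.
rewrite (E m.*2 m) ?double_gt0 ?m0 ?leqnn //.
have -> : (\sum_(1 <= d < m.+1 | d.*2 %| m.*2) d ^ r)%N = (\sum_(d <- divisors m) d ^ r)%N.
  rewrite (sum_divisors _ m0 (leqnn m)); apply: eq_bigl => d.
  by rewrite -!muln2 dvdn_pmul2r.
set I := (if _ then _ else _).
set S := (\sum_(d <- divisors m) d ^ r)%N; set O := (\sum_(0 <= d < m | _) _)%N.
suff -> : S = (2 ^ r * I + O)%N by move: S I O => *; ring.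
rewrite /S (E m m) ?m0 -?addnn ?leq_addr //; congr (_ + _)%N; last first.
  apply: eq_bigl => d; rewrite -[m.*2]muln2 Gauss_dvdl //.
  by rewrite coprimen2 /= odd_double.
rewrite /I; congr (_ * _)%N; case: ifPn => om.
  rewrite big1 // => d dm; have : (2 %| m)%N by apply: dvdn_trans dm; rewrite -mul2n dvdn_mulr.
  by rewrite dvdn2 om.
have mE : m = m./2.*2 by rewrite even_halfK.
rewrite (@sum_divisors _ m./2 m); [|lia|lia].
by apply: eq_bigl => d; rewrite {1}mE -!muln2 dvdn_pmul2r.
Qed.

Section Hecke.
Variable K : fieldType.

(** The left side is twice the even part, that is 2 VU of the series; the identity is V applied to
    the eigenvalue equation U = (1 + 2^r) - 2^r V. *)
Lemma sigma_fps_even r :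
  sigma_fps K r + fpsN (sigma_fps K r) =
  2%:R * (1 + 2%:R ^+ r) * fpsV (sigma_fps K r)
  - 2%:R * 2%:R ^+ r * fpsV (fpsV (sigma_fps K r)).
Proof.
apply: fpsP => n.
have -> : 2%:R * (1 + 2%:R ^+ r) = fpsC (2%:R * (1 + 2%:R ^+ r)) :> fps K.
  by rewrite -(rmorph_nat (@fpsC K)) -rmorphXn -(rmorph1 (@fpsC K)) -rmorphD -rmorphM.
have -> : 2%:R * 2%:R ^+ r = fpsC (2%:R * 2%:R ^+ r) :> fps K.
  by rewrite -(rmorph_nat (@fpsC K)) -rmorphXn -rmorphM.
rewrite fpsDE fpsBE !fpsCM fpsN_coef !fpsV_coef -signr_odd.
have [on|en] := boolP (odd n); first by rewrite expr1 mulN1r subrr !mulr0 subr0.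
rewrite expr0 mul1r.
have [n0|n0] := posnP n; first by rewrite n0 /=; ring.
have m0 : (0 < n./2)%N by case: n n0 en => [|[]].
have nE : n = n./2.*2 by rewrite even_halfK.
have := congr1 (fun k => k%:R : K) (sum_divisors_double r m0).
move: (n./2) m0 nE => m m0 ->; rewrite !natrM !natrD natrX natrM.
have LE k : (0 < k)%N -> sigma_fps K r k = (\sum_(d <- divisors k) d ^ r)%:R by case: k.
rewrite (LE m.*2) ?double_gt0 // (LE m) //.
have -> : ((if odd m then 0 else \sum_(d <- divisors m./2) d ^ r)%N%:R : K) =
          (if odd m then 0 else sigma_fps K r m./2).
  by case: ifP => // om; rewrite LE //; case: m m0 om => [|[]].
by move=> /(canRL (addrK _)) ->; rewrite natrX; ring.
Qed.

End Hecke.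

(** Leaves an identity for [ring]: the multiplier [c] certifies that x - y is in the ideal generated
    by u - v. Several hypotheses are used by applying it repeatedly. *)
Lemma eq_by_sub (A : pzRingType) (c x y u v : A) :
  u = v -> x - y = c * (u - v) -> x = y.
Proof. by move=> ->; rewrite subrr mulr0 => /eqP; rewrite subr_eq0 => /eqP. Qed.

Section Coefficients.
Variable K : fieldType.

Lemma fps_coef1M (f g : fps K) : (f * g) 1%N = f 0%N * g 1%N + f 1%N * g 0%N.
Proof. by rewrite fpsME big_ord_recl big_ord1. Qed.

Lemma fps_natM_coef (k : nat) (f : fps K) n : (k%:R * f) n = k%:R * f n.
Proof. by rewrite -(rmorph_nat (@fpsC K)) fpsCM. Qed.

End Coefficients.

(** * Level 4 relations *)

(* [eps = t - e4 * o4] measures the failure of the expected relation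
   [o4^2 = V (e4 * o4)]. Differentiating [V t = o4^2] bounds the order of
   [o4 * eps] below by twice that of [eps], which forces [eps = 0]. *)
Section LevelFourRelations.
Variable K : fieldType.
Hypothesis char0 : forall n : nat, n.+1%:R != 0 :> K.
Variables a e4 o4 t X : fps K.
Hypothesis V_E2 : 2%:R * fpsV a = a + e4 + 16%:R * o4.
Hypothesis VV_E2 : 4%:R * fpsV (fpsV a) = a + 3%:R * e4.
Hypothesis V_e4_16o4 : fpsV (e4 + 16%:R * o4) = e4 - 8%:R * o4.
Hypothesis ramanujan_E2 : 12%:R * fpsD a = a ^+ 2 - X.
Hypothesis V_E4 : fpsV X = (e4 - 8%:R * o4) ^+ 2 + 192%:R * o4 ^+ 2.
Hypothesis V_t : fpsV t = o4 ^+ 2.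
Let eps : fps K := t - e4 * o4.
Let p := fpsV e4.
Let q := fpsV o4.
Let X1 : fps K := (e4 + 16%:R * o4) ^+ 2 + 192%:R * t.

(** Every term of [V_E4] is in the image of V: [e4 - 8 o4] is V(e4 + 16 o4) and [o4 ^+ 2] is V t.
    Since V is injective, it can be removed. *)
Let E4_t : X = X1.
Proof.
apply: fpsV_inj; rewrite V_E4 /X1 fpsV_add fpsV_mul fpsV_exp V_e4_16o4 V_t fpsV_nat.
by [].
Qed.

Let p_q : p + 16%:R * q = e4 - 8%:R * o4.
Proof. by rewrite -V_e4_16o4 fpsV_add fpsV_mul fpsV_nat. Qed.

Let pq : p * q + fpsV eps = o4 ^+ 2.
Proof. by rewrite -V_t /eps fpsV_sub fpsV_mul -/p -/q; ring. Qed.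

Let D1 : 12%:R * fpsD a = a ^+ 2 - X1.
Proof. by rewrite ramanujan_E2 E4_t. Qed.

Let D2 : 6%:R * fpsD (fpsV a) = fpsV a ^+ 2 - ((e4 - 8%:R * o4) ^+ 2 + 192%:R * o4 ^+ 2).
Proof.
have := congr1 (@fpsV K) ramanujan_E2.
rewrite fpsV_mul fpsV_nat fpsV_sub fpsV_exp V_E4 => <-.
by rewrite fpsD_V; ring.
Qed.

Let D4 : 3%:R * fpsD (fpsV (fpsV a)) =
  fpsV (fpsV a) ^+ 2 - ((p - 8%:R * q) ^+ 2 + 192%:R * q ^+ 2).
Proof.
have := congr1 (@fpsV K) D2.
rewrite !(fpsV_nat, fpsV_mul, fpsV_sub, fpsV_exp, fpsV_add) -/p -/q => <-.
by rewrite fpsD_V; ring.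
Qed.

Let X4E : (p - 8%:R * q) ^+ 2 + 192%:R * q ^+ 2 =
  (e4 - 8%:R * o4) ^+ 2 - 48%:R * (o4 ^+ 2 - fpsV eps).
Proof. by rewrite -p_q -pq; ring. Qed.

(** [VV_E2] writes [e4] through E2(q) and E2(q^4). Differentiate it and insert Ramanujan's equation
    at q and at q^4; [eps] enters through t = e4 o4 + eps, and V eps through [pq]. The same is done
    for [o4] with [V_E2]. *)
Let De : 6%:R * fpsD e4 = e4 * (a - e4 + 80%:R * o4) + 32%:R * eps - 128%:R * fpsV eps.
Proof.
have h := congr1 (@fpsD K) VV_E2; rewrite fpsD_add !fpsD_natM in h.
apply: (fps_natI char0 (n := 5)).
have -> : 6%:R * (6%:R * fpsD e4) = 16%:R * (3%:R * fpsD (fpsV (fpsV a))) - 12%:R * fpsD a.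
  by refine (eq_by_sub (c := - 12%:R) h _); ring.
rewrite D4 D1 X4E mulrBr.
have -> : 16%:R * fpsV (fpsV a) ^+ 2 = (a + 3%:R * e4) ^+ 2 by rewrite -VV_E2; ring.
by rewrite /X1 /eps; ring.
Qed.

Let Do : 6%:R * fpsD o4 = o4 * (a + 5%:R * e4 - 16%:R * o4) + 4%:R * eps + 8%:R * fpsV eps.
Proof.
have h := congr1 (@fpsD K) V_E2; rewrite !fpsD_add !fpsD_natM in h.
apply: (fps_natI char0 (n := 95)).
have -> : 96%:R * (6%:R * fpsD o4) = 12%:R * (6%:R * fpsD (fpsV a)) - 3%:R * (12%:R * fpsD a)
   - 6%:R * (6%:R * fpsD e4).
  by refine (eq_by_sub (c := - 36%:R) h _); ring.
rewrite De D1 D2 mulrBr.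
have -> : 12%:R * fpsV a ^+ 2 = 3%:R * (a + e4 + 16%:R * o4) ^+ 2 by rewrite -V_E2; ring.
by rewrite /X1 /eps; ring.
Qed.

Let eps_V : 8%:R * (o4 * eps) =
  fpsV eps * (64%:R * q + 8%:R * p - 16%:R * o4 - 2%:R * (a + 5%:R * e4 - 16%:R * o4))
  + fpsV (fpsV eps) * (16%:R * p - 256%:R * q) + 12%:R * fpsV (fpsD eps).
Proof.
have tE : t = e4 * o4 + eps by rewrite /eps; ring.
have h : 12%:R * (o4 * fpsD o4) = 12%:R * (fpsV (fpsD e4) * q + p * fpsV (fpsD o4) + fpsV (fpsD eps)).
  have := congr1 (@fpsD K) V_t; rewrite fpsD_V tE fpsD_add fpsD_mul !fpsV_add !fpsV_mul -/p -/q.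
  by rewrite fpsD_exp /= => e; refine (eq_by_sub (c := - 6%:R) e _); ring.
have VDe := congr1 (@fpsV K) De; have VDo := congr1 (@fpsV K) Do.
rewrite !(fpsV_nat, fpsV_mul, fpsV_sub, fpsV_exp, fpsV_add) -/p -/q in VDe VDo.
have {}h : 2%:R * o4 * (6%:R * fpsD o4) = 2%:R * (6%:R * fpsV (fpsD e4)) * q
    + 2%:R * p * (6%:R * fpsV (fpsD o4)) + 12%:R * fpsV (fpsD eps).
  by refine (eq_by_sub (c := 1) h _); ring.
rewrite Do VDe VDo in h.
refine (eq_by_sub (c := 1) h _).
refine (eq_by_sub (c := 2%:R * p * q) V_E2 _).
refine (eq_by_sub (c := 8%:R * p * q) p_q _).
refine (eq_by_sub (c := 2%:R * (a + 5%:R * e4 - 16%:R * o4)) pq _).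
by rewrite /eps !(fpsV_nat, fpsV_mul, fpsV_sub) -/p -/q -/eps; ring.
Qed.

Hypothesis e4_0 : e4 0%N = 1.
Hypothesis o4_0 : o4 0%N = 0.
Hypothesis o4_1 : o4 1%N = 1.

Let eps_lowz k : fps_lowz k eps.
Proof.
have t0 : t 0%N = 0 by rewrite -fpsV_coef0 V_t fps_coef0X o4_0 expr0n.
have t1 : t 1%N = 1.
  have := congr1 (fun h : fps K => h 2%N) V_t; rewrite fpsV_coef -[LHS]/(t 1%N) => ->.
  by rewrite expr2 fpsME !big_ord_recl big_ord0 /= /bump /= o4_0 o4_1 !mul0r mulr0 mul1r addr0 add0r addr0.
elim: k => // k IH i; rewrite ltnS leq_eqVlt => /orP[/eqP ->|]; last exact: IH.
(* If [eps] has order at least k, the right side of [eps_V] has order at least 2k, and the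
   coefficient of index k + 1 is needed. As 2k > k + 1 only for k >= 2, the coefficients 0 and 1 of
   [eps] are computed directly. *)
case: k IH => [|[|k]] IH.
- by rewrite /eps fpsBE fps_coef0M o4_0 mulr0 t0 subr0.
- by rewrite /eps fpsBE fps_coef1M e4_0 o4_0 o4_1 t1 mulr0 addr0 mulr1 subrr.
have Vlow m (f : fps K) : fps_lowz m f -> fps_lowz m.*2 (fpsV f).
  move=> fm j jm; rewrite fpsV_coef; case: ifP => // oj; apply: fm; lia.
have low1 (f g : fps K) m : fps_lowz m f -> fps_lowz m (f * g).
  by move=> fm; rewrite -[m]addn0; apply: fps_lowzM.
have E := congr1 (fun h : fps K => h k.+3) eps_V; move: E.
have [w oE] : exists w, o4 = fpsX ^+ 1 * w.
  by apply: fps_lowzP => -[].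
have w0 : w 0%N = 1 by rewrite -o4_1 oE fps_XnM.
have -> : (8%:R * (o4 * eps)) k.+3 = 8%:R * eps k.+2.
  rewrite fps_natM_coef; congr (_ * _).
  transitivity ((w * eps) k.+2); first by rewrite oE -mulrA fps_XnM.
  rewrite fpsME big_ord_recl w0 mul1r subn0 big1 ?addr0 // => j _.
  by rewrite lift0 IH ?mulr0 //; lia.
have V1 : fps_lowz k.+2.*2 (fpsV eps) := Vlow _ _ IH.
have V2 : fps_lowz k.+2.*2.*2 (fpsV (fpsV eps)) := Vlow _ _ V1.
have V3 : fps_lowz k.+2.*2 (fpsV (fpsD eps)).
  by apply: Vlow => j jk; rewrite fpsD_coef IH ?mulr0.
rewrite !fpsDE fps_natM_coef (low1 _ _ _ V1) ?(low1 _ _ _ V2) ?V3; [|lia|lia|lia].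
rewrite mulr0 !addr0 => /eqP; rewrite mulf_eq0 (negPf (char0 7)) => /eqP //.
Qed.

Let eps0 : eps = 0.
Proof. by apply: fpsP => n; rewrite (eps_lowz (ltnSn n)). Qed.

Lemma level4_product : t = e4 * o4.
Proof. by apply/eqP; rewrite -subr_eq0 -/eps eps0. Qed.

Lemma level4_De : 6%:R * fpsD e4 = e4 * (a - e4 + 80%:R * o4).
Proof. by rewrite De eps0 /fpsV fps_subst0; ring. Qed.

Lemma level4_Do : 6%:R * fpsD o4 = o4 * (a + 5%:R * e4 - 16%:R * o4).
Proof. by rewrite Do eps0 /fpsV fps_subst0; ring. Qed.

Lemma level4_X : X = (e4 + 16%:R * o4) ^+ 2 + 192%:R * (e4 * o4).
Proof. by rewrite E4_t /X1 level4_product. Qed.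

End LevelFourRelations.

(** * Eisenstein series of weight 2 and level 4 *)

Section LevelFour.
Variable K : fieldType.
Hypothesis char0 : forall n : nat, n.+1%:R != 0 :> K.

Definition E2 : fps K := 1 - 24%:R * sigma_fps K 1.
(* [e4 = (4 E2(q^4) - E2(q)) / 3 = theta^4] and
   [o4 = (3 E2(q^2) - E2(q) - 2 E2(q^4)) / 24 = \sum_(n odd) sigma(n) q^n]. *)
Definition e4 : fps K := 1 + 8%:R * sigma_fps K 1 - 32%:R * fpsV (fpsV (sigma_fps K 1)).
Definition o4 : fps K := sigma_fps K 1 - 3%:R * fpsV (sigma_fps K 1) + 2%:R * fpsV (fpsV (sigma_fps K 1)).

Let a := E2.

Lemma E4E : E4 = 1 + 240%:R * sigma_fps K 3. Proof. by []. Qed.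

Lemma ramanujan_E2 : 12%:R * fpsD a = a ^+ 2 - E4.
Proof.
rewrite E4E /a /E2 fpsD_sub fpsD1 fpsD_natM.
have := ramanujan_sigma K.
move: (fpsD (sigma_fps K 1)) (sigma_fps K 3) (sigma_fps K 1) => dL L3 L h.
by refine (eq_by_sub (c := - 48%:R) h _); ring.
Qed.

Lemma V_E2 : 2%:R * fpsV a = a + e4 + 16%:R * o4.
Proof. by rewrite /a /E2 /e4 /o4 fpsV_sub fpsV1 fpsV_mul fpsV_nat; ring. Qed.

Lemma VV_E2 : 4%:R * fpsV (fpsV a) = a + 3%:R * e4.
Proof. by rewrite /a /E2 /e4 !fpsV_sub !fpsV1 !fpsV_mul !fpsV_nat; ring. Qed.

Lemma N_o4 : fpsN o4 = - o4.
Proof.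
have e : fpsN (sigma_fps K 1) = 6%:R * fpsV (sigma_fps K 1) - 4%:R * fpsV (fpsV (sigma_fps K 1)) - sigma_fps K 1.
  by apply: (addrI (sigma_fps K 1)); rewrite sigma_fps_even; ring.
rewrite /o4 fpsN_add fpsN_sub !fpsN_mul !fpsN_nat !fpsNV e; ring.
Qed.

(** [e4 + 16 o4] is 2 E2(q^2) - E2(q), the weight 2 Eisenstein series of level 2, so this is a
    linear relation between E2 at q, q^2 and q^4. *)
Lemma V_e4_16o4 : fpsV (e4 + 16%:R * o4) = e4 - 8%:R * o4.
Proof.
have -> : e4 + 16%:R * o4 = 2%:R * fpsV a - a by rewrite V_E2; ring.
apply: (fps_natI char0 (n := 3)); rewrite fpsV_sub fpsV_mul fpsV_nat.
transitivity (2%:R * (4%:R * fpsV (fpsV a)) - 2%:R * (2%:R * fpsV a)); first by ring.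
by rewrite V_E2 VV_E2; ring.
Qed.

Lemma E4_even : E4 + fpsN E4 = 2%:R * (9%:R * fpsV E4 - 8%:R * fpsV (fpsV E4)) :> fps K.
Proof.
rewrite !E4E fpsN_add !fpsV_add !fpsN_mul !fpsV_mul !fpsN_nat !fpsV_nat !fpsV1.
rewrite (_ : fpsN 1 = 1); last exact: (fpsN_nat K 1).
transitivity (2%:R + 240%:R * (sigma_fps K 3 + fpsN (sigma_fps K 3))); first by ring.
by rewrite sigma_fps_even; ring.
Qed.

(** Add Ramanujan's equations at q and at -q. The derivative of the even part [m] of E2 is known
    from the equations at q^2 and q^4, and E4(q) + E4(-q) from [E4_even]. The terms in E4(q^4)
    cancel, and 6 E4(q^2) remains, expressed by squares of weight 2 series. *)
Lemma V_E4 : fpsV E4 = (e4 - 8%:R * o4) ^+ 2 + 192%:R * o4 ^+ 2.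
Proof.
pose a2 := fpsV a; pose a4 := fpsV a2; pose m := 3%:R * a2 - 2%:R * a4.
have aE : a = m - 24%:R * o4.
  by rewrite /m /a4 /a2 /a /E2 /o4 !fpsV_sub !fpsV1 !fpsV_mul !fpsV_nat; ring.
have NaE : fpsN a = m + 24%:R * o4.
  by rewrite {1}aE fpsN_sub !fpsN_mul N_o4 /m fpsN_sub !fpsN_mul !fpsN_nat /a4 /a2 !fpsNV; ring.
have X1 := ramanujan_E2.
have X2 : 6%:R * fpsD a2 = a2 ^+ 2 - fpsV E4.
  have := congr1 (@fpsV K) X1; rewrite fpsV_mul fpsV_nat fpsV_sub fpsV_exp => <-.
  by rewrite /a2 fpsD_V; ring.
have X4 : 3%:R * fpsD a4 = a4 ^+ 2 - fpsV (fpsV E4).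
  have := congr1 (@fpsV K) X2; rewrite fpsV_mul fpsV_nat fpsV_sub fpsV_exp => <-.
  by rewrite /a4 fpsD_V; ring.
have XN : 12%:R * fpsD (fpsN a) = fpsN a ^+ 2 - fpsN E4.
  have := congr1 (@fpsN K) X1.
  by rewrite fpsN_mul fpsN_nat fpsN_sub fpsN_exp -fpsD_N.
have -> : e4 - 8%:R * o4 = 2%:R * a4 - a2.
  by rewrite /e4 /o4 /a4 /a2 /a /E2 !fpsV_sub !fpsV1 !fpsV_mul !fpsV_nat; ring.
have H : 12%:R * fpsD a + 12%:R * fpsD (fpsN a) =
         12%:R * (6%:R * fpsD a2) - 16%:R * (3%:R * fpsD a4).
  have := congr1 (@fpsD K) aE; have := congr1 (@fpsD K) NaE.
  by rewrite /m !(fpsD_sub, fpsD_add) !fpsD_natM => -> ->; ring.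
rewrite X1 X2 X4 XN NaE in H.
have HE := E4_even.
apply: (fps_natI char0 (n := 5)).
refine (eq_by_sub (c := - 1) H _).
by refine (eq_by_sub (c := - 1) HE _); rewrite aE /m; ring.
Qed.

Lemma fpsN_fixedP (f : fps K) : fpsN f = f -> exists g, f = fpsV g.
Proof.
move=> Nf; exists (Fps (fun n => f n.*2)); apply: fpsP => n; rewrite fpsV_coef.
case: ifPn => [on|/even_halfK /= -> //].
have := congr1 (fun h : fps K => h n) Nf.
rewrite fpsN_coef -signr_odd on expr1 mulN1r => /esym/eqP.
rewrite -addr_eq0 -mulr2n -mulr_natl mulf_eq0 => /orP[|/eqP//].
by rewrite (negPf (char0 1)).
Qed.

Lemma sigma_fps_coef1 r : sigma_fps K r 1%N = 1.
Proof. by rewrite /= (_ : divisors 1 = [:: 1%N]) // big_seq1 exp1n. Qed.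

Lemma e4_coef0 : e4 0%N = 1.
Proof. by rewrite /e4 fpsBE fpsDE !fps_natM_coef !fpsV_coef0 /= !mulr0 addr0 subr0. Qed.

Lemma o4_coef0 : o4 0%N = 0.
Proof. by rewrite /o4 fpsDE fpsBE !fps_natM_coef !fpsV_coef0 /= !mulr0 addr0 subr0. Qed.

Lemma o4_coef1 : o4 1%N = 1.
Proof.
by rewrite /o4 fpsDE fpsBE !fps_natM_coef !fpsV_coef sigma_fps_coef1 !mulr0 addr0 subr0.
Qed.

Lemma o4_sq_V : exists t, fpsV t = o4 ^+ 2.
Proof.
have [t tE] : exists t, o4 ^+ 2 = fpsV t.
  by apply: fpsN_fixedP; rewrite fpsN_exp N_o4 sqrrN.
by exists t.
Qed.

Lemma level4_relations :
  [/\ 6%:R * fpsD e4 = e4 * (E2 - e4 + 80%:R * o4),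
      6%:R * fpsD o4 = o4 * (E2 + 5%:R * e4 - 16%:R * o4) &
      E4 = (e4 + 16%:R * o4) ^+ 2 + 192%:R * (e4 * o4)].
Proof.
have [t Vt] := o4_sq_V.
have A1 := level4_De char0 V_E2 VV_E2 V_e4_16o4 ramanujan_E2 V_E4 Vt.
have A2 := level4_Do char0 V_E2 VV_E2 V_e4_16o4 ramanujan_E2 V_E4 Vt.
have A3 := level4_X char0 V_E2 VV_E2 V_e4_16o4 ramanujan_E2 V_E4 Vt.
split; [apply: A1|apply: A2|apply: A3];
  by [exact: e4_coef0 | exact: o4_coef0 | exact: o4_coef1].
Qed.

End LevelFour.

(** * Identities deduced from logarithmic derivatives *)

Section LogDerivatives.
Variable K : fieldType.
Hypothesis char0 : forall n : nat, n.+1%:R != 0 :> K.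

Lemma fpsC_invK (n : nat) : fpsC n.+1%:R^-1 * n.+1%:R = 1 :> fps K.
Proof. by rewrite -(rmorph_nat (@fpsC K)) -rmorphM mulVf ?char0 // rmorph1. Qed.

Lemma dlog_div (n : nat) (f m : fps K) :
  n.+1%:R * fpsD f = f * m -> dlog f (fpsC n.+1%:R^-1 * m).
Proof.
by move=> e; rewrite /dlog -mulrA [m * f]mulrC -e mulrA fpsC_invK mul1r.
Qed.

Lemma fpsX_inj (f g : fps K) : fpsX * f = fpsX * g -> f = g.
Proof.
move=> fg; apply: fpsP => n; have := congr1 (fun h : fps K => h n.+1) fg.
by rewrite -[fpsX]expr1 !fps_XnM !subn1.
Qed.

Lemma dlog_fpsX_uniq (y z l : fps K) : y 0%N = 1 -> z 0%N = 1 ->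
  dlog (fpsX * y) l -> dlog (fpsX * z) l -> y = z.
Proof.
have dl f : dlog (fpsX * f) l -> dlog f (l - 1).
  rewrite /dlog fpsD_mul (dlogX K) mul1r => e; apply: fpsX_inj.
  by refine (eq_by_sub (c := 1) e _); ring.
by move=> y0 z0 /dl dy /dl dz; apply: dlog_uniq dy dz.
Qed.

Lemma fps_coef0M1 (f g : fps K) : f 0%N = 1 -> g 0%N = 1 -> (f * g) 0%N = 1.
Proof. by move=> f0 g0; rewrite fps_coef0M f0 g0 mulr1. Qed.

Lemma fps_coef0X1 (f : fps K) k : f 0%N = 1 -> (f ^+ k) 0%N = 1.
Proof. by move=> f0; rewrite fps_coef0X f0 expr1n. Qed.

Lemma dlog_leadX_uniq (w u z e l : fps K) :
  w 0%N = 1 -> u 0%N = 1 -> z 0%N = 1 -> e 0%N = 1 ->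
  dlog (fpsX * w * u) l -> dlog (fpsX * z * e) l ->
  fpsX * w * u = fpsX * z * e.
Proof.
move=> w0 u0 z0 e0; rewrite -!mulrA => dy dz; congr (_ * _).
by apply: dlog_fpsX_uniq dy dz; apply: fps_coef0M1.
Qed.

Lemma dlog_congr (f l m : fps K) : dlog f l -> l = m -> dlog f m.
Proof. by move=> ? <-. Qed.

Section ThetaRelation.
Variables u g o e : fps K.
Hypothesis u_0 : u 0%N = 1.
Hypothesis ou : o * u = g * e.

(** By [ou] the derivative of u - 16 g, namely 16 (o u - g e), is zero. *)
Lemma theta_relation : g 0%N = 0 -> dlog u (16%:R * o) -> dlog g e -> u = 1 + 16%:R * g.
Proof.
move=> g0 du dg; have /(fpsD_eq0 char0) : fpsD (u - 16%:R * g) = 0.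
  by rewrite fpsD_sub fpsD_natM du dg -mulrA ou; ring.
by rewrite fpsBE fps_natM_coef g0 mulr0 subr0 u_0 rmorph1 => /eqP; rewrite subr_eq => /eqP.
Qed.

Lemma E4_relation (A X : fps K) : u = 1 + 16%:R * g -> e ^+ 2 = A * u ^+ 2 ->
  X = (e + 16%:R * o) ^+ 2 + 192%:R * (e * o) -> X = A * (1 + 256%:R * (g * u)).
Proof.
move=> uE eA ->; apply: (fps_mulrI (fps_coef0X1 2 u_0)).
transitivity (e ^+ 2 * u ^+ 2 + 224%:R * e * u * (o * u) + 256%:R * (o * u) ^+ 2).
  by ring.
rewrite ou.
transitivity (e ^+ 2 * (u ^+ 2 + 224%:R * g * u + 256%:R * g ^+ 2)); first by ring.
by rewrite eA uE; ring.
Qed.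

End ThetaRelation.

Lemma j_relation (X P1 P2 P4 I1 I2 I4 A B : fps K) :
  A = P1 ^+ 16 * I2 ^+ 8 ->
  P1 0%N = 1 -> I2 0%N = 1 -> P1 * I1 = 1 -> P2 * I2 = 1 -> P4 * I4 = 1 ->
  B 0%N = 1 ->
  X * P1 ^+ 24 * fps_inv ((A * B) ^+ 3) =
  X * (P4 ^+ 8 * I1 ^+ 8) * (P2 ^+ 24 * (I1 ^+ 16 * I4 ^+ 8)) * fps_inv B ^+ 3.
Proof.
move=> AE P10 I20 V1 V2 V4 B0.
have A0 : A 0%N = 1 by rewrite AE; exact: fps_coef0M1 (fps_coef0X1 _ P10) (fps_coef0X1 _ I20).
have AB0 : ((A * B) ^+ 3) 0%N = 1 := fps_coef0X1 _ (fps_coef0M1 A0 B0).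
apply: (fps_mulrI AB0); have V3 := fps_mulVl AB0; have V := fps_mulVl B0.
move: (fps_inv ((A * B) ^+ 3)) (fps_inv B) V3 V => D C V3 V.
transitivity (X * P1 ^+ 24 * ((A * B) ^+ 3 * D)); first by ring.
rewrite V3 AE.
transitivity (X * P1 ^+ 24 * (P1 * I1) ^+ 24 * (P2 * I2) ^+ 24 * (P4 * I4) ^+ 8 * (B * C) ^+ 3).
  by rewrite V1 V2 V4 V; ring.
by ring.
Qed.

(** The product u(q) u(-q) has logarithmic derivative 16 (o(q) + o(-q)) = 0. *)
Lemma fpsN_odd_dlog (u o : fps K) : u 0%N = 1 -> dlog u (16%:R * o) -> fpsN o = - o ->
  fpsN u = fps_inv u.
Proof.
move=> u0 du No; apply: (fps_mulrI u0); rewrite (fps_mulVl u0).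
have d := dlogM du (dlogN du); apply: (dlog_uniq char0 _ _ d).
- by rewrite fps_coef0M fpsN_coef0 u0 mulr1.
- by [].
by rewrite /dlog fpsD1 fpsN_mul fpsN_nat No; ring.
Qed.

Lemma coef0_1addM (n : nat) (g u : fps K) : g 0%N = 0 -> (1 + n%:R * (g * u)) 0%N = 1.
Proof. by move=> g0; rewrite fpsDE fps_natM_coef fps_coef0M g0 mul0r mulr0 addr0. Qed.

End LogDerivatives.

(** * Eta quotients and 1/j *)

Section EtaQuotients.
Variable K : fieldType.
Hypothesis char0 : forall n : nat, n.+1%:R != 0 :> K.

Notation L := (sigma_fps K 1).

Definition euler_fps : fps K := fps_prod (fun n => 1 - fpsX ^+ n).
Let P1 := euler_fps.
Let P2 := fpsV P1.
Let P4 := fpsV P2.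

Lemma fps_prod_coef0 (F : nat -> fps K) : fps_prod F 0%N = 1.
Proof. by rewrite /= big_geq. Qed.

Let P1_0 : P1 0%N = 1. Proof. exact: fps_prod_coef0. Qed.
Let P2_0 : P2 0%N = 1. Proof. by rewrite fpsV_coef0. Qed.
Let P4_0 : P4 0%N = 1. Proof. by rewrite fpsV_coef0. Qed.

Lemma dlog_1subXn n : (0 < n)%N -> dlog (1 - fpsX ^+ n : fps K) (- (n%:R * lambert K n)).
Proof.
move=> n0; rewrite /dlog fpsD_sub fpsD1 fpsD_Xn -{1}(lambertE K n0); ring.
Qed.

Lemma natM_lowz (k m : nat) (f : fps K) : fps_lowz m f -> fps_lowz m (k%:R * f).
Proof. by move=> fm i im; rewrite fps_natM_coef fm ?mulr0. Qed.

Lemma lowzN m (f : fps K) : fps_lowz m f -> fps_lowz m (- f).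
Proof. by move=> fm i im; rewrite fpsNE fm ?oppr0. Qed.

Lemma lowzX1 m n : (m <= n)%N -> fps_lowz m (fpsX ^+ n : fps K).
Proof. by move=> mn i im; rewrite fps_XnE ltn_eqF // (leq_trans im). Qed.

Lemma fps_lowz_leq m n (f : fps K) : (n <= m)%N -> fps_lowz m f -> fps_lowz n f.
Proof. by move=> nm fm i lin; apply: fm; apply: leq_trans nm. Qed.

Lemma lowz_exp_sub1 m (f : fps K) k : fps_lowz m (f - 1) -> fps_lowz m (f ^+ k - 1).
Proof.
move=> fm; elim: k => [|k IH]; first by rewrite subrr.
have -> : f ^+ k.+1 - 1 = (f - 1) * f ^+ k + (f ^+ k - 1) by rewrite exprS; ring.
by move=> i im; rewrite fpsDE IH // addr0; apply: (fps_lowzM fm (n := 0)); rewrite ?addn0.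
Qed.

Lemma lambert_sum c :
  Fps (fun n => (\sum_(1 <= k < n.+1) (- (c%:R * (k%:R * lambert K k)))) n) = - (c%:R * L).
Proof.
apply: fpsP => n.
transitivity ((\sum_(1 <= k < n.+1) (- (c%:R * (k%:R * lambert K k)))) n); first by [].
rewrite fpsNE fps_natM_coef.
rewrite (@sigma_fps_eqto K 1 n n) // !fps_sumE mulr_sumr -sumrN.
by apply: eq_bigr => k _; rewrite fpsNE !fps_natM_coef expn1.
Qed.

Lemma dlog_prod_1subXn c :
  dlog (fps_prod (fun n => (1 - fpsX ^+ n : fps K) ^+ c)) (- (c%:R * L)).
Proof.
rewrite -lambert_sum; apply: dlog_fps_prod => n n0.
- by have := dlog_exp c (dlog_1subXn n0); rewrite mulrN.
- apply: lowz_exp_sub1; rewrite addrAC subrr add0r.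
  exact/lowzN/lowzX1.
- by apply/lowzN/natM_lowz/natM_lowz/lambert_lowz.
Qed.

Let dP1 : dlog P1 (- L).
Proof.
by have := dlog_prod_1subXn 1; rewrite mul1r.
Qed.

Let dP2 : dlog P2 (- (2%:R * fpsV L)).
Proof. by have := dlogV dP1; rewrite fpsV_opp mulrN. Qed.

Let dP4 : dlog P4 (- (4%:R * fpsV (fpsV L))).
Proof.
have := dlogV dP2; rewrite fpsV_opp fpsV_mul fpsV_nat.
by rewrite (_ : 2%:R * _ = - (4%:R * fpsV (fpsV L))) //; ring.
Qed.

Lemma DeltaE : Delta = fpsX * P1 ^+ 24.
Proof.
congr (_ * _); apply: (dlog_uniq char0 _ _ (dlog_prod_1subXn 24)).
- exact: fps_prod_coef0.
- by rewrite fps_coef0X P1_0 expr1n.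
by have := dlog_exp 24 dP1; rewrite mulrN.
Qed.

Lemma lambert_double n : lambert K n.*2 = fpsV (lambert K n).
Proof.
apply: fpsP => k; rewrite fpsV_coef /=; case: ifPn => [ok|ek].
  have -> : (n.*2 %| k)%N = false; last by rewrite andbF.
  apply/negP; rewrite -mul2n => /(dvdn_trans (dvdn_mulr n (dvdnn 2))).
  by rewrite dvdn2 ok.
have {1 2}-> : k = k./2.*2 by rewrite even_halfK.
by rewrite -!muln2 dvdn_pmul2r // muln2 double_gt0.
Qed.

Lemma fpsV_eqto n (f g : fps K) : fps_eqto n f g -> fps_eqto n (fpsV f) (fpsV g).
Proof.
move=> fg i lin; rewrite !fpsV_coef; case: ifP => // _; apply: fg; lia.
Qed.

(** As 1 + q^n = (1 - q^(2n)) / (1 - q^n), the product is P1^6 / P2^3; the computation is done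
    factor by factor. *)
Lemma dlog_h_root8 : dlog (h_root8 : fps K) (6%:R * (fpsV L - L)).
Proof.
pose l n := 6%:R * (n%:R * fpsV (lambert K n) - n%:R * lambert K n).
have dF n : (0 < n)%N ->
  dlog (((1 - fpsX ^+ n) * fps_inv (1 + fpsX ^+ n : fps K)) ^+ 3) (l n).
  move=> n0; have n20 : (0 < n.*2)%N by rewrite double_gt0.
  have c0 : (1 + fpsX ^+ n : fps K) 0%N = 1.
    by rewrite fpsDE fps_XnE ltn_eqF // addr0.
  have d1 : dlog (1 + fpsX ^+ n : fps K) (n%:R * lambert K n - 2%:R * (n%:R * fpsV (lambert K n))).
    rewrite /dlog; apply: (fps_mulrI (subXn_coef0 K n0)).
    have E : (1 - fpsX ^+ n) * (1 + fpsX ^+ n) = 1 - fpsX ^+ n.*2 :> fps K.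
      by rewrite -addnn exprD; ring.
    transitivity (n%:R * (lambert K n * (1 - fpsX ^+ n)) * (1 + fpsX ^+ n)
       - 2%:R * n%:R * (fpsV (lambert K n) * (1 - fpsX ^+ n.*2))); last by rewrite -E; ring.
    rewrite -lambert_double !lambertE // fpsD_add fpsD1 fpsD_Xn -addnn exprD; ring.
  have := dlog_exp 3 (dlogM (dlog_1subXn n0) (dlog_inv c0 d1)).
  by congr (dlog _ _); rewrite /l; ring.
have -> : 6%:R * (fpsV L - L) = Fps (fun n => (\sum_(1 <= k < n.+1) l k) n).
  apply: fpsP => n; transitivity ((\sum_(1 <= k < n.+1) l k) n); last by [].
  rewrite fps_natM_coef fpsBE (fpsV_eqto (@sigma_fps_eqto K 1 n)) // (@sigma_fps_eqto K 1 n n) //.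
  rewrite -fpsBE -fps_natM_coef; congr (fps_coef _ n); rewrite -mulr_sumr sumrB.
  congr (_ * (_ - _)).
  elim/big_rec2: _ => [|k y1 y2 _ <-]; first exact: (fpsV_nat K 0).
  by rewrite fpsV_add fpsV_mul fpsV_nat expn1.
apply: dlog_fps_prod => // n n0.
- apply: lowz_exp_sub1.
  have c0 : (1 + fpsX ^+ n : fps K) 0%N = 1.
    by rewrite fpsDE fps_XnE ltn_eqF // addr0.
  have -> : (1 - fpsX ^+ n) * fps_inv (1 + fpsX ^+ n) - 1 =
     fpsX ^+ n * (- 2%:R * fps_inv (1 + fpsX ^+ n)) :> fps K.
    apply: (fps_mulrI c0); have V := fps_mulVl c0.
    by refine (eq_by_sub (c := 1 + fpsX ^+ n) V _); ring.
  by rewrite -[n in fps_lowz n]addn0; apply: fps_lowzM => //; apply: lowzX1.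
- have h1 : fps_lowz n (lambert K n) by apply: lambert_lowz.
  have h2 : fps_lowz n (fpsV (lambert K n)).
    rewrite -lambert_double; apply: (fps_lowz_leq _ (@lambert_lowz K n.*2 _)).
      by rewrite -addnn leq_addr.
    by rewrite double_gt0.
  apply: natM_lowz => i lin.
  by rewrite fpsBE (natM_lowz n h1 lin) (natM_lowz n h2 lin) subrr.
Qed.

(* [hm4 = (eta(q^4)/eta(q))^8] is a Hauptmodul of X_0(4), [hmu] turns out to be
   [1 + 16 hm4], and [hm4 * hmu = Delta(q^2)/Delta(q)] is a Hauptmodul of X_0(2). *)
Definition hmu : fps K := P2 ^+ 24 * (fps_inv P1 ^+ 16 * fps_inv P4 ^+ 8).
Definition hm4 : fps K := fpsX * (P4 ^+ 8 * fps_inv P1 ^+ 8).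

Let P1V : P1 * fps_inv P1 = 1. Proof. exact: fps_mulVl. Qed.
Let P2V : P2 * fps_inv P2 = 1. Proof. exact: fps_mulVl. Qed.
Let P4V : P4 * fps_inv P4 = 1. Proof. exact: fps_mulVl. Qed.

Lemma hmu_coef0 : hmu 0%N = 1.
Proof.
apply: fps_coef0M1 (fps_coef0X1 _ P2_0) _.
exact: fps_coef0M1 (fps_coef0X1 _ (fps_inv0 _)) (fps_coef0X1 _ (fps_inv0 _)).
Qed.

Let z_0 : (P4 ^+ 8 * fps_inv P1 ^+ 8) 0%N = 1.
Proof. exact: fps_coef0M1 (fps_coef0X1 _ P4_0) (fps_coef0X1 _ (fps_inv0 _)). Qed.

Lemma dlog_hmu : dlog hmu (16%:R * o4 K).
Proof.
have d1 := dlog_exp 16 (dlog_inv P1_0 dP1).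
have d4 := dlog_exp 8 (dlog_inv P4_0 dP4).
have := dlogM (dlog_exp 24 dP2) (dlogM d1 d4).
by congr (dlog _ _); rewrite /o4; ring.
Qed.

Lemma dlog_hm4 : dlog hm4 (e4 K).
Proof.
have d1 := dlog_exp 8 (dlog_inv P1_0 dP1).
have := dlogM (dlogX K) (dlogM (dlog_exp 8 dP4) d1).
by congr (dlog _ _); rewrite /e4; ring.
Qed.

(** Both sides begin with q. By the differential equations the logarithmic derivatives of [o4] and
    [e4] differ by e4 - 16 o4, which is also the difference for [hm4] and [hmu]. *)
Lemma hmu_o4 : o4 K * hmu = hm4 * e4 K.
Proof.
have [De Do _] := level4_relations char0.
have [w] : exists w, o4 K = fpsX ^+ 1 * w.
  by apply: fps_lowzP => -[|//] _; apply: o4_coef0.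
rewrite expr1 => oE.
have w0 : w 0%N = 1 by rewrite -(o4_coef1 K) oE -[fpsX]expr1 fps_XnM.
have dy := dlogM (dlog_div char0 Do) dlog_hmu.
have dz := dlogM dlog_hm4 (dlog_div char0 De).
have i6 := fpsC_invK char0 5.
have e : e4 K + fpsC 6%:R^-1 * (E2 K - e4 K + 80%:R * o4 K) =
  fpsC 6%:R^-1 * (E2 K + 5%:R * e4 K - 16%:R * o4 K) + 16%:R * o4 K.
  move: i6 => {dy dz w0 oE De Do}; move: (fpsC _) (e4 K) (o4 K) (E2 K) => c e o a i6.
  by refine (eq_by_sub (c := 16%:R * o - e) i6 _); ring.
have {}dz := dlog_congr dz e; rewrite {1}oE.
apply: (dlog_leadX_uniq char0 w0 hmu_coef0 z_0 (e4_coef0 K) _ dz).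
by rewrite -oE; exact: dy.
Qed.

Lemma hm4_coef0 : hm4 0%N = 0.
Proof. by rewrite /hm4 fps_coef0M mul0r. Qed.

Lemma hm4_coef1 : hm4 1%N = 1.
Proof.
by rewrite /hm4 fps_coef1M z_0 /= mul0r add0r mul1r.
Qed.

(* Jacobi's theta identity [theta3^4 = theta2^4 + theta4^4], divided by [theta4^4]. *)
Lemma hmuE : hmu = 1 + 16%:R * hm4.
Proof.
exact: (theta_relation char0 hmu_coef0 hmu_o4 hm4_coef0 dlog_hmu dlog_hm4).
Qed.

(** This is eta(q)^16 / eta(q^2)^8, a weight 4 form of level 2; dividing E4 by it leaves a function
    of the Hauptmodul of X_0(2). *)
Let A := P1 ^+ 16 * fps_inv P2 ^+ 8.

Let A_0 : A 0%N = 1.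
Proof. exact: fps_coef0M1 (fps_coef0X1 _ P1_0) (fps_coef0X1 _ (fps_inv0 _)). Qed.

Let e4A : e4 K ^+ 2 = A * hmu ^+ 2.
Proof.
have [De Do _] := level4_relations char0.
have dA : dlog (A * hmu ^+ 2) (- (16%:R * L) + 16%:R * fpsV L + 32%:R * o4 K).
  apply: dlog_congr (dlogM (dlogM (dlog_exp 16 dP1) (dlog_exp 8 (dlog_inv P2_0 dP2))) (dlog_exp 2 dlog_hmu)) _.
  by ring.
apply: (dlog_uniq char0 _ _ _ dA).
- exact: fps_coef0X1 (e4_coef0 K).
- exact: fps_coef0M1 A_0 (fps_coef0X1 2 hmu_coef0).
apply: (fps_natI char0 (n := 2)).
have {}De : 3%:R * fpsD (e4 K ^+ 2) = e4 K ^+ 2 * (E2 K - e4 K + 80%:R * o4 K).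
  rewrite fpsD_exp; move: (e4 K) (o4 K) (E2 K) (fpsD _) De => e o a de De.
  by refine (eq_by_sub (c := e) De _); ring.
rewrite De; move: (e4 K ^+ 2) => x; rewrite /E2 /e4 /o4.
by move: L (fpsV _) (fpsV _) => l l2 l4; ring.
Qed.

Lemma E4_hm4 : E4 = A * (1 + 256%:R * (hm4 * hmu)).
Proof.
have [_ _ XE] := level4_relations char0.
exact: (E4_relation hmu_coef0 hmu_o4 hmuE e4A XE).
Qed.

Lemma jinv_hm4 : jinv = hm4 * hmu * fps_inv (1 + 256%:R * (hm4 * hmu)) ^+ 3 :> fps K.
Proof.
have B0 := coef0_1addM 256 hmu hm4_coef0.
rewrite /jinv E4_hm4 DeltaE.
exact: (j_relation fpsX (erefl A) P1_0 (fps_inv0 _) P1V P2V P4V B0).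
Qed.

Lemma N_hmu : fpsN hmu = fps_inv hmu.
Proof. exact (fpsN_odd_dlog char0 hmu_coef0 dlog_hmu (N_o4 K)). Qed.

End EtaQuotients.

(** * The formal identity satisfied by a form in the kernel of U *)

Section BinomialSeries.
Variable C : closedFieldType.
Hypothesis char0 : forall n : nat, n.+1%:R != 0 :> C.
Implicit Types (f l : fps C) (x y s : C).

Lemma binomC0 x : binomC x 0 = 1.
Proof. by rewrite /binomC big_geq // fact0 mulfV ?oner_eq0. Qed.

Lemma fact_neq0 k : (k`!)%:R != 0 :> C.
Proof. by have := fact_gt0 k; case: (k`!)%N => // n _. Qed.

Lemma binomCS x k : k.+1%:R * binomC x k.+1 = (x - k%:R) * binomC x k.
Proof.
rewrite /binomC big_nat_recr //= factS natrM invfM.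
have := char0 k; have := fact_neq0 k.
move: (k.+1%:R) (k`!%:R) (\prod_(_ <= _ < _) _) => n f p f0 n0.
by field; rewrite n0 f0.
Qed.

Definition binser x : fps C := Fps (binomC x).
Definition fps_pow f x := fps_subst (binser x) (f - 1).

Lemma sub1_coef0 f : f 0%N = 1 -> (f - 1) 0%N = 0.
Proof. by move=> f0; rewrite fpsBE f0 fps1E subrr. Qed.

Lemma fps_pow_coef0 f x : fps_pow f x 0%N = 1.
Proof. by rewrite /fps_pow fps_subst_coef0 /= binomC0. Qed.

(** The binomial series B solves (1 + X) B' = x B; substitute X = f - 1. *)
Lemma dlog_pow f l x : f 0%N = 1 -> dlog f l -> dlog (fps_pow f x) (fpsC x * l).
Proof.
move=> f0 fl; have y0 := sub1_coef0 f0.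
pose B' : fps C := Fps (fun n => n.+1%:R * binser x n.+1).
have BE : B' * (1 + fpsX) = fpsC x * binser x.
  apply: fpsP => n; rewrite mulrDr mulr1 fpsDE [B' * _]mulrC -[fpsX]expr1 fps_XnM fpsCM.
  rewrite /B' /= binomCS; case: n => [|n] /=; first by rewrite addr0 subr0.
  by rewrite subn1 /=; ring.
have := congr1 (fun g : fps C => fps_subst g (f - 1)) BE; cbv beta.
rewrite !fps_substM // fps_subst_add fps_subst1 fps_subst_X // fps_substC [1 + (f - 1)]addrC subrK => e.
rewrite /dlog /fps_pow fpsD_subst // fpsD_sub fpsD1 subr0 fl.
by rewrite mulrCA [X in l * X]e; ring.
Qed.

Lemma fps_powD f x y : f 0%N = 1 -> fps_pow f (x + y) = fps_pow f x * fps_pow f y.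
Proof.
move=> f0; have d := dlog_ex f0.
apply: (dlog_uniq char0 _ _ (dlog_pow (x + y) f0 d)); rewrite ?fps_pow_coef0 //.
  by rewrite fps_coef0M !fps_pow_coef0 mulr1.
rewrite rmorphD mulrDl; exact: dlogM (dlog_pow x f0 d) (dlog_pow y f0 d).
Qed.

Lemma fps_pow_nat f (n : nat) : f 0%N = 1 -> fps_pow f n%:R = f ^+ n.
Proof.
move=> f0; have d := dlog_ex f0.
apply: (dlog_uniq char0 _ _ (dlog_pow n%:R f0 d)); rewrite ?fps_pow_coef0 //.
  by rewrite fps_coef0X f0 expr1n.
by rewrite rmorph_nat; apply: dlog_exp.
Qed.

(** If h_k is the lowest nonzero coefficient of the difference h, the coefficient of q^k in h(w) is
    h_k w_1^k. *)
Lemma fps_subst_inj (w f g : fps C) : w 0%N = 0 -> w 1%N != 0 ->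
  fps_subst f w = fps_subst g w -> f = g.
Proof.
move=> w0 w1 e; apply/eqP; rewrite -subr_eq0; apply/eqP.
have {e} : fps_subst (f - g) w = 0 by rewrite fps_subst_sub e subrr.
move: (f - g) => h e.
have wk k : (w ^+ k) k = w 1%N ^+ k.
  have [v ->] : exists v, w = fpsX ^+ 1 * v.
    by apply: fps_lowzP => -[|//].
  by rewrite exprMn -exprM mul1n !fps_XnM !ltnn !subnn fps_coef0X.
have hz k : fps_lowz k h.
  elim: k => // k IH i; rewrite ltnS leq_eqVlt => /orP[/eqP ->|]; last exact: IH.
  have /eqP := congr1 (fun g : fps C => g k) e.
  rewrite /= big_ord_recr big1 /= ?add0r; last first.
    by move=> j _; rewrite IH ?mul0r //=.
  by rewrite wk mulf_eq0 expf_eq0 (negPf w1) andbF orbF => /eqP.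
by apply: fpsP => n; rewrite (hz n.+1).
Qed.

Lemma Uop_eq0_odd (G : fps C) : Uop G = 0 -> fpsN G = - G.
Proof.
move=> U; apply: fpsP => n; rewrite fpsN_coef -signr_odd fpsNE.
case: (boolP (odd n)) => on; first by rewrite expr1 mulN1r.
have := congr1 (fun g : fps C => g n./2) U => /=.
by rewrite mul2n even_halfK // => ->; rewrite mulr0 oppr0.
Qed.

Lemma hpowE s : hpow s = fps_pow h_root8 (8%:R * s). Proof. by []. Qed.

Let u := hmu C.
Let w := u - 1.

Let u0 : u 0%N = 1. Proof. exact: hmu_coef0. Qed.
Let w0 : w 0%N = 0. Proof. exact: sub1_coef0. Qed.

Lemma h_root8_coef0 : (h_root8 : fps C) 0%N = 1.
Proof. exact: fps_prod_coef0. Qed.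

Lemma V_hpow s : fpsV (hpow s) = fps_pow u (3%:R * s) * hpow s.
Proof.
have dh := dlog_pow (8%:R * s) h_root8_coef0 (dlog_h_root8 C).
rewrite -hpowE in dh.
have du := dlog_pow (3%:R * s) u0 (dlog_hmu C).
apply: (dlog_uniq char0 _ _ (dlogV dh)).
- by rewrite fpsV_coef0 hpowE fps_pow_coef0.
- by rewrite fps_coef0M fps_pow_coef0 hpowE fps_pow_coef0 mulr1.
apply: dlog_congr (dlogM du dh) _.
rewrite fpsV_mul fpsV_C fpsV_mul fpsV_nat fpsV_sub /o4.
rewrite !rmorphM !rmorph_nat; ring.
Qed.

Lemma N_pow x : fpsN (fps_pow u x) * fps_pow u x = 1.
Proof.
have d := dlog_pow x u0 (dlog_hmu C).
apply: (dlog_uniq char0 _ _ (dlogM (dlogN d) d)).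
- by rewrite fps_coef0M fpsN_coef0 fps_pow_coef0 mulr1.
- by [].
by rewrite /dlog fpsD1 fpsN_mul fpsN_C fpsN_mul fpsN_nat (N_o4 C); ring.
Qed.

Lemma N_form s (G : fps C) : Uop G = 0 ->
  fpsN (hpow s * G) = - (fps_pow u (6%:R * s) * (hpow s * G)).
Proof.
move=> /Uop_eq0_odd NG; set F := hpow s * G; set U3 := fps_pow u (3%:R * s).
have E1 : fpsV (hpow s) * G = U3 * F by rewrite V_hpow /F mulrA.
have E2 : fpsN (U3 * F) = - (U3 * F).
  by rewrite -E1 fpsN_mul fpsNV NG mulrN.
have -> : 6%:R * s = 3%:R * s + 3%:R * s by ring.
rewrite fps_powD // -/U3; have N1 := N_pow (3%:R * s); rewrite -/U3 in N1.
rewrite fpsN_mul in E2.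
transitivity (fpsN U3 * U3 * fpsN F); first by rewrite N1 mul1r.
transitivity (U3 * (fpsN U3 * fpsN F)); first by ring.
by rewrite E2; ring.
Qed.

(* [1/j] in terms of [y = w + w^2 = 16 f], where [f = Delta(q^2)/Delta(q)]. *)
Definition jser : fps C := fpsC 16%:R^-1 * fpsX * fps_inv (1 + 16%:R * fpsX) ^+ 3.

Lemma coef0_1addnX (n : nat) : (1 + n%:R * fpsX : fps C) 0%N = 1.
Proof. by rewrite fpsDE fps_natM_coef mulr0 addr0. Qed.

Lemma jser_coef0 : jser 0%N = 0.
Proof. by rewrite /jser -mulrA fpsCM fps_coef0M mul0r mulr0. Qed.

Lemma XX2_coef0 : (fpsX + fpsX ^+ 2 : fps C) 0%N = 0.
Proof. by rewrite fpsDE fps_XnE addr0. Qed.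

Lemma jser_subst (y z : fps C) : y 0%N = 0 -> y = 16%:R * z ->
  fps_subst jser y = z * fps_inv (1 + 256%:R * z) ^+ 3.
Proof.
move=> y0 yE; have i16 := fpsC_invK char0 15.
have cE : fpsC 16%:R^-1 * y = z by rewrite yE mulrA i16 mul1r.
have BE : 1 + 16%:R * y = 1 + 256%:R * z by rewrite yE; ring.
rewrite /jser (fps_substM _ _ y0) (fps_substM _ _ y0) fps_substC (fps_subst_X y0) cE.
rewrite (fps_subst_exp _ _ y0) (fps_subst_inv (coef0_1addnX 16) y0).
by rewrite fps_subst_add fps_subst1 (fps_substM _ _ y0) fps_subst_nat (fps_subst_X y0) BE.
Qed.

Lemma jinv_jser : jinv = fps_subst jser (w + w ^+ 2).
Proof.
have y0 : (w + w ^+ 2) 0%N = 0 by rewrite fpsDE fps_coef0X w0 expr0n addr0.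
have yE : w + w ^+ 2 = 16%:R * (hm4 C * u).
  by rewrite /w /u (hmuE char0); ring.
by rewrite (jser_subst y0 yE) (jinv_hm4 char0).
Qed.

(* With [u = 1 + X], substituting [recip] for [X] amounts to [u -> 1/u]. *)
Definition recip : fps C := fps_inv (1 + fpsX) - 1.

Lemma recip_coef0 : recip 0%N = 0.
Proof. by rewrite /recip fpsBE fps_inv0 fps1E subrr. Qed.

(** Transfers an identity from q to the variable of [Phi]: both sides agree after substituting [v],
    and [v], of order exactly 1, can be cancelled. *)
Lemma subst_recip (v F E Phi : fps C) : v 0%N = 0 -> v 1%N != 0 ->
  fpsN v = fps_inv (1 + v) - 1 -> F = fps_subst Phi v ->
  fpsN F = - (fps_subst E v * F) -> fps_subst Phi recip = - (E * Phi).
Proof.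
move=> v0 v1 Nv FE NF; apply: (fps_subst_inj v0 v1).
have X10 : (1 + fpsX : fps C) 0%N = 1 by rewrite fpsDE addr0.
rewrite -(fps_subst_comp _ recip_coef0 v0) fps_subst_opp (fps_substM _ _ v0) -FE -NF FE.
rewrite /fpsN -(fps_subst_comp _ v0 (fpsNX_0 C)) -/(fpsN v) Nv.
by rewrite /recip fps_subst_sub (fps_subst_inv X10 v0) fps_subst_add !fps_subst1 (fps_subst_X v0).
Qed.

Lemma subst_XX2 (v b : fps C) : v 0%N = 0 ->
  fps_subst b (v + v ^+ 2) = fps_subst (fps_subst b (fpsX + fpsX ^+ 2)) v.
Proof.
move=> v0; rewrite -(fps_subst_comp _ XX2_coef0 v0) fps_subst_add.
by rewrite (fps_subst_exp _ _ v0) (fps_subst_X v0).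
Qed.

Lemma formal_identity s (G b : fps C) :
  hpow s * G = fps_subst b (w + w ^+ 2) -> Uop G = 0 ->
  fps_subst (fps_subst b (fpsX + fpsX ^+ 2)) recip =
  - (binser (6%:R * s) * fps_subst b (fpsX + fpsX ^+ 2)).
Proof.
rewrite (subst_XX2 _ w0) => FE /(N_form s) NF.
have w1 : w 1%N != 0.
  rewrite /w /u (hmuE char0) addrC addKr fps_natM_coef (hm4_coef1 C) mulr1.
  exact: (char0 15).
apply: (subst_recip w0 w1 _ FE NF).
have -> : 1 + w = u by rewrite addrC subrK.
by rewrite /w fpsN_sub (fpsN_nat C 1) (N_hmu char0).
Qed.

End BinomialSeries.

(** * Ultrametric estimates *)

Section Ultrametric.
Variables (R : realType) (C : closedFieldType) (nrm : C -> R).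
Hypothesis hC : is_C2 nrm.
Implicit Types (x y : C) (f g : fps C).

Lemma nrm0 : nrm 0 = 0. Proof. exact/(nrm_eq0 hC). Qed.
Lemma nrm1 : nrm 1 = 1.
Proof.
have := nrmM hC 1 1; rewrite mulr1 => /eqP.
rewrite -[X in X == _]mulr1 (inj_eq (mulfI _)) => [/eqP <-//|].
by apply/eqP => /(nrm_eq0 hC)/eqP; rewrite oner_eq0.
Qed.
Lemma nrmX x n : nrm (x ^+ n) = nrm x ^+ n.
Proof. by elim: n => [|n IH]; rewrite ?nrm1 // !exprS (nrmM hC) IH. Qed.
Lemma nrmN x : nrm (- x) = nrm x.
Proof.
have : nrm (- x) ^+ 2 = nrm x ^+ 2 by rewrite -!nrmX sqrrN.
by move/eqP; rewrite eqrXn2 ?(nrm_ge0 hC) // => /eqP.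
Qed.
Lemma nrmB_sym x y : nrm (x - y) = nrm (y - x).
Proof. by rewrite -nrmN opprB. Qed.
Lemma nrm_gt0 x : x != 0 -> 0 < nrm x.
Proof.
move=> x0; rewrite lt_def (nrm_ge0 hC) andbT; apply: contra x0 => /eqP.
by move/(nrm_eq0 hC) => ->.
Qed.
Lemma nrm_eq0b x : (nrm x == 0) = (x == 0).
Proof. by apply/eqP/eqP => /(nrm_eq0 hC). Qed.
Lemma nrmV x : nrm x^-1 = (nrm x)^-1.
Proof.
have [->|x0] := eqVneq x 0; first by rewrite !(invr0, nrm0).
apply: (mulfI (lt0r_neq0 (nrm_gt0 x0))).
by rewrite -(nrmM hC) !mulfV ?nrm1 // nrm_eq0b.
Qed.
Lemma nrm_div x y : nrm (x / y) = nrm x / nrm y.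
Proof. by rewrite (nrmM hC) nrmV. Qed.
Lemma nrm_prod I (r : seq I) (P : pred I) (F : I -> C) :
  nrm (\prod_(i <- r | P i) F i) = \prod_(i <- r | P i) nrm (F i).
Proof. by elim/big_rec2: _ => [|i y1 y2 _ <-]; rewrite ?nrm1 // (nrmM hC). Qed.

Lemma nrmD_le x y B : nrm x <= B -> nrm y <= B -> nrm (x + y) <= B.
Proof. by move=> xB yB; apply: le_trans (nrmD_max hC x y) _; rewrite ge_max xB. Qed.
Lemma nrmD_lt x y B : nrm x < B -> nrm y < B -> nrm (x + y) < B.
Proof. by move=> xB yB; apply: le_lt_trans (nrmD_max hC x y) _; rewrite gt_max xB. Qed.
Lemma nrmB_le x y B : nrm x <= B -> nrm y <= B -> nrm (x - y) <= B.
Proof. by move=> xB yB; apply: nrmD_le; rewrite ?nrmN. Qed.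
Lemma nrmB_lt x y B : nrm x < B -> nrm y < B -> nrm (x - y) < B.
Proof. by move=> xB yB; apply: nrmD_lt; rewrite ?nrmN. Qed.
Lemma nrm_sum_le I (r : seq I) (P : pred I) (F : I -> C) B : 0 <= B ->
  (forall i, P i -> nrm (F i) <= B) -> nrm (\sum_(i <- r | P i) F i) <= B.
Proof.
move=> B0 FB; elim/big_rec: _ => [|i y Pi yB]; first by rewrite nrm0.
by apply: nrmD_le yB; apply: FB.
Qed.
Lemma nrm_sum_lt (I : eqType) (r : seq I) (P : pred I) (F : I -> C) B : 0 < B ->
  (forall i, i \in r -> P i -> nrm (F i) < B) -> nrm (\sum_(i <- r | P i) F i) < B.
Proof.
move=> B0 FB; rewrite big_seq_cond; elim/big_rec: _ => [|i y /andP[ir Pi] yB].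
  by rewrite nrm0.
by apply: nrmD_lt yB; apply: FB.
Qed.
Lemma nrmDl_eq x y : nrm y < nrm x -> nrm (x + y) = nrm x.
Proof.
move=> yx; apply/eqP; rewrite eq_le nrmD_le ?(ltW yx) //=.
have [//|lt] := leP (nrm x) (nrm (x + y)).
have := nrmB_lt lt yx; rewrite addrK ltxx //.
Qed.
Lemma nrmBl_eq x y : nrm y < nrm x -> nrm (x - y) = nrm x.
Proof. by move=> yx; rewrite nrmDl_eq ?nrmN. Qed.

Lemma nrm_nat_le1 (n : nat) : nrm n%:R <= 1.
Proof.
elim: n => [|n IH]; first by rewrite nrm0.
by rewrite -natr1; apply: nrmD_le IH _; rewrite nrm1.
Qed.
Lemma nrm_odd n : odd n -> nrm n%:R = 1.
Proof.
move=> on; rewrite -[n]odd_double_half on /= natrD -[X in nrm X]/(1 + _) nrmDl_eq nrm1 //.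
rewrite -mul2n natrM (nrmM hC) (nrm2 hC).
have := nrm_nat_le1 n./2; lra.
Qed.
Lemma nrm_nat n : (0 < n)%N -> nrm n%:R = 2^-1 ^+ logn 2 n.
Proof.
move=> n0; have [m om {1}->] := pfactor_coprime (isT : prime 2) n0.
rewrite natrM (nrmM hC) natrX nrmX (nrm2 hC) nrm_odd ?mul1r //.
by rewrite -coprime2n.
Qed.
Lemma char0_C2 n : n.+1%:R != 0 :> C.
Proof.
by rewrite -nrm_eq0b nrm_nat // expf_eq0 invr_eq0 pnatr_eq0 andbF.
Qed.
Lemma nrm_nat_sub (m n : nat) : (m%:R - n%:R : C) != 0 ->
  exists k : nat, nrm (m%:R - n%:R) = 2^-1 ^+ k.
Proof.
have H (a b : nat) : (a <= b)%N -> (b%:R - a%:R : C) != 0 ->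
    exists k : nat, nrm (b%:R - a%:R) = 2^-1 ^+ k.
  move=> ab; rewrite -natrB // => nz; exists (logn 2 (b - a)).
  apply: nrm_nat; rewrite lt0n; apply: contra nz => /eqP ->; by rewrite mulr0n.
move=> nz; case: (leqP n m) => [|/ltnW] mn; first exact: H.
by rewrite nrmB_sym; apply: H; rewrite // -opprB oppr_eq0.
Qed.

(* [a] is in the Tate algebra of the closed disc of radius [r]. *)
Definition vanish (r : R) (a : nat -> C) := forall e : R, 0 < e ->
  exists N : nat, forall n, (N <= n)%N -> nrm (a n) * r ^+ n < e.

Lemma rigid_vanish r a : 0 <= r -> rigid_on_disc nrm r a <-> vanish r a.
Proof.
move=> r0; have nn n : 0 <= nrm (a n) * r ^+ n.
  by rewrite mulr_ge0 ?(nrm_ge0 hC) // exprn_ge0.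
split=> [/cvgrPdist_lt h e e0|h].
  have [N _ HN] := h e e0; exists N => n Nn; have := HN n Nn.
  by rewrite /= sub0r normrN ger0_norm.
apply/cvgrPdist_lt => e e0; have [N HN] := h e e0; exists N => // n Nn /=.
by rewrite sub0r normrN ger0_norm //; apply: HN.
Qed.

(** A bound for the Gauss norm at radius [r]; [gboundM] is its submultiplicativity. *)
Definition gbound (r M : R) (a : nat -> C) := forall n, nrm (a n) * r ^+ n <= M.

Section Tate.
Variable r : R.
Hypothesis r0 : 0 <= r.

Let nrm_r_ge0 (a : C) n : 0 <= nrm a * r ^+ n.
Proof. by rewrite mulr_ge0 ?(nrm_ge0 hC) // exprn_ge0. Qed.

Lemma nrm_sum_r I (s : seq I) (P : pred I) (F : I -> C) n B : 0 <= B ->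
  (forall i, P i -> nrm (F i) * r ^+ n <= B) -> nrm (\sum_(i <- s | P i) F i) * r ^+ n <= B.
Proof.
move=> B0 FB; elim/big_rec: _ => [|i y Pi yB]; first by rewrite nrm0 mul0r.
have [h|h] := leP (nrm (F i)) (nrm y).
  by apply: le_trans yB; rewrite ler_wpM2r ?exprn_ge0 // nrmD_le.
by apply: le_trans (FB i Pi); rewrite ler_wpM2r ?exprn_ge0 // nrmD_le // ltW.
Qed.

Lemma vanish_gbound a : vanish r a -> exists2 M, 0 < M & gbound r M a.
Proof.
move=> /(_ 1 ltr01) [N HN].
suff [M M0 HM] : exists2 M, 0 < M & forall n, (n < N)%N -> nrm (a n) * r ^+ n <= M.
  exists (Num.max M 1); first by rewrite lt_max M0.
  move=> n; rewrite le_max; case: (ltnP n N) => [/HM ->//|/HN/ltW ->].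
  by rewrite orbT.
elim: N {HN} => [|N [M M0 HM]]; first by exists 1.
exists (Num.max M (nrm (a N) * r ^+ N)); first by rewrite lt_max M0.
move=> n; rewrite ltnS leq_eqVlt le_max => /orP[/eqP ->|/HM ->//].
by rewrite lexx orbT.
Qed.

Lemma gboundM M M' f g : gbound r M f -> gbound r M' g -> gbound r (M * M') (f * g).
Proof.
move=> fM gM n; rewrite fpsME; apply: nrm_sum_r => [|i _].
  by apply: mulr_ge0; [exact: le_trans (nrm_r_ge0 _ _) (fM 0%N)|exact: le_trans (nrm_r_ge0 _ _) (gM 0%N)].
have -> : r ^+ n = r ^+ i * r ^+ (n - i) by rewrite -exprD subnKC // -ltnS.
rewrite (nrmM hC) mulrACA; exact: (ler_pM (nrm_r_ge0 _ _) (nrm_r_ge0 _ _)).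
Qed.

Lemma gboundX M f k : gbound r M f -> gbound r (M ^+ k) (f ^+ k).
Proof.
move=> fM; elim: k => [|k IH]; last by rewrite !exprS; apply: gboundM.
move=> n; rewrite expr0 fps1E expr0; case: n => [|n] /=; first by rewrite nrm1 mulr1.
by rewrite nrm0 mul0r.
Qed.

Lemma vanishM f g : vanish r f -> vanish r g -> vanish r (f * g).
Proof.
move=> vf vg e e0; have [M M0 fM] := vanish_gbound vf; have [M' M'0 gM] := vanish_gbound vg.
have [N HN] := vf (e / 2 / M') ltac:(by rewrite !divr_gt0).
have [N' HN'] := vg (e / 2 / M) ltac:(by rewrite !divr_gt0).
exists (N + N')%N => n Nn; apply: (@le_lt_trans _ _ (e / 2)); last by lra.
rewrite fpsME; apply: nrm_sum_r => [|i _]; first lra.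
have -> : r ^+ n = r ^+ i * r ^+ (n - i) by rewrite -exprD subnKC // -ltnS.
rewrite (nrmM hC) mulrACA.
have [iN|iN] := leqP N i.
  rewrite -[e / 2](divfK (lt0r_neq0 M'0)); apply: (ler_pM (nrm_r_ge0 _ _) (nrm_r_ge0 _ _)).
    exact/ltW/HN.
  exact: gM.
rewrite -[e / 2](divfK (lt0r_neq0 M0)) mulrC; apply: (ler_pM (nrm_r_ge0 _ _) (nrm_r_ge0 _ _)).
  by apply/ltW/HN'; have := ltn_ord i; lia.
exact: fM.
Qed.

Lemma vanish_fin f D : (forall n, (D < n)%N -> f n = 0) -> vanish r f.
Proof. by move=> fD e e0; exists D.+1 => n Dn; rewrite fD // nrm0 mul0r. Qed.

Lemma vanish1 : vanish r (1 : fps C).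
Proof. by apply: (@vanish_fin _ 0) => -[]. Qed.

Lemma vanishX f k : vanish r f -> vanish r (f ^+ k).
Proof. by move=> vf; elim: k => [|k IH]; [exact: vanish1 | rewrite exprS; apply: vanishM]. Qed.

Lemma vanishD f g : vanish r f -> vanish r g -> vanish r (f + g).
Proof.
move=> vf vg e e0; have [N HN] := vf e e0; have [N' HN'] := vg e e0.
exists (N + N')%N => n Nn; rewrite fpsDE.
apply: le_lt_trans (_ : Num.max (nrm (f n)) (nrm (g n)) * r ^+ n < e).
  by rewrite ler_wpM2r ?exprn_ge0 // (nrmD_max hC).
by rewrite /Num.max; case: ifP => _; [apply: HN'|apply: HN]; lia.
Qed.

Lemma vanishN f : vanish r f -> vanish r (- f).
Proof. by move=> vf e /vf [N HN]; exists N => n /HN; rewrite fpsNE nrmN. Qed.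

(** Rigid functions compose: [y] maps the closed disc of radius [r] into the one of radius [q]. The
    terms of large index k are uniformly small because y^k has Gauss norm at most q^k; each of the
    others tends to 0. *)
Lemma vanish_subst (a : nat -> C) (y : fps C) (q : R) : vanish q a -> vanish r y -> gbound r q y -> y 0%N = 0 ->
  vanish r (fps_subst a y).
Proof.
move=> va vy yq y0 e e0; have [K HK] := va (e / 2) ltac:(lra).
have q0 : 0 <= q by apply: le_trans (yq 0%N); apply: nrm_r_ge0.
have [N HN] : exists N : nat, forall n k, (N <= n)%N -> (k < K)%N ->
    nrm (a k * (y ^+ k) n) * r ^+ n < e / 2.
  elim: (K) => [|k [N HN]]; first by exists 0%N.
  have [N' HN'] : exists N' : nat, forall n, (N' <= n)%N ->
     nrm (a k * (y ^+ k) n) * r ^+ n < e / 2.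
    have [->|ak] := eqVneq (a k) 0; first by exists 0%N => n _; rewrite mul0r nrm0 mul0r; lra.
    have ak0 := nrm_gt0 ak.
    have e1 : 0 < e / 2 / nrm (a k) by rewrite !divr_gt0.
    have [N' HN'] := vanishX k vy e1.
    by exists N' => n /HN'; rewrite ltr_pdivlMr // (nrmM hC) -mulrA mulrC.
  exists (N + N')%N => n j Nn; rewrite ltnS leq_eqVlt => /orP[/eqP ->|jk].
    by apply: HN'; lia.
  by apply: HN => //; lia.
exists N => n Nn; apply: (@le_lt_trans _ _ (e / 2)); last lra.
rewrite /fps_subst -[fps_coef _ n]/(\sum_(k < n.+1) a k * (y ^+ k) n).
apply: nrm_sum_r => [|k _]; first lra.
have [kK|kK] := ltnP k K; first exact/ltW/HN.
apply: le_trans (ltW (HK _ kK)).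
by rewrite (nrmM hC) -mulrA ler_wpM2l ?(nrm_ge0 hC) //; apply: gboundX.
Qed.

(** N is the Weierstrass degree of [f] on the closed disc. It exists since the terms tend to 0, so
    that their maximum is attained, and only finitely often. *)
Lemma max_index f : 0 < r -> vanish r f -> f <> 0 ->
  exists N, [/\ f N != 0, forall n, nrm (f n) * r ^+ n <= nrm (f N) * r ^+ N &
    forall n, (N < n)%N -> nrm (f n) * r ^+ n < nrm (f N) * r ^+ N].
Proof.
move=> rp vf f0; pose F n := nrm (f n) * r ^+ n.
have [m fm] : exists m, f m != 0.
  apply: contrapT => h; apply: f0; apply: fpsP => n; apply/eqP.
  by apply: contrapT => /negP fn; apply: h; exists n.
have Fm : 0 < F m by rewrite mulr_gt0 ?nrm_gt0 ?exprn_gt0.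
have [N0 HN0] := vf _ Fm.
have mN0 : (m < N0)%N by rewrite ltnNge; apply/negP => /HN0; rewrite ltxx.
have [M HM] : exists M, forall n, F n <= F M.
  have : exists2 M, F m <= F M & forall n, (n < N0)%N -> F n <= F M.
    elim: (N0) => [|k [M mM HM]]; first by exists m.
    have [h|h] := leP (F k) (F M).
      by exists M => // n; rewrite ltnS leq_eqVlt => /orP[/eqP -> //|/HM].
    exists k; first exact: le_trans mM (ltW h).
    by move=> n; rewrite ltnS leq_eqVlt => /orP[/eqP -> //|/HM/le_trans]; apply; apply: ltW.
  move=> [M mM HM]; exists M => n; have [/HM//|/HN0/ltW h] := ltnP n N0.
  exact: le_trans h mM.
have exP : exists n, F n == F M by exists M.
have ubP n : F n == F M -> (n <= N0)%N.
  move=> /eqP FnM; rewrite leqNgt; apply/negP => /ltnW/HN0.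
  by rewrite -/(F n) -/(F m) FnM ltNge HM.
case: (ex_maxnP exP ubP) => N /eqP FN maxN; exists N; rewrite -/(F N) FN.
split=> [| |n Nn]; [|exact: HM|].
  apply/eqP => fN; have := HM m; rewrite -FN /F fN nrm0 mul0r leNgt => /negP; apply.
  exact: Fm.
by rewrite lt_neqAle HM andbT; apply/negP => /maxN; rewrite leqNgt Nn.
Qed.

End Tate.

End Ultrametric.

(** * The 2-adic valuation of factorials *)

Lemma logn2_fact_double m : logn 2 (m.*2)`! = (m + logn 2 m`!)%N.
Proof.
elim: m => // m IH; rewrite doubleS !factS !lognM ?muln_gt0 ?fact_gt0 //.
rewrite IH -[m.*2.+2]doubleS -mul2n lognM // (logn_prime _ (isT : prime 2)) /=.
have -> : logn 2 m.*2.+1 = 0%N by rewrite lognE /= dvdn2 /= odd_double.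
lia.
Qed.

Lemma logn2_fact_S_double m : logn 2 (m.*2.+1)`! = (m + logn 2 m`!)%N.
Proof.
rewrite factS lognM ?fact_gt0 // logn2_fact_double.
by rewrite (_ : logn 2 m.*2.+1 = 0%N) // lognE /= dvdn2 /= odd_double.
Qed.

(** By Legendre's formula n - v(n!) is the number of binary digits 1 of n. Only three consequences
    are proved, by halving: it is at least 1, it is 1 for powers of 2, and it is at least 2 strictly
    between consecutive powers of 2. *)
Lemma logn2_fact_lt n : (0 < n)%N -> (logn 2 n`! < n)%N.
Proof.
elim/ltn_ind: n => n IH n0; have := odd_double_half n.
have [m0|m0] := posnP n./2.
  by rewrite m0; case: (odd n) => /= nE; move: n0; rewrite -nE.
have := IH n./2 _ m0; have lt : (n./2 < n)%N by lia.
move=> /(_ lt) H; case: (odd n) => /= <-; rewrite ?add1n ?add0n.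
  by rewrite logn2_fact_S_double; lia.
by rewrite logn2_fact_double; lia.
Qed.

Lemma logn2_fact_exp2 k : (logn 2 (2 ^ k)`!).+1 = (2 ^ k)%N.
Proof.
elim: k => // k IH; rewrite expnS mul2n logn2_fact_double -addnn.
by rewrite -addnS IH.
Qed.

Lemma logn2_fact_lt2 k n : (2 ^ k < n < 2 ^ k.+1)%N -> ((logn 2 n`!).+1 < n)%N.
Proof.
elim: k n => [|k IH] n /andP[h1 h2]; first by rewrite expn0 expn1 in h1 h2; lia.
rewrite !expnS in h1 h2 IH; have := odd_double_half n; case: (boolP (odd n)) => /= _ nE.
  have m0 : (0 < n./2)%N by have := expn_gt0 2 k; lia.
  by have := logn2_fact_lt m0; rewrite -{2 3}nE add1n logn2_fact_S_double; lia.
have /IH : (2 ^ k < n./2 < 2 * 2 ^ k)%N by lia.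
by rewrite -{3 4}nE add0n logn2_fact_double; lia.
Qed.

(** * Products with a series whose dominant coefficients are lacunary *)

Section Gap.
Variables (R : realType) (C : closedFieldType) (nrm : C -> R).
Hypothesis hC : is_C2 nrm.

(* If [f N] is the last dominant coefficient of [f], then the coefficient of
   index [2 ^ k + N] of [E * f] is dominated by [E (2 ^ k) * f N]. *)
Lemma gap_not_vanish (r kappa : R) (K : nat) (E f : fps C) :
  0 < r -> 0 < kappa -> f <> 0 -> vanish nrm r f ->
  (forall n, nrm (E n) * r ^+ n <= kappa) ->
  (forall k, (K <= k)%N -> nrm (E (2 ^ k)%N) * r ^+ (2 ^ k) = kappa) ->
  (forall k n, (K <= k)%N -> (2 ^ k < n < 2 ^ k.+1)%N -> nrm (E n) * r ^+ n < kappa) ->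
  ~ vanish nrm r (E * f).
Proof.
move=> r0 k0 f0 vf Ele Eeq Elt vEf.
have [N [fN fle flt]] := max_index hC r0 vf f0.
set M := nrm (f N) * r ^+ N in fle flt.
have M0 : 0 < M by rewrite mulr_gt0 ?(nrm_gt0 hC) ?exprn_gt0.
have [N1 HN1] := vEf _ (mulr_gt0 k0 M0).
(* This [k] is at least [K], makes the index 2^k + N at least [N1], and gives N < 2^k, so that the
   indices from 2^k + 1 to 2^k + N lie in the gap before 2^(k+1). *)
pose k := (K + N + N1)%N; have kk : (k < 2 ^ k)%N by rewrite ltn_expl.
have Kk : (K <= k)%N by rewrite /k; lia.
pose n := (2 ^ k + N)%N.
have := HN1 n; rewrite ltNge => /(_ _)/negP; apply; first by rewrite /n /k in kk *; lia.
have in0 : (2 ^ k < n.+1)%N by rewrite /n; lia.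
have rn : 0 < r ^+ n by rewrite exprn_gt0.
have nn (a : C) i : 0 <= nrm a * r ^+ i.
  by rewrite mulr_ge0 ?(nrm_ge0 hC) // exprn_ge0 // ltW.
have split i : (i <= n)%N -> nrm (E i * f (n - i)%N) * r ^+ n =
   (nrm (E i) * r ^+ i) * (nrm (f (n - i)%N) * r ^+ (n - i)).
  by move=> lin; rewrite (nrmM hC) mulrACA -exprD subnKC.
rewrite fpsME (bigD1 (Ordinal in0)) //= (nrmDl_eq hC).
  rewrite split ?leq_addr // Eeq // /n addnC addnK //.
have mainE : nrm (E (2 ^ k)%N * f (n - 2 ^ k)%N) = kappa * M / r ^+ n.
  apply: (mulIf (lt0r_neq0 rn)); rewrite divfK ?lt0r_neq0 //.
  by rewrite split ?leq_addr // Eeq // /n addnC addnK.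
have B0 : 0 < kappa * M / r ^+ n by rewrite divr_gt0 // mulr_gt0.
rewrite mainE; apply: (nrm_sum_lt hC B0).
move=> i _ /eqP ii; rewrite ltr_pdivlMr // split; last by rewrite -ltnS.
(* Below 2^k the cofactor of [f] has index above [N] and is strictly smaller than the maximum; above
   2^k the coefficient of [E] is in the gap. *)
have [ilt|igt|ie] := ltngtP i (2 ^ k)%N; last by case: ii; apply: val_inj.
- apply: (@le_lt_trans _ _ (kappa * (nrm (f (n - i)%N) * r ^+ (n - i)))).
    by rewrite ler_wpM2r.
  have aux (a b c : nat) : (c < a)%N -> (b < a + b - c)%N by lia.
  have Nni : (N < n - i)%N := aux _ _ _ ilt.
  by rewrite ltr_pM2l // flt.
- apply: (@le_lt_trans _ _ (nrm (E i) * r ^+ i * M)).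
    by rewrite ler_wpM2l.
  rewrite ltr_pM2r // (Elt k) // igt expnS.
  by have := ltn_ord i; rewrite /n /k in kk *; lia.
Qed.

End Gap.

(** * Mean values of truncated valuations *)

Lemma count_multiples d n : (0 < d)%N ->
  (\sum_(0 <= i < n) (d %| i) = (n + d.-1) %/ d)%N.
Proof.
move=> d0; elim: n => [|n IH].
  by rewrite big_geq // add0n divn_small // prednK.
rewrite big_nat_recr //= IH addSn divnS // addnC; congr (_ + _)%N.
by rewrite -addnS prednK // dvdn_addl.
Qed.

(** As 0 counts, there are exactly n/d rounded up multiples of [d] below [n]. The rounding goes in
    the direction that makes products of |c - i| small. *)
Lemma count_multiples_ge d n : (0 < d)%N ->
  (n <= \sum_(0 <= i < n) (d %| i) * d)%N.
Proof.
move=> d0; rewrite -big_distrl /= count_multiples //.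
have := divn_eq (n + d.-1) d; have := ltn_pmod (n + d.-1) d0; lia.
Qed.

Lemma count_multiples_eq d n : (0 < d)%N -> (d %| n)%N ->
  (\sum_(0 <= i < n) (d %| i) * d = n)%N.
Proof.
move=> d0 /dvdnP[q ->]; rewrite -big_distrl /= count_multiples //.
by rewrite divnMDl // divn_small ?addn0 // prednK.
Qed.

Section Layers.
Variable R : realType.
Implicit Types (t b : R).

(* For [0 < b], min(v(i), b) is the sum over 1 <= k <= m of [2^k | i], plus
   (b - m) [2^(m+1) | i], where m is the integer part of b; [layer] is the
   contribution of one such term, normalized by its average. *)
Definition layer (d : nat) t (n : nat) : R :=
  (\prod_(0 <= i < n) (if (d %| i)%N then 2 `^ (- t) else 1)) * 2 `^ (t * (n%:R / d%:R)).

Lemma prod_if_pow (P : pred nat) (x : R) n :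
  \prod_(0 <= i < n) (if P i then x else 1) = x ^+ (\sum_(0 <= i < n) P i)%N.
Proof.
elim: n => [|n IH]; first by rewrite !big_geq.
by rewrite !big_nat_recr //= IH exprD; case: (P n).
Qed.

Lemma layerE d t n : (0 < d)%N ->
  layer d t n = 2 `^ (t * (n%:R / d%:R - (\sum_(0 <= i < n) (d %| i))%N%:R)).
Proof.
move=> d0; rewrite /layer prod_if_pow -powR_mulrn ?powR_ge0 // -powRrM -powRD; last first.
  by apply/implyP => _; rewrite pnatr_eq0.
by congr (_ `^ _); ring.
Qed.

Lemma layer_le1 d t n : (0 < d)%N -> 0 <= t -> layer d t n <= 1.
Proof.
move=> d0 t0; rewrite layerE // -[X in _ <= X](powRr0 2) ler_powR ?ler1n //.
rewrite mulr_ge0_le0 // subr_le0 ler_pdivrMr ?ltr0n // -natrM ler_nat big_distrl /=.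
exact: count_multiples_ge.
Qed.

Lemma layer_eq1 d t n : (0 < d)%N -> (d %| n)%N -> layer d t n = 1.
Proof.
move=> d0 dn; rewrite layerE // -{1}(count_multiples_eq d0 dn) -big_distrl /= natrM.
by rewrite mulfK ?subrr ?mulr0 ?powRr0 // pnatr_eq0 -lt0n.
Qed.

Lemma powR_sum (I : Type) (r : seq I) (F : I -> R) :
  2 `^ (\sum_(i <- r) F i) = \prod_(i <- r) 2 `^ F i.
Proof.
elim/big_rec2: _ => [|i y1 y2 _ <-]; first by rewrite powRr0.
by rewrite powRD //; apply/implyP => _; rewrite pnatr_eq0.
Qed.

Definition nu_fin b : R :=
  if b <= 0 then b
  else let n := Num.truncn b in
       \sum_(1 <= k < n.+1) 2^-1 ^+ k + (b - n%:R) / 2 ^+ n.+1.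

(** Strictness puts the radius 2^(nu - 1) below 1, where [recip] converges. *)
Lemma nu_fin_lt1 b : nu_fin b < 1.
Proof.
rewrite /nu_fin; case: ifPn => [b0|]; first by lra.
rewrite -ltNge => b0 /=; set n := Num.truncn b.
have bn : b - n%:R < 1.
  by have /truncn_itv/andP[_] := ltW b0; rewrite -/n -natr1; lra.
have -> : \sum_(1 <= k < n.+1) 2^-1 ^+ k = 1 - 2^-1 ^+ n :> R.
  elim: n {bn} => [|n IH]; first by rewrite big_geq // expr0 subrr.
  by rewrite big_nat_recr //= IH exprS; field.
rewrite exprS invfM -exprVn.
have := exprn_gt0 n (_ : 0 < 2^-1 :> R); rewrite invr_gt0 ltr0n => /(_ isT).
set e := 2^-1 ^+ n => e0.
have : (b - n%:R) * (2^-1 * e) < 1 * (2^-1 * e) by rewrite ltr_pM2r // mulr_gt0 ?invr_gt0.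
rewrite mul1r; move: (_ * (2^-1 * e)) => X h.
lra.
Qed.

End Layers.

(** * The case of finite distance to Z_2 *)

Section FiniteDistance.
Variables (R : realType) (C : closedFieldType) (nrm : C -> R).
Hypothesis hC : is_C2 nrm.
Variables (b : R) (c : C).
Let delta : R := 2 `^ (- b).
Hypothesis c_norm : nrm c = delta.
Hypothesis c_dist : forall i : nat, delta <= nrm (c - i%:R).

(** The factor of |binomC c n| R^n that depends on the position of [c]; the other factor is 2^(-n) /
    |n!|. *)
Let A n := (\prod_(0 <= i < n) nrm (c - i%:R)) * (2 `^ nu_fin b) ^+ n.

Let dist_small i : nrm (i%:R : C) <= delta -> nrm (c - i%:R) = delta.
Proof.
move=> h; apply/eqP; rewrite eq_le c_dist andbT.
by apply: (nrmB_le hC) => //; rewrite c_norm.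
Qed.

Let two_neq0 : (2 : R) != 0. Proof. by rewrite pnatr_eq0. Qed.

Let A_nonpos n : b <= 0 -> A n = 1.
Proof.
move=> b0; have d1 : 1 <= delta.
  by rewrite /delta -[X in X <= _](powRr0 2) ler_powR ?ler1n // oppr_ge0.
rewrite /A /nu_fin b0 (eq_bigr (fun=> delta)); last first.
  by move=> i _; rewrite dist_small // (le_trans (nrm_nat_le1 hC i)).
rewrite prodr_const_nat subn0 -exprMn /delta -powRD; last by apply/implyP.
by rewrite addNr powRr0 expr1n.
Qed.

(** |c - i| is the larger of |i| and [delta]; when they are equal, [c_dist] excludes cancellation.
    The product form allows exchanging the product over i with the one over the powers 2^k. *)
Let dist_layers i : 0 < b ->
  nrm (c - i%:R) =
  (\prod_(1 <= k < (Num.truncn b).+1) (if (2 ^ k %| i)%N then 2 `^ (- 1) else 1))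
  * (if (2 ^ (Num.truncn b).+1 %| i)%N then 2 `^ (- (b - (Num.truncn b)%:R)) else 1).
Proof.
move=> b0; set m := Num.truncn b.
have /andP[mb bm] : m%:R <= b < m.+1%:R by apply: truncn_itv; apply: ltW.
have half : 2 `^ (- 1) = 2^-1 :> R by rewrite powRN powRr1.
have halfX k : 2^-1 ^+ k = 2 `^ (- k%:R) :> R by rewrite powRN powR_mulrn // exprVn.
have [di|di] := boolP (2 ^ m.+1 %| i)%N.
  rewrite (eq_big_nat _ _ (F2 := fun=> 2^-1)); last first.
    move=> k /andP[_ km]; rewrite half (dvdn_trans _ di) // dvdn_exp2l //.
    exact: leqW.
  rewrite prodr_const_nat subn1 /= halfX -powRD; last by apply/implyP.
  rewrite dist_small; first by congr (_ `^ _); ring.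
  apply: (@le_trans _ _ (2^-1 ^+ m.+1)).
    have [->|i0] := posnP i; first by rewrite (nrm0 hC) exprn_ge0.
    rewrite (nrm_nat hC i0) ler_wiXn2l ?invr_ge0 ?invf_le1 ?ler1n //.
    by rewrite -pfactor_dvdn.
  by rewrite halfX ler_powR ?ler1n // lerN2 ltW.
rewrite mulr1; have i0 : (0 < i)%N by case: i di => //; rewrite dvdn0.
have vm : (logn 2 i <= m)%N.
  by rewrite leqNgt; apply: contra di; rewrite pfactor_dvdn.
set v := logn 2 i in vm.
have -> : \prod_(1 <= k < m.+1) (if (2 ^ k %| i)%N then 2 `^ (- 1) else 1) = 2^-1 ^+ v :> R.
  rewrite (@big_cat_nat _ _ _ v.+1) //= big_nat [X in X * _](_ : _ = 2^-1 ^+ v).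
    rewrite [X in _ * X]big_nat [X in _ * X]big1 ?mulr1 // => k /andP[vk _].
    by rewrite pfactor_dvdn // leqNgt vk.
  rewrite -big_nat (eq_big_nat _ _ (F2 := fun=> 2^-1)) ?prodr_const_nat ?subn1 //.
  by move=> k /andP[_ kv]; rewrite pfactor_dvdn // -ltnS kv half.
have ni : nrm (i%:R : C) = 2^-1 ^+ v by rewrite (nrm_nat hC i0).
have dv : delta <= 2^-1 ^+ v.
  rewrite halfX /delta ler_powR ?ler1n // lerN2; apply: le_trans mb.
  by rewrite ler_nat.
move: dv; rewrite le_eqVlt => /orP[/eqP dv|dv].
  by rewrite dist_small ?dv // ni.
by rewrite (nrmB_sym hC) (nrmBl_eq hC) ni // c_norm.
Qed.

Let A_pos n : 0 < b ->
  A n = \prod_(1 <= k < (Num.truncn b).+1) layer (2 ^ k) (1 : R) n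
        * layer (2 ^ (Num.truncn b).+1) (b - (Num.truncn b)%:R) n.
Proof.
move=> b0; set m := Num.truncn b.
have E : (2 `^ nu_fin b) ^+ n =
    \prod_(1 <= k < m.+1) 2 `^ (1 * (n%:R / (2 ^ k)%N%:R)) *
    2 `^ ((b - m%:R) * (n%:R / (2 ^ m.+1)%N%:R)).
  rewrite /nu_fin leNgt b0 /= -/m.
  rewrite -powR_mulrn ?powR_ge0 // -powRrM mulrDl powRD; last by apply/implyP.
  rewrite mulr_suml powR_sum; congr (_ * _).
    by apply: eq_bigr => k _; congr (_ `^ _); rewrite mul1r natrX exprVn mulrC.
  by congr (_ `^ _); rewrite natrX mulrAC mulrA.
rewrite /A E (eq_bigr _ (fun i _ => dist_layers i b0)) -/m big_split /= exchange_big /=.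
by rewrite mulrACA -big_split.
Qed.

Let A_le1 n : A n <= 1.
Proof.
have [b0|b0] := leP b 0; first by rewrite A_nonpos.
rewrite A_pos //.
have bm : 0 <= b - (Num.truncn b)%:R.
  by have /truncn_itv/andP[] := ltW b0; rewrite subr_ge0.
have h k (t : R) : 0 <= t -> 0 <= layer (2 ^ k) t n <= 1.
  move=> t0; rewrite layer_le1 ?expn_gt0 // andbT mulr_ge0 ?powR_ge0 //.
  by apply: prodr_ge0 => i _; case: ifP => _; rewrite ?powR_ge0.
have /andP[l0 l1] := h (Num.truncn b).+1 _ bm.
have /andP[p0 p1] : 0 <= \prod_(1 <= k < (Num.truncn b).+1) layer (2 ^ k) (1 : R) n <= 1.
  elim/big_rec: _ => [|k x _ /andP[x0 x1]]; first by rewrite ler01 lexx.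
  by have /andP[y0 y1] := h k 1 ler01; rewrite mulr_ge0 // mulr_ile1.
exact: mulr_ile1.
Qed.

(** Such a 2^k is a multiple of every modulus that occurs, so no layer loses anything to
    rounding. *)
Let A_eq1 k : (Num.truncn b < k)%N -> A (2 ^ k)%N = 1.
Proof.
move=> bk; have [b0|b0] := leP b 0; first by rewrite A_nonpos.
rewrite A_pos // layer_eq1 ?expn_gt0 ?dvdn_exp2l // mulr1 big_nat big1 // => j /andP[_ jb].
by rewrite layer_eq1 ?expn_gt0 ?dvdn_exp2l // ltnW // (leq_trans jb).
Qed.

Let rr : R := 2 `^ (nu_fin b - 1).

Let coef_norm n : (0 < n)%N ->
  nrm ((binser c - 1) n) * rr ^+ n = A n * 2^-1 ^+ (n - logn 2 n`!).
Proof.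
move=> n0; have [fn nf] : (logn 2 n`! < n)%N /\ (n != 0)%N by rewrite logn2_fact_lt // -lt0n.
rewrite fpsBE fps1E (negPf nf) subr0 /= /binomC (nrm_div hC) (nrm_prod hC).
rewrite (nrm_nat hC) ?fact_gt0 // /A /rr powRD; last by apply/implyP.
rewrite powRN powRr1 // exprMn -[in RHS](subnK (ltnW fn)).
have e0 : (2^-1 ^+ logn 2 n`! : R) != 0 by rewrite expf_neq0 // invr_eq0.
rewrite subnK ?(ltnW fn) //.
have -> : 2^-1 ^+ n = 2^-1 ^+ (n - logn 2 n`!) * 2^-1 ^+ logn 2 n`! :> R.
  by rewrite -exprD subnK // ltnW.
move: (\prod_(_ <= _ < _) _) ((2 `^ _) ^+ _) (2^-1 ^+ (n - _)) e0 => p q x.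
by move: (2^-1 ^+ _) => y y0; field.
Qed.

Lemma binser_not_vanish (f : fps C) : f <> 0 -> vanish nrm rr f ->
  ~ vanish nrm rr ((binser c - 1) * f).
Proof.
move=> f0 vf; have r0 : 0 < rr by rewrite powR_gt0.
have nn n : 0 <= A n.
  by rewrite mulr_ge0 ?exprn_ge0 ?powR_ge0 // prodr_ge0 // => i _; rewrite (nrm_ge0 hC).
have E0 : (binser c - 1) 0%N = 0.
  by rewrite fpsBE fps1E /= (binomC0 _) subrr.
have half1 (k : nat) : (0 < k)%N -> 2^-1 ^+ k <= 2^-1 :> R.
  by move=> k0; rewrite -[X in _ <= X]expr1 ler_wiXn2l ?invr_ge0 ?invf_le1 ?ler1n.
apply: (gap_not_vanish hC (kappa := 2^-1) (K := (Num.truncn b).+1) r0 _ f0 vf).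
- by rewrite invr_gt0.
- move=> n; have [->|n0] := posnP n; first by rewrite E0 (nrm0 hC) mul0r invr_ge0.
  rewrite coef_norm // -[X in _ <= X]mul1r ler_pM ?exprn_ge0 ?invr_ge0 //.
  by apply: half1; rewrite subn_gt0 logn2_fact_lt.
- move=> k Kk; rewrite coef_norm ?expn_gt0 // A_eq1 // mul1r.
  by rewrite -{1}(logn2_fact_exp2 k) subSnn expr1.
move=> k n _ kn; have n0 : (0 < n)%N by case/andP: kn => /(leq_ltn_trans (leq0n _)).
rewrite coef_norm //; apply: (@le_lt_trans _ _ (2^-1 ^+ 2)); last first.
  by rewrite expr2; lra.
rewrite -[X in _ <= X]mul1r ler_pM ?exprn_ge0 ?invr_ge0 // ler_wiXn2l ?invr_ge0 ?invf_le1 ?ler1n //.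
by have := logn2_fact_lt2 kn; lia.
Qed.

End FiniteDistance.

(** * Approximation by natural numbers and distance to Z_2 *)

Section Distance.
Variables (R : realType) (C : closedFieldType) (nrm : C -> R).
Hypothesis hC : is_C2 nrm.
Implicit Types (x y : C).

Lemma half_exp_lt (e : R) : 0 < e -> exists k : nat, 2^-1 ^+ k < e.
Proof.
move=> e0; have := @cvg_expr R 2^-1; rewrite gtr0_norm ?invr_gt0 // invf_lt1 ?ltr1n // => /(_ isT).
move=> /cvgrPdist_lt /(_ e e0) [N _ HN]; exists N; have := HN N (leqnn N).
by rewrite /= sub0r normrN ger0_norm // exprn_ge0 ?invr_ge0.
Qed.

Lemma nrm_int_le1 (z : int) : nrm z%:~R <= 1.
Proof.
case: z => n; first exact: (nrm_nat_le1 hC).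
by rewrite NegzE mulrNz (nrmN hC); apply: (nrm_nat_le1 hC).
Qed.

Lemma nrm_int_dvd (k : nat) (z : int) : ((2 ^ k)%:Z %| z)%Z -> nrm z%:~R <= 2^-1 ^+ k.
Proof.
move=> /dvdzP[q ->]; rewrite intrM (nrmM hC) -pmulrn natrX (nrmX hC) (nrm2 hC).
by rewrite -[X in _ <= X]mul1r ler_wpM2r ?nrm_int_le1 // exprn_ge0 ?invr_ge0.
Qed.

(** Norm at most 1 means odd denominator d. The Chinese remainder theorem yields a multiple N of d
    congruent to the numerator modulo 2^k, and N/d is the approximation. *)
Lemma nrm_rat_nat (a : rat) (k : nat) : nrm (ratr a) <= 1 ->
  exists n : nat, nrm (ratr a - n%:R) <= 2^-1 ^+ k.
Proof.
move=> a1; have cop := coprime_num_den a.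
have d0 : (0 < `|denq a|)%N by rewrite absz_gt0 denq_neq0.
have dE : denq a = `|denq a|%N :> int by rewrite gez0_abs // denq_ge0.
have od : odd `|denq a|.
  apply: contraT => ed; move: a1; rewrite /ratr (nrm_div hC) leNgt => /negP; case.
  have on : odd `|numq a|.
    apply: contraT => en; move: cop; rewrite /coprime => /eqP g1.
    have : (2 %| gcdn `|numq a| `|denq a|)%N by rewrite dvdn_gcd !dvdn2 en ed.
    by rewrite g1.
  have -> : nrm (numq a)%:~R = 1.
    have : nrm (`|numq a|%N)%:R = 1 := nrm_odd hC on.
    case: (numq a) => n; rewrite ?absz_nat // NegzE abszN absz_nat mulrNz => <-.
    by rewrite (nrmN hC).
  rewrite mul1r dE -pmulrn (nrm_nat hC d0) -exprVn invrK.
  rewrite exprn_egt1 ?ltr1n // -lt0n logn_gt0 mem_primes d0 /= dvdn2.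
  by rewrite ed.
have cop2 : coprime (2 ^ k) `|denq a| by rewrite coprimeXl // coprime2n.
pose r := `|(numq a %% (2 ^ k)%:Z)%Z|%N.
pose N := chinese (2 ^ k) `|denq a| r 0.
have Nd : (`|denq a| %| N)%N.
  by rewrite /dvdn (chinese_modr cop2) mod0n.
have [n nE] := dvdnP Nd; exists n.
have dn : nrm (denq a)%:~R = 1 by rewrite dE -pmulrn (nrm_odd hC).
have d0' : (denq a)%:~R != 0 :> C by rewrite -(nrm_eq0b hC) dn oner_eq0.
have -> : ratr a - n%:R = (numq a - N%:Z)%:~R / (denq a)%:~R :> C.
  rewrite /ratr; apply: (mulIf d0'); rewrite mulrBl !divfK // intrB; congr (_ - _).
  by rewrite nE PoszM intrM -dE.
rewrite (nrm_div hC) dn divr1; apply: nrm_int_dvd.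
rewrite -eqz_mod_dvd; apply/eqP.
have p0 : (2 ^ k)%:Z != 0 by rewrite eqz_nat -lt0n expn_gt0.
have -> : (N = r %[mod (2 ^ k)%:Z])%Z.
  by rewrite !modz_nat; congr Posz; apply: (chinese_modl cop2).
by rewrite /r gez0_abs ?modz_ge0 // modz_mod.
Qed.

Lemma Z2_nat_approx x (e : R) : Z2 nrm x -> 0 < e -> exists n : nat, nrm (x - n%:R) < e.
Proof.
move=> [qx x1] e0; have m0 : 0 < Num.min e 1 by rewrite lt_min e0 ltr01.
have [a] := qx _ m0; rewrite lt_min => /andP[ae a1].
have an : nrm (ratr a) <= 1.
  by rewrite -[ratr a](subKr x); apply: (nrmB_le hC) => //; apply: ltW.
have [k ke] := half_exp_lt e0; have [n an'] := nrm_rat_nat k an.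
exists n; rewrite -[x](subrK (ratr a)) -addrA; apply: (nrmD_lt hC) => //.
exact: le_lt_trans ke.
Qed.

Lemma Z2_nat (n : nat) : Z2 nrm n%:R.
Proof.
split; last exact: (nrm_nat_le1 hC).
by move=> e e0; exists n%:R; rewrite ratr_nat subrr (nrm0 hC).
Qed.

(** 3 is invertible in Z_2: the natural number (1 + 2 * 4^k) / 3 is close to 1/3. *)
Lemma third_approx (i : nat) (e : R) : 0 < e ->
  exists n : nat, nrm (i%:R - 3%:R * n%:R) < e.
Proof.
move=> e0; have [k ke] := half_exp_lt e0.
have d3 : (3 %| 1 + 2 * 4 ^ k)%N by rewrite /dvdn -modnDmr -modnMmr -modnXm exp1n.
exists (i * ((1 + 2 * 4 ^ k) %/ 3))%N.
rewrite -natrM mulnCA [(3 * _)%N]mulnC divnK // mulnDr muln1 natrD opprD addrA subrr add0r.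
rewrite (nrmN hC); apply: le_lt_trans ke.
have -> : (i * (2 * 4 ^ k) = i * 2 * 2 ^ k * 2 ^ k)%N by rewrite -mulnA -expnMn mulnA.
rewrite natrM (nrmM hC) natrX (nrmX hC) (nrm2 hC) -[X in _ <= X]mul1r.
by rewrite ler_wpM2r ?(nrm_nat_le1 hC) // exprn_ge0 ?invr_ge0.
Qed.

(** If |x - n| > d, a closer n' gives |x - n| = |n' - n|, a power of 1/2. At most one such power
    lies strictly between d and 2d, so an infimum that is not attained is impossible. *)
Lemma nat_dist_attained x (d : R) : 0 < d -> (forall n : nat, d <= nrm (x - n%:R)) ->
  (forall d', d < d' -> exists n : nat, nrm (x - n%:R) < d') ->
  exists n : nat, nrm (x - n%:R) = d.
Proof.
move=> d0 dle dex.
have step n : d < nrm (x - n%:R) -> exists k : nat, nrm (x - n%:R) = 2^-1 ^+ k.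
  move=> dn; have [n' n'd] := dex _ dn.
  have e : nrm (n'%:R - n%:R) = nrm (x - n%:R).
    rewrite -(nrmBl_eq hC n'd); congr nrm; ring.
  rewrite -e; apply: (nrm_nat_sub hC).
  by rewrite -(nrm_eq0b hC) e lt0r_neq0 // (lt_trans d0).
have [n1 n1d] := dex (2 * d) ltac:(lra).
have := dle n1; rewrite le_eqVlt => /orP[/eqP dE|dn1]; first by exists n1.
have [n2 n2d] := dex _ dn1.
have := dle n2; rewrite le_eqVlt => /orP[/eqP dE|dn2]; first by exists n2.
have [k1 e1] := step _ dn1; have [k2 e2] := step _ dn2.
exfalso; move: n2d; rewrite e1 e2 => lt.
have k12 : (k1 < k2)%N.
  rewrite ltnNge; apply/negP => k21; move: lt; rewrite ltNge.
  by rewrite ler_wiXn2l ?invr_ge0 ?invf_le1 ?ler1n.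
have : 2^-1 ^+ k2 <= 2^-1 * 2^-1 ^+ k1 :> R.
  by rewrite -exprS ler_wiXn2l ?invr_ge0 ?invf_le1 ?ler1n.
by move: dn2 n1d; rewrite e1 e2; lra.
Qed.

Lemma valC_gt y (t : R) : (t%:E < valC nrm y)%E = (nrm y < 2 `^ (- t)).
Proof.
have l2 : 0 < ln (2 : R) by rewrite ln_gt0 // ltr1n.
rewrite /valC; have [->|y0] := eqVneq y 0; first by rewrite (nrm0 hC) ltry powR_gt0.
have p := nrm_gt0 hC y0.
rewrite lte_fin -[in RHS]ltr_ln ?posrE ?powR_gt0 // ln_powR.
by rewrite ltrNr ltr_pdivrMr.
Qed.

Lemma beta_neq_ninfty x : beta nrm x <> -oo%E.
Proof.
move=> bx; have : (valC nrm (x - 0) <= beta nrm x)%E.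
  apply: ereal_sup_ubound; exists 0 => //; exact: (Z2_nat 0).
by rewrite bx leNgt /valC; case: ifP => _; rewrite ltNye.
Qed.

Lemma beta_fin x b : beta nrm x = b%:E ->
  (forall y, Z2 nrm y -> 2 `^ (- b) <= nrm (x - y)) /\
  (exists n : nat, nrm (x - n%:R) = 2 `^ (- b)).
Proof.
move=> bx.
have le y : Z2 nrm y -> 2 `^ (- b) <= nrm (x - y).
  move=> zy; rewrite leNgt -valC_gt -bx -leNgt.
  by apply: ereal_sup_ubound; exists y.
split=> //; apply: nat_dist_attained; first by rewrite powR_gt0.
  by move=> n; apply/le/Z2_nat.
move=> d db; have l2 : 0 < ln (2 : R) by rewrite ln_gt0 // ltr1n.
have d0 : 0 < d by apply: lt_trans db; rewrite powR_gt0.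
pose t := - (ln d / ln 2).
have td : 2 `^ (- t) = d.
  by rewrite /t opprK /powR pnatr_eq0 /= divfK ?lt0r_neq0 // lnK.
have : (t%:E < beta nrm x)%E.
  rewrite bx lte_fin ltNge; apply/negP => bt; move: db; rewrite -td ltNge.
  by rewrite ler_powR ?ler1n // lerN2.
move=> /ereal_sup_gt [_ [y zy <-]]; rewrite valC_gt td => yd.
have [n ny] := Z2_nat_approx zy d0; exists n.
by rewrite -[x](subrK y) -addrA; apply: (nrmD_lt hC).
Qed.

Lemma beta_pinfty x : beta nrm x = +oo%E -> Z2 nrm x.
Proof.
move=> bx.
have ex (e : R) : 0 < e -> exists n : nat, nrm (x - n%:R) < e.
  move=> e0; pose t := - (ln e / ln 2).
  have l2 : 0 < ln (2 : R) by rewrite ln_gt0 // ltr1n.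
  have td : 2 `^ (- t) = e.
    by rewrite /t opprK /powR pnatr_eq0 /= divfK ?lt0r_neq0 // lnK.
  have : (t%:E < beta nrm x)%E by rewrite bx ltry.
  move=> /ereal_sup_gt [_ [y zy <-]]; rewrite valC_gt td => yd.
  have [n ny] := Z2_nat_approx zy e0; exists n.
  by rewrite -[x](subrK y) -addrA; apply: (nrmD_lt hC).
split.
  by move=> e /ex [n ne]; exists n%:R; rewrite ratr_nat.
have [n n1] := ex 1 ltr01; rewrite -[x](subrK n%:R).
by apply: (nrmD_le hC); [apply: ltW | apply: (nrm_nat_le1 hC)].
Qed.

End Distance.

(** * Contradiction when beta is finite *)

Section FiniteCase.
Variables (R : realType) (C : closedFieldType) (nrm : C -> R).
Hypothesis hC : is_C2 nrm.
Implicit Types (x y s : C) (f : fps C).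

Let char0 := char0_C2 hC.

Let X1_0 : (1 + fpsX : fps C) 0%N = 1. Proof. by rewrite fpsDE addr0. Qed.

Lemma binser_pow x : binser x = fps_pow (1 + fpsX) x.
Proof. by rewrite /fps_pow addrC addKr fps_subst_id. Qed.

Lemma binserD x y : binser (x + y) = binser x * binser y.
Proof. by rewrite !binser_pow (fps_powD char0). Qed.

Lemma binser_nat (n : nat) : binser (n%:R : C) = (1 + fpsX) ^+ n.
Proof. by rewrite binser_pow (fps_pow_nat char0). Qed.

Lemma inv_1addX : fps_inv (1 + fpsX) = Fps (fun n => (-1) ^+ n) :> fps C.
Proof.
apply: fps_inv_eq => //; apply: fpsP => n.
rewrite mulrDl mul1r fpsDE -[fpsX]expr1 fps_XnM fps1E.
by case: n => [|n] /=; rewrite ?addr0 // subn1 exprS mulN1r addNr.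
Qed.

Lemma recip_coef n : nrm (recip C n) <= 1.
Proof.
rewrite /recip fpsBE inv_1addX fps1E /=; case: n => [|n].
  by rewrite subrr (nrm0 hC).
by rewrite subr0 (nrmX hC) (nrmN hC) (nrm1 hC) expr1n.
Qed.

Lemma gbound_recip (r : R) : 0 <= r <= 1 -> gbound nrm r r (recip C).
Proof.
move=> /andP[r0 r1] [|n]; first by rewrite recip_coef0 (nrm0 hC) mul0r.
rewrite -[X in _ <= X]mul1r ler_pM ?(nrm_ge0 hC) ?exprn_ge0 ?recip_coef //.
by rewrite exprS -[X in _ <= X]mulr1 ler_wpM2l // exprn_ile1.
Qed.

Lemma vanish_recip (r : R) : 0 <= r < 1 -> vanish nrm r (recip C).
Proof.
move=> /andP[r0 r1] e e0; have := @cvg_expr R r; rewrite ger0_norm // => /(_ r1).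
move=> /cvgrPdist_lt /(_ e e0) [N _ HN]; exists N => n Nn; have := HN n Nn.
rewrite /= sub0r normrN ger0_norm ?exprn_ge0 // => h.
apply: le_lt_trans h; rewrite -[X in _ <= X]mul1r.
by rewrite ler_wpM2r ?exprn_ge0 ?recip_coef.
Qed.

Lemma exp_1addX_mul_neq0 f k : f <> 0 -> (1 + fpsX) ^+ k * f <> 0.
Proof.
move=> f0 e; apply: f0; apply: (fps_mulrI (fps_coef0X1 k X1_0)).
by rewrite e mulr0.
Qed.

Lemma no_extension_finite s (b : R) f :
  beta nrm (2%:R * s) = b%:E -> f <> 0 -> vanish nrm (2 `^ (nu_fin b - 1)) f ->
  fps_subst f (recip C) = - (binser (6%:R * s) * f) -> False.
Proof.
move=> bs f0 vf fE; set r := 2 `^ _ in vf.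
have r0 : 0 < r by rewrite powR_gt0.
have r1 : r < 1.
  have l2 : 0 < ln (2 : R) by rewrite ln_gt0 // ltr1n.
  by rewrite /r /powR pnatr_eq0 /= expR_lt1 pmulr_llt0 // subr_lt0 nu_fin_lt1.
have r01 : 0 <= r < 1 by rewrite ltW.
have [dle [m mE]] := beta_fin hC bs.
have n3 : nrm 3%:R = 1 := nrm_odd hC (isT : odd 3).
(* Shifting 6s by 3m, rather than by an arbitrary integer, keeps the factor 3, a unit, so distances
   for [c] are distances for 2s. *)
pose c := 6%:R * s - (3 * m)%:R.
have cE : c = 3%:R * (2%:R * s - m%:R) by rewrite /c natrM; ring.
have c_norm : nrm c = 2 `^ (- b) by rewrite cE (nrmM hC) n3 mul1r.
(* If [c] were closer to some i, division by 3 in Z_2 would produce a natural number m + n closer to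
   2s than beta allows. *)
have c_dist i : 2 `^ (- b) <= nrm (c - i%:R).
  rewrite leNgt; apply/negP => lt.
  have [n ni] := third_approx hC i (powR_gt0 (- b) (ltr0n R 2)).
  have := dle _ (Z2_nat hC (m + n)); rewrite leNgt => /negP; apply.
  have e3 z : nrm z = nrm (3%:R * z) by rewrite (nrmM hC) n3 mul1r.
  rewrite e3.
  have -> : 3%:R * (2%:R * s - (m + n)%:R) = (c - i%:R) + (i%:R - 3%:R * n%:R).
    by rewrite cE natrD; ring.
  exact: (nrmD_lt hC lt ni).
pose f1 := (1 + fpsX) ^+ (3 * m) * f.
have v1X : vanish nrm r (1 + fpsX : fps C).
  apply: (@vanish_fin _ _ _ hC _ _ 1) => n n1; rewrite fpsDE fps1E -[fpsX]expr1 fps_XnE.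
  by case: n n1 => [|[|n]] // _; rewrite addr0.
have vf1 : vanish nrm r f1.
  by apply: (vanishM hC (ltW r0)) => //; apply: (vanishX hC (ltW r0)).
apply: (binser_not_vanish hC c_norm c_dist (exp_1addX_mul_neq0 (k := 3 * m) f0) vf1).
have -> : (binser c - 1) * f1 = - fps_subst f (recip C) - f1.
  rewrite fE opprK mulrBl mul1r /f1 mulrA; congr (_ * _ - _).
  by rewrite -binser_nat -binserD /c subrK.
apply: (vanishD hC (ltW r0)); apply: (vanishN hC); last exact: vf1.
apply: (vanish_subst hC (ltW r0) vf (vanish_recip r01)); last exact: recip_coef0.
by apply: gbound_recip; rewrite !ltW.
Qed.

End FiniteCase.

(** * The case of 2s in Z_2 *)

Section PolyFps.
Variable K : comNzRingType.
Implicit Types p q : {poly K}.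

Definition fps_poly p : fps K := Fps (fun n => p`_n).

Lemma fps_polyE p n : fps_poly p n = p`_n. Proof. by []. Qed.
Lemma fps_polyM p q : fps_poly (p * q) = fps_poly p * fps_poly q.
Proof. by apply: fpsP => n; rewrite /= coefM. Qed.
Lemma fps_polyD p q : fps_poly (p + q) = fps_poly p + fps_poly q.
Proof. by apply: fpsP => n; rewrite /= coefD. Qed.
Lemma fps_polyC c : fps_poly c%:P = fpsC c.
Proof. by apply: fpsP => n; rewrite /= coefC; case: n. Qed.
Lemma fps_polyX : fps_poly 'X = fpsX.
Proof. by apply: fpsP => n; rewrite /= coefX. Qed.
Lemma fps_polyXn p n : fps_poly (p ^+ n) = fps_poly p ^+ n.
Proof.
elim: n => [|n IH]; last by rewrite !exprS fps_polyM IH.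
by rewrite !expr0 (fps_polyC 1) rmorph1.
Qed.
Lemma fps_poly_comp p q : fps_poly q 0%N = 0 ->
  fps_poly (p \Po q) = fps_subst (fps_poly p) (fps_poly q).
Proof.
move=> q0; elim/poly_ind: p => [|p c IH].
  by rewrite comp_poly0 (fps_polyC 0) rmorph0 fps_subst0.
rewrite comp_polyD comp_polyM comp_polyX comp_polyC !fps_polyD !fps_polyM IH.
by rewrite !fps_polyC fps_polyX fps_subst_add fps_substM // fps_subst_X // fps_substC.
Qed.

Lemma exp_1addX_high k n : (k < n)%N -> ((1 + fpsX : fps K) ^+ k) n = 0.
Proof.
elim: k n => [|k IH] [|n] // kn; rewrite exprS mulrDl mul1r fpsDE -{2}[fpsX]expr1 fps_XnM.
by rewrite /= subn1 /= !IH ?addr0 // ltnW.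
Qed.

Lemma exp_1addX_top k : ((1 + fpsX : fps K) ^+ k) k = 1.
Proof.
elim: k => [|k IH] //; rewrite exprS mulrDl mul1r fpsDE -{2}[fpsX]expr1 fps_XnM.
by rewrite /= subn1 /= IH exp_1addX_high ?add0r.
Qed.

End PolyFps.

(** * Binomial series with exponent in Z_2 *)

Section IntegralSeries.
Variables (R : realType) (C : closedFieldType) (nrm : C -> R).
Hypothesis hC : is_C2 nrm.
Implicit Types (x y : C) (f g : fps C) (B : R).

Let char0 := char0_C2 hC.

Definition cbound B f := forall n, nrm (f n) <= B.

Lemma cbound_ge0 B f : cbound B f -> 0 <= B.
Proof. by move=> /(_ 0%N); apply: le_trans; apply: (nrm_ge0 hC). Qed.

Lemma cboundM B f g : cbound B f -> cbound 1 g -> cbound B (f * g).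
Proof.
move=> fB g1 n; rewrite fpsME; apply: (nrm_sum_le hC) => [|i _].
  exact: cbound_ge0 fB.
by rewrite (nrmM hC) -[X in _ <= X]mulr1 ler_pM ?(nrm_ge0 hC).
Qed.

Lemma cboundD B f g : cbound B f -> cbound B g -> cbound B (f + g).
Proof. by move=> fB gB n; rewrite fpsDE (nrmD_le hC). Qed.

Lemma cboundN B f : cbound B f -> cbound B (- f).
Proof. by move=> fB n; rewrite fpsNE (nrmN hC). Qed.

Lemma cbound1 : cbound 1 1.
Proof. by move=> n; rewrite fps1E; apply: (nrm_nat_le1 hC). Qed.

Lemma cboundX f k : cbound 1 f -> cbound 1 (f ^+ k).
Proof.
by move=> f1; elim: k => [|k IH]; [exact: cbound1 | rewrite exprS; apply: cboundM].
Qed.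

Lemma cbound_Xn k : cbound 1 (fpsX ^+ k).
Proof. by move=> n; rewrite fps_XnE; apply: (nrm_nat_le1 hC). Qed.

Lemma cbound_1addX : cbound 1 (1 + fpsX).
Proof. by apply: cboundD; [exact: cbound1 | rewrite -[fpsX]expr1; apply: cbound_Xn]. Qed.

Lemma cbound_subst B f (y : fps C) : cbound B f -> cbound 1 y ->
  cbound B (fps_subst f y).
Proof.
move=> fB y1 n; rewrite /fps_subst -[fps_coef _ n]/(\sum_(k < n.+1) f k * (y ^+ k) n).
apply: (nrm_sum_le hC) => [|k _]; first exact: cbound_ge0 fB.
by rewrite (nrmM hC) -[X in _ <= X]mulr1 ler_pM ?(nrm_ge0 hC) //; apply: cboundX.
Qed.

(** Membership in Z_2, as the closure of the natural numbers. *)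
Definition nat_limit x := forall e : R, 0 < e -> exists n : nat, nrm (x - n%:R) < e.

Lemma nat_limitB x m : nat_limit x -> nat_limit (x - m%:R).
Proof.
move=> nx e e0; have [n ne] := nx e e0; have [k ke] := half_exp_lt e0.
(* m (2^k - 1) is a natural number congruent to -m modulo 2^k. *)
exists (n + m * (2 ^ k).-1)%N.
have -> : x - m%:R - (n + m * (2 ^ k).-1)%:R = (x - n%:R) - (m * 2 ^ k)%:R.
  by rewrite -[in RHS](prednK (expn_gt0 2 k)) !natrD mulnS natrD; ring.
apply: (nrmB_lt hC) => //; apply: le_lt_trans ke.
rewrite natrM (nrmM hC) natrX (nrmX hC) (nrm2 hC) -[X in _ <= X]mul1r.
by rewrite ler_wpM2r ?(nrm_nat_le1 hC) // exprn_ge0 ?invr_ge0.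
Qed.

Lemma nat_limitD x m : nat_limit x -> nat_limit (x + m%:R).
Proof.
by move=> nx e /nx [n ne]; exists (n + m)%N; rewrite natrD opprD addrACA subrr addr0.
Qed.

Lemma binomC_absorb x k : k.+1%:R * binomC x k.+1 = x * binomC (x - 1) k.
Proof.
rewrite /binomC big_nat_recl // subr0 factS natrM invfM.
rewrite (eq_bigr (fun i : nat => x - 1 - i%:R)); last by move=> i _; rewrite -natr1; ring.
have := char0 k; have := fact_neq0 char0 k.
move: (k.+1%:R) (k`!%:R) (\prod_(_ <= _ < _) _) => n f p f0 n0.
by field; rewrite n0 f0.
Qed.

Lemma nrm_binomC_tiny y k K : (k <= K)%N -> nrm y <= nrm (K`!)%:R -> nrm (binomC y k) <= 1.
Proof.
move=> kK yK; have y1 : nrm y <= 1 := le_trans yK (nrm_nat_le1 hC _).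
have fk0 : 0 < nrm (k`!)%:R by apply: (nrm_gt0 hC); apply: fact_neq0.
rewrite /binomC (nrm_div hC) ler_pdivrMr // mul1r.
case: k kK fk0 => [|k] kK fk0; first by rewrite big_geq // fact0.
have yk : nrm y <= nrm (k.+1`!)%:R.
  apply: le_trans yK _; rewrite -(bin_fact kK) mulnCA natrM (nrmM hC).
  by rewrite -[X in _ <= X]mulr1 ler_wpM2l ?(nrm_ge0 hC) ?(nrm_nat_le1 hC).
apply: le_trans yk; rewrite big_nat_recl // subr0 (nrmM hC) -[X in _ <= X]mulr1.
rewrite ler_wpM2l ?(nrm_ge0 hC) // (nrm_prod hC).
have /andP[_ //] : 0 <= \prod_(0 <= i < k) nrm (y - i.+1%:R) <= 1.
elim/big_rec: _ => [|i z _ /andP[z0 z1]]; first by rewrite ler01 lexx.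
rewrite mulr_ge0 ?(nrm_ge0 hC) //= mulr_ile1 ?(nrm_ge0 hC) //.
by apply: (nrmB_le hC) => //; apply: (nrm_nat_le1 hC).
Qed.

(** For the coefficient of index K, write x = (x - n) + n with |x - n| < |K!|: the factor x - n
    alone absorbs the denominators up to K!, and the coefficients of (1 + X)^n are integers. *)
Lemma binser_integral x : nat_limit x -> cbound 1 (binser x).
Proof.
move=> nx K.
have fK0 : 0 < nrm (K`!)%:R by apply: (nrm_gt0 hC); apply: fact_neq0.
have [n nK] := nx _ fK0.
rewrite -[x](subrK n%:R) (binserD hC) (binser_nat hC) fpsME.
apply: (nrm_sum_le hC) => // i _; rewrite (nrmM hC) mulr_ile1 ?(nrm_ge0 hC) //.
  by apply: (nrm_binomC_tiny (K := K)); [rewrite -ltnS | apply: ltW].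
by apply: cboundX; apply: cbound_1addX.
Qed.

(** j binom(x, j) = x binom(x - 1, j - 1), where the last factor is integral, and v(j) < k for 0 < j
    < 2^k. *)
Lemma binser_small x k j : nat_limit x -> nrm x <= 2^-1 ^+ k -> (0 < j < 2 ^ k)%N ->
  nrm (binser x j) <= 2^-1.
Proof.
move=> nx xk /andP[]; case: j => // j _ jk.
have j0 : nrm (j.+1%:R : C) != 0 by rewrite (nrm_eq0b hC) char0.
have -> : nrm (binser x j.+1) = nrm x / nrm j.+1%:R * nrm (binser (x - 1) j).
  apply: (mulIf j0); rewrite mulrAC divfK // -!(nrmM hC) mulrC; congr nrm.
  exact: binomC_absorb.
have b1 : nrm (binser (x - 1) j) <= 1.
  by apply: binser_integral; rewrite -[1]/(1%:R); apply: nat_limitB.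
apply: le_trans (_ : nrm x / nrm j.+1%:R <= _).
  by rewrite -[X in _ <= X]mulr1 ler_wpM2l // divr_ge0 ?(nrm_ge0 hC).
rewrite ler_pdivrMr ?lt_def ?j0 ?(nrm_ge0 hC) //.
rewrite (nrm_nat hC) // -exprS; apply: le_trans xk _.
rewrite ler_wiXn2l ?invr_ge0 ?invf_le1 ?ler1n //.
rewrite -(ltn_exp2l _ _ (isT : (1 < 2)%N)); apply: leq_ltn_trans jk.
by apply: dvdn_leq; rewrite // -p_part dvdn_part.
Qed.

End IntegralSeries.

(** There are finitely many candidates m <= l; if none were equal to x, their distances to x would
    have a positive minimum. *)
Lemma nat_of_approx (R : realType) (C : closedFieldType) (nrm : C -> R)
    (hC : is_C2 nrm) (x : C) (l : nat) :
  (forall k, exists2 m : nat, (m <= l)%N & nrm (x - m%:R) <= 2^-1 ^+ k) ->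
  exists m : nat, x = m%:R.
Proof.
move=> approx; apply: contrapT => ex.
have pos m : 0 < nrm (x - m%:R).
  apply: (nrm_gt0 hC); apply/eqP => e; apply: ex; exists m; exact/subr0_eq.
have [d d0 dle] : exists2 d : R, 0 < d & forall m : nat, (m <= l)%N -> d <= nrm (x - m%:R).
  elim: l {approx} => [|l [d d0 dle]].
    by exists (nrm (x - 0%:R)) => // -[].
  exists (Num.min d (nrm (x - l.+1%:R))); first by rewrite lt_min d0 pos.
  by move=> m; rewrite leq_eqVlt ge_min => /orP[/eqP ->|/dle ->//]; rewrite lexx orbT.
have [k kd] := half_exp_lt d0; have [m ml mk] := approx k.
by have := dle m ml; rewrite leNgt (le_lt_trans mk kd).
Qed.

(** * Contradiction when 2s is in Z_2 *)

Section IntegralCase.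
Variables (R : realType) (C : closedFieldType) (nrm : C -> R).
Hypothesis hC : is_C2 nrm.
Variables (t : C) (b : fps C).
Hypothesis t_lim : nat_limit nrm t.
Hypothesis t_small : nrm t < 1.

Let char0 := char0_C2 hC.
Let Phi := fps_subst b (fpsX + fpsX ^+ 2).
Hypothesis Phi_recip : fps_subst Phi (recip C) = - (binser t * Phi).

Variables (N0 N : nat) (M : R).
Hypothesis N0N : (N0 <= N)%N.
Hypothesis M_gt0 : 0 < M.
Hypothesis bN0 : nrm (b N0) = M.
Hypothesis b_le : forall n, nrm (b n) <= M.
Hypothesis b_lt : forall n, (N0 < n)%N -> nrm (b n) < M.
Hypothesis b_tail : forall n, (N < n)%N -> nrm (b n) <= M / 4.

Let p : {poly C} := \poly_(n < N.+1) b n.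
Let P : {poly C} := p \Po ('X + 'X^2).
(** The substitution of [recip] sends X + X^2 to -X / (1 + X)^2. Multiplication by (1 + X)^D with D
    >= 2N clears the denominators, so [Ps D] is the left side of the functional equation for the
    truncation. *)
Let Ps D : {poly C} :=
  \sum_(n < N.+1) (b n)%:P * ((- 'X) ^+ n * (1 + 'X) ^+ (D - n.*2)).

Let y : fps C := fpsX + fpsX ^+ 2.
Let z : fps C := recip C + recip C ^+ 2.

Let y_0 : y 0%N = 0. Proof. exact: XX2_coef0. Qed.
Let z_0 : z 0%N = 0.
Proof. by rewrite /z fpsDE fps_coef0X recip_coef0 expr0n addr0. Qed.

Let y_int : cbound nrm 1 y.
Proof.
by apply: (cboundD hC); [rewrite -[fpsX]expr1|]; apply: (cbound_Xn hC).
Qed.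

Let z_int : cbound nrm 1 z.
Proof.
have r1 : cbound nrm 1 (recip C) by apply: recip_coef.
by apply: (cboundD hC) => //; apply: (cboundX hC).
Qed.

Let fps_poly_1X : fps_poly (1 + 'X : {poly C}) = 1 + fpsX.
Proof. by rewrite fps_polyD fps_polyX -[1]/(1%:P) fps_polyC rmorph1. Qed.

Let P_subst : fps_poly P = fps_subst (fps_poly p) y.
Proof.
have yE : fps_poly ('X + 'X^2 : {poly C}) = y.
  by rewrite fps_polyD fps_polyXn fps_polyX.
by rewrite fps_poly_comp yE.
Qed.

Let sub_p : cbound nrm (M / 4) (b - fps_poly p).
Proof.
move=> n; rewrite fpsBE fps_polyE coef_poly; case: ltnP => nN.
  by rewrite subrr (nrm0 hC) divr_ge0 // ltW.
by rewrite subr0; apply: b_tail.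
Qed.

Let Ps_subst D : (N.*2 <= D)%N ->
  fps_poly (Ps D) = (1 + fpsX) ^+ D * fps_subst (fps_poly p) z.
Proof.
move=> ND.
have zE : (1 + fpsX) ^+ 2 * z = - fpsX.
  have X10 : (1 + fpsX : fps C) 0%N = 1 by rewrite fpsDE addr0.
  rewrite /z /recip; have := fps_mulVl X10.
  move=> V; refine (eq_by_sub (c := (1 + fpsX) * fps_inv (1 + fpsX) - fpsX) V _).
  by ring.
apply: fpsP => i.
transitivity ((\sum_(n < N.+1) fpsC (b n) * ((- fpsX) ^+ n * (1 + fpsX) ^+ (D - n.*2))) i).
  congr (fps_coef _ i); rewrite /Ps.
  elim/big_rec2: _ => [|n y1 y2 _ <-].
    by rewrite -[0]/(0%:P) fps_polyC rmorph0.
  rewrite fps_polyD !fps_polyM fps_polyC !fps_polyXn fps_poly_1X.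
  by rewrite -[- 'X]mulN1r fps_polyM fps_polyX -[-1]/(- (1%:P)) -polyCN fps_polyC rmorphN1 mulN1r.
transitivity (((1 + fpsX) ^+ D * (\sum_(n < N.+1) fpsC (b n) * z ^+ n)) i).
  congr (fps_coef _ i); rewrite mulr_sumr; apply: eq_bigr => n _.
  have nD : (n.*2 <= D)%N by apply: leq_trans ND; rewrite leq_double -ltnS.
  rewrite -zE exprMn -exprM mul2n -{2}(subnK nD) exprD; ring.
have eqs : fps_subst (fps_poly p) z = \sum_(n < N.+1) fpsC (b n) * z ^+ n.
  apply: fpsP => j; rewrite (@fps_substE _ _ _ _ (N + j)) ?leq_addl // fps_sumE.
  rewrite -(big_mkord xpredT (fun k => fps_poly p k * (z ^+ k) j)).
  rewrite -(big_mkord xpredT (fun k => (fpsC (b k) * z ^+ k) j)).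
  rewrite (@big_cat_nat _ _ _ N.+1) //; last by rewrite ltnS leq_addr.
  rewrite -[LHS]/(_ + _) [X in _ + X]big_nat [X in _ + X]big1 ?addr0; last first.
    by move=> k /andP[Nk _]; rewrite fps_polyE coef_poly ltnNge Nk mul0r.
  by apply: eq_big_nat => k /andP[_ kN]; rewrite fpsCM fps_polyE coef_poly kN.
by rewrite eqs.
Qed.

(** The functional equation times (1 + X)^D, with [b] replaced by its truncation. All substituted
    and multiplied series are integral, so the two tails contribute at most M / 4. *)
Let Q_small D : (N.*2 <= D)%N ->
  cbound nrm (M / 4) (fps_poly (Ps D) + binser (t + D%:R) * fps_poly P).
Proof.
move=> ND; rewrite Ps_subst // P_subst (binserD hC) (binser_nat hC).
have X1 : cbound nrm 1 ((1 + fpsX) ^+ D) by apply: (cboundX hC); apply: (cbound_1addX hC).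
have E : fps_subst b z = - (binser t * Phi).
  rewrite -Phi_recip /Phi -(fps_subst_comp _ (XX2_coef0 C) (recip_coef0 C)).
  by rewrite fps_subst_add (fps_subst_exp _ _ (recip_coef0 C)) (fps_subst_X (recip_coef0 C)).
have -> : (1 + fpsX) ^+ D * fps_subst (fps_poly p) z
    + binser t * (1 + fpsX) ^+ D * fps_subst (fps_poly p) y =
  - (fps_subst (b - fps_poly p) z * (1 + fpsX) ^+ D)
  - fps_subst (b - fps_poly p) y * (binser t * (1 + fpsX) ^+ D).
  rewrite !fps_subst_sub E -/y -/Phi; ring.
apply: (cboundD hC); apply: (cboundN hC).
  apply: (cboundM hC) => //; exact: (cbound_subst hC).
apply: (cboundM hC); first exact: (cbound_subst hC).
by apply: (cboundM hC) => //; apply: (binser_integral hC).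
Qed.

Let y_pow k n : (y ^+ k) n = if (n < k)%N then 0 else ((1 + fpsX : fps C) ^+ k) (n - k)%N.
Proof.
have -> : y = fpsX * (1 + fpsX) by rewrite /y; ring.
by rewrite exprMn fps_XnM.
Qed.

(** (X + X^2)^k has degree 2k and leading coefficient 1. In degree 2 N0 this isolates the
    coefficient of index N0: smaller k do not reach it, larger k carry coefficients below M. *)
Let P_top : nrm (fps_poly P N0.*2) = M.
Proof.
rewrite P_subst (@fps_substE _ _ _ _ (N0.*2 + N)) ?leq_addr //.
have h : (N0 < (N0.*2 + N).+1)%N by rewrite -addnn; lia.
have ytop : (y ^+ N0) N0.*2 = 1.
  by rewrite y_pow ltnNge -addnn leq_addr /= addnK exp_1addX_top.
rewrite (bigD1 (Ordinal h)) //= coef_poly ltnS N0N ytop mulr1.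
rewrite (nrmDl_eq hC) // bN0; apply: (nrm_sum_lt hC) => // k _ /eqP kN0.
have kn : nat_of_ord k <> N0 by move=> e; apply: kN0; apply: val_inj.
rewrite coef_poly y_pow; case: (ltnP k N.+1) => kN; last by rewrite mul0r (nrm0 hC).
case: (ltnP _ k) => kN2; first by rewrite mulr0 (nrm0 hC).
have [kl|kg|//] := ltngtP k N0.
  by rewrite exp_1addX_high ?mulr0 ?(nrm0 hC) //; lia.
rewrite (nrmM hC); apply: le_lt_trans (b_lt kg); rewrite -[X in _ <= X]mulr1.
by rewrite ler_wpM2l ?(nrm_ge0 hC) //; apply: (cboundX hC); apply: (cbound_1addX hC).
Qed.

Let P_high n : (N0.*2 < n)%N -> nrm (fps_poly P n) < M.
Proof.
move=> Nn; rewrite P_subst (@fps_substE _ _ _ _ n) //.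
apply: (nrm_sum_lt hC) => // k _ _; rewrite fps_polyE coef_poly y_pow.
case: (ltnP k N.+1) => kN; last by rewrite mul0r (nrm0 hC).
case: (ltnP n k) => kn; first by rewrite mulr0 (nrm0 hC).
have [kl|kg] := leqP k N0.
  by rewrite exp_1addX_high ?mulr0 ?(nrm0 hC) //; lia.
rewrite (nrmM hC); apply: le_lt_trans (b_lt kg); rewrite -[X in _ <= X]mulr1.
by rewrite ler_wpM2l ?(nrm_ge0 hC) //; apply: (cboundX hC); apply: (cbound_1addX hC).
Qed.

Let P_int : cbound nrm M (fps_poly P).
Proof.
rewrite P_subst; apply: (cbound_subst hC) => // n; rewrite fps_polyE coef_poly.
by case: ifP => _; rewrite ?(nrm0 hC) ?b_le // ltW.
Qed.

Let Ps_high D n : (N.*2 <= D)%N -> (D < n)%N -> fps_poly (Ps D) n = 0.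
Proof.
move=> ND Dn; rewrite /= /Ps coef_sum big1 // => k _.
rewrite coefCM nth_default ?mulr0 //; apply: leq_trans (_ : D.+1 <= n)%N => //.
apply: leq_trans (size_polyMleq _ _) _.
have s1 : (size ((- 'X : {poly C}) ^+ k) <= k.+1)%N.
  by apply: leq_trans (size_poly_exp_leq _ _) _; rewrite size_polyN size_polyX mul1n.
have s2 : (size ((1 + 'X : {poly C}) ^+ (D - k.*2)) <= (D - k.*2).+1)%N.
  apply: leq_trans (size_poly_exp_leq _ _) _.
  by rewrite addrC -[1]/(1%:P) size_XaddC mul1n.
have aux (u v d m l : nat) : (u <= d.+1)%N -> (v <= (m - d.*2).+1)%N ->
  (d < l.+1)%N -> (l.*2 <= m)%N -> ((u + v).-1 <= m.+1)%N by lia.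
exact: aux s1 s2 (ltn_ord k) ND.
Qed.

(* [(1 + X)^x] is 1 modulo 2 and [X^(2^k)] when [2^k] divides [x], so that
   [(1 + X)^(t + 2N)] can be replaced by a polynomial of small degree. *)
Let residue_bound k m : nrm (t + N.*2%:R - m%:R) <= 2^-1 ^+ k -> (m + N.*2 < 2 ^ k)%N ->
  (m <= N.*2)%N.
Proof.
move=> tm mk; apply: (@leq_trans (m + N0.*2)); first exact: leq_addr.
(* After scaling by a constant of norm M, [j] is the degree of (1 + X)^m P modulo the maximal ideal.
   If it exceeded 2N, the degree bound of [Ps], the coefficient of X^j in the functional equation
   would have norm M. *)
rewrite leqNgt; apply/negP => Nm; set j := (m + N0.*2)%N in Nm.
have jk : (j < 2 ^ k)%N by apply: leq_ltn_trans mk; rewrite leq_add2l leq_double.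
pose T := (1 + fpsX) ^+ m * fps_poly P.
have X1 : cbound nrm 1 ((1 + fpsX) ^+ m) by apply: (cboundX hC); apply: (cbound_1addX hC).
have T_int : cbound nrm M T by rewrite /T mulrC; apply: (cboundM hC).
pose E := binser (t + N.*2%:R - m%:R).
have nl : nat_limit nrm (t + N.*2%:R - m%:R) by apply: (nat_limitB hC); apply: nat_limitD.
have := Q_small (leqnn _) j; rewrite fpsDE (Ps_high (leqnn _) Nm) add0r.
have -> : binser (t + N.*2%:R) * fps_poly P = E * T.
  by rewrite /T mulrA /E -(binser_nat hC) -(binserD hC) subrK.
have E0 : E 0%N = 1 by rewrite /E /= binomC0.
have Tj : nrm (T j) = M.
  have mj : (m < j.+1)%N by rewrite ltnS leq_addr.
  rewrite /T fpsME (bigD1 (Ordinal mj)) // -[nat_of_ord (Ordinal mj)]/m.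
  rewrite exp_1addX_top mul1r {2}/j addKn (nrmDl_eq hC) P_top //.
  apply: (nrm_sum_lt hC) => // i _ /andP[_ /eqP im].
  have [il|ig|ie] := ltngtP i m; last by case: im; apply: val_inj.
    rewrite (nrmM hC); apply: le_lt_trans (P_high (n := j - i) _); last by rewrite /j; lia.
    by rewrite -[X in _ <= X]mul1r ler_wpM2r ?(nrm_ge0 hC).
  by rewrite exp_1addX_high ?mul0r ?(nrm0 hC).
rewrite fpsME big_ord_recl E0 mul1r subn0 leNgt => /negP; apply.
rewrite (nrmDl_eq hC) Tj.
  by rewrite gtr_pMr // invf_lt1 ?ltr1n ?ltr0n.
apply: (nrm_sum_lt hC) => // i _ _; rewrite lift0 (nrmM hC).
apply: (@le_lt_trans _ _ (2^-1 * M)); last first.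
  by rewrite gtr_pMl // invf_lt1 ?ltr1n ?ltr0n.
rewrite ler_pM ?(nrm_ge0 hC) //; apply: (binser_small hC nl tm).
by rewrite /= (leq_ltn_trans _ jk).
Qed.

(** The residue of t + 2N modulo 2^k is either at most 2N or within 2N of 2^k, hence close to a
    small negative integer. Adding another 2N turns both cases into natural numbers at most 4N, a
    bound independent of k. *)
Let exponent_approx k : exists2 m : nat, (m <= N.*2.*2)%N &
  nrm (t + N.*2.*2%:R - m%:R) <= 2^-1 ^+ k.
Proof.
have nl : nat_limit nrm (t + N.*2%:R) by apply: nat_limitD.
have e0 : 0 < 2^-1 ^+ k :> R by rewrite exprn_gt0 // invr_gt0.
have [n nk] := nl _ e0; pose m := (n %% 2 ^ k)%N.
have mk : (m < 2 ^ k)%N by rewrite ltn_mod expn_gt0.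
have p2 (q : nat) : nrm (q * 2 ^ k)%:R <= 2^-1 ^+ k.
  rewrite natrM (nrmM hC) natrX (nrmX hC) (nrm2 hC) -[X in _ <= X]mul1r.
  by rewrite ler_wpM2r ?(nrm_nat_le1 hC) // ltW.
have mt : nrm (t + N.*2%:R - m%:R) <= 2^-1 ^+ k.
  have -> : t + N.*2%:R - m%:R = (t + N.*2%:R - n%:R) + (n %/ 2 ^ k * 2 ^ k)%:R.
    by rewrite {1}(divn_eq n (2 ^ k)) natrD -/m; ring.
  by apply: (nrmD_le hC) => //; apply: ltW.
have [small|large] := ltnP (m + N.*2) (2 ^ k).
  have mN := residue_bound mt small.
  exists (m + N.*2)%N; first by rewrite -[N.*2.*2]addnn leq_add2r.
  by rewrite -[N.*2.*2]addnn !natrD opprD addrACA addrK; move: mt; congr (nrm _ <= _); ring.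
exists (N.*2 - (2 ^ k - m))%N; first by rewrite -[N.*2.*2]addnn (leq_trans (leq_subr _ _)) ?leq_addr.
have kN : (2 ^ k - m <= N.*2)%N by rewrite leq_subLR.
rewrite natrB // natrB ?(ltnW mk) // -[N.*2.*2]addnn natrD.
have -> : t + (N.*2%:R + N.*2%:R) - (N.*2%:R - ((2 ^ k)%N%:R - m%:R)) =
  (t + N.*2%:R - m%:R) + (1 * 2 ^ k)%:R by rewrite mul1n; ring.
exact: (nrmD_le hC).
Qed.

Let exponent_nat : exists m : nat, t + N.*2.*2%:R = m%:R.
Proof. exact: (nat_of_approx hC exponent_approx). Qed.

(** The truncated Phi as a function of u = 1 + w, since w + w^2 = u^2 - u. *)
Let f (u : C) := p.[u ^+ 2 - u].

Let f_reflect u : f (1 - u) = f u.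
Proof. by rewrite /f; congr (p.[_]); ring. Qed.

(** Now that t + D is a natural number, the series of [Q_small] is a polynomial and can be evaluated
    at w = u - 1, of norm at most 1. *)
Let f_relation D m u : (N.*2 <= D)%N -> t + D%:R = m%:R -> nrm u = 1 ->
  nrm (u ^+ D * f u^-1 + u ^+ m * f u) <= M / 4.
Proof.
move=> ND tD u1; have u0 : u != 0 by rewrite -(nrm_eq0b hC) u1 oner_eq0.
pose Q := Ps D + (1 + 'X) ^+ m * P.
have Qs n : nrm Q`_n <= M / 4.
  have := Q_small ND n; rewrite tD (binser_nat hC).
  by rewrite -fps_poly_1X -fps_polyXn -fps_polyM -fps_polyD.
have -> : u ^+ D * f u^-1 + u ^+ m * f u = Q.[u - 1].
  have X1 : (1 + 'X : {poly C}).[u - 1] = u.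
    by rewrite hornerD hornerX -polyC1 hornerC addrC subrK.
  have XX : ('X + 'X^2 : {poly C}).[u - 1] = u ^+ 2 - u.
    by rewrite hornerD hornerXn hornerX; ring.
  rewrite /Q hornerD hornerM horner_exp X1 /P horner_comp XX; congr (_ + _).
  rewrite /f horner_poly /Ps horner_sum mulr_sumr; apply: eq_bigr => n _.
  rewrite !hornerM !horner_exp hornerC hornerN hornerX X1.
  have nD : (n.*2 <= D)%N by apply: leq_trans ND; rewrite leq_double -ltnS.
  rewrite -{1}(subnK nD) exprD -mul2n exprM.
  have -> : u^-1 ^+ 2 - u^-1 = (1 - u) * (u ^+ 2)^-1 by field.
  rewrite [((1 - u) * _) ^+ n]exprMn exprVn opprB; field.
  by rewrite expf_neq0 // expf_neq0.
rewrite horner_coef; apply: (nrm_sum_le hC) => [|i _]; first by rewrite divr_ge0 // ltW.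
rewrite (nrmM hC) -[X in _ <= X]mulr1 ler_pM ?(nrm_ge0 hC) //.
rewrite (nrmX hC) exprn_ile1 ?(nrm_ge0 hC) //.
by apply: (nrmB_le hC); rewrite ?u1 ?(nrm1 hC).
Qed.

(* The reflections [u -> 1/u] and [u -> 1 - u] are conjugate in the group
   they generate (S_3), but [f] is odd for the first one (up to a factor, and
   approximately) and even for the second one. *)
Let f_small u : nrm u = 1 -> nrm (1 - u) = 1 -> nrm (f u) <= M / 2.
Proof.
move=> u1 v1; have [m tm] := exponent_nat.
(* m = t + 4N has norm below 1. For odd m the two copies of [f u] in [key] would cancel instead of
   adding up to 2 f(u). *)
have em : ~~ odd m.
  apply/negP => om; have := nrm_odd hC om; rewrite -tm => /eqP.
  rewrite lt_eqF //; apply: (nrmD_lt hC) => //.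
  rewrite -mul2n natrM (nrmM hC) (nrm2 hC).
  apply: (@le_lt_trans _ _ (2^-1 * 1)); last by rewrite mulr1 invf_lt1 ?ltr1n ?ltr0n.
  by rewrite ler_wpM2l ?invr_ge0 ?(nrm_nat_le1 hC).
have ND : (N.*2 <= N.*2.*2)%N by rewrite -[N.*2.*2]addnn leq_addr.
have u0 : u != 0 by rewrite -(nrm_eq0b hC) u1 oner_eq0.
have v0 : 1 - u != 0 by rewrite -(nrm_eq0b hC) v1 oner_eq0.
set D := N.*2.*2 in tm ND.
have ED (x : C) : (- x) ^+ D = x ^+ D by rewrite /D -mul2n !exprM sqrrN.
have Em (x : C) : (- x) ^+ m = x ^+ m.
  by rewrite -(even_halfK em) -mul2n !exprM sqrrN.
(* w = 1 - 1/u and 1 - 1/w = 1/(1 - u), so the relation at w links the values f(1/u) and f(1/(1 -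
   u)) that occur in the relations at u and at 1 - u. *)
pose w := (u - 1) / u.
have w1 : nrm w = 1 by rewrite /w (nrm_div hC) u1 (nrmB_sym hC) v1 divr1.
have R1 := f_relation ND tm u1; have R2 := f_relation ND tm v1.
have R3 := f_relation ND tm w1.
have fw : f w = f u^-1.
  by rewrite -f_reflect; congr f; rewrite /w; field.
have fw' : f w^-1 = f (1 - u)^-1.
  rewrite -f_reflect; congr f; rewrite /w invfM invrK; field.
  by rewrite v0 -opprB oppr_eq0.
rewrite f_reflect in R2; rewrite fw fw' in R3.
have nD (x : C) k : nrm x = 1 -> nrm (x ^+ k) = 1 by move=> x1; rewrite (nrmX hC) x1 expr1n.
pose q := 1 - u; pose F := f u; pose F1 := f u^-1; pose F2 := f q^-1.
have key : 2%:R * (q ^+ m * u ^+ m * F) =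
  (q ^+ D * F2 + q ^+ m * F) * u ^+ m
  - (w ^+ D * F2 + w ^+ m * F1) * (u ^+ D * u ^+ m)
  + q ^+ m * (u ^+ D * F1 + u ^+ m * F).
  have wu : w = - q / u by rewrite /w /q opprB.
  have wD : w ^+ D * u ^+ D = q ^+ D by rewrite wu exprMn ED exprVn divfK // expf_neq0.
  have wm : w ^+ m * u ^+ m = q ^+ m by rewrite wu exprMn Em exprVn divfK // expf_neq0.
  transitivity ((q ^+ D * F2 + q ^+ m * F) * u ^+ m
     - (w ^+ D * u ^+ D * F2 * u ^+ m + w ^+ m * u ^+ m * F1 * u ^+ D)
     + q ^+ m * (u ^+ D * F1 + u ^+ m * F)); last by ring.
  by rewrite wD wm; ring.
have h2 : nrm (2%:R * (q ^+ m * u ^+ m * F)) <= M / 4.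
  rewrite key; apply: (nrmD_le hC); last by rewrite (nrmM hC) nD // mul1r.
  apply: (nrmB_le hC); first by rewrite (nrmM hC) nD // mulr1.
  by rewrite (nrmM hC) [nrm (u ^+ D * _)](nrmM hC) !nD // !mulr1.
(* Dividing by 2 doubles the bound; the tail was cut at M / 4 so that M / 2 is still below M. *)
move: h2; rewrite !(nrmM hC) (nrm2 hC) !nD // !mul1r.
have -> : M / 4 = 2^-1 * (M / 2) by field.
by rewrite ler_pM2l // invr_gt0.
Qed.

(** No residue field is needed. A root v of v p0(v) = b_N0 must have |v| = 1, as |v| < 1 makes the
    left side too small and |v| > 1 too large; hence |p0(v)| = M, and terms above N0 do not change
    this. Then u (u - 1) = v forces |u| = |u - 1| = 1. *)
Let f_large : exists u, [/\ nrm u = 1, nrm (1 - u) = 1 & nrm (f u) = M].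
Proof.
pose p0 : {poly C} := \poly_(n < N0.+1) b n.
pose Q := 'X * p0 - (b N0)%:P.
have bN : b N0 != 0 by rewrite -(nrm_eq0b hC) bN0 lt0r_neq0.
have sp0 : size p0 = N0.+1 by rewrite size_poly_eq.
have p00 : p0 != 0 by rewrite -size_poly_eq0 sp0.
have sQ : size Q != 1%N.
  rewrite /Q size_polyDl mulrC size_mulX // sp0 // size_polyN.
  by rewrite (leq_ltn_trans (size_polyC_leq1 _)).
have [v] := closed_rootP Q sQ; rewrite /root /Q !hornerE subr_eq0 => /eqP vE.
have p0_int x : nrm x <= 1 -> nrm p0.[x] <= M.
  move=> x1; rewrite horner_coef; apply: (nrm_sum_le hC) => [|i _]; first exact: ltW.
  rewrite (nrmM hC) -[X in _ <= X]mulr1 ler_pM ?(nrm_ge0 hC) //.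
    by rewrite coef_poly; case: ifP => _ //; rewrite (nrm0 hC) ltW.
  by rewrite (nrmX hC) exprn_ile1 ?(nrm_ge0 hC).
have v1 : nrm v = 1.
  have [lt|gt|//] := ltgtP (nrm v) 1.
    have := congr1 nrm vE; rewrite (nrmM hC) bN0 => /eqP; rewrite lt_eqF //.
    apply: (@le_lt_trans _ _ (nrm v * M)); last by rewrite gtr_pMl.
    by rewrite ler_wpM2l ?(nrm_ge0 hC) // p0_int ?ltW.
  have vn k : 0 < nrm v ^+ k by rewrite exprn_gt0 // (lt_trans ltr01).
  have top : nrm p0.[v] = M * nrm v ^+ N0.
    rewrite horner_poly big_ord_recr /= addrC (nrmDl_eq hC) (nrmM hC) bN0 (nrmX hC) //.
    apply: (nrm_sum_lt hC); first by rewrite mulr_gt0.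
    move=> i _ _; rewrite (nrmM hC) (nrmX hC).
    apply: (@le_lt_trans _ _ (M * nrm v ^+ i)).
      by rewrite ler_wpM2r ?exprn_ge0 ?(nrm_ge0 hC).
    by rewrite ltr_pM2l // ltr_eXn2l.
  have := congr1 nrm vE; rewrite (nrmM hC) top bN0 mulrCA -exprS => /eqP.
  rewrite -[X in _ == X]mulr1 (inj_eq (mulfI (lt0r_neq0 M_gt0))) gt_eqF //.
  by rewrite exprn_egt1.
have pv0 : nrm p0.[v] = M by have := congr1 nrm vE; rewrite (nrmM hC) v1 mul1r bN0.
have pv : nrm p.[v] = M.
  have -> : p.[v] = p0.[v] + \sum_(N0.+1 <= i < N.+1) b i * v ^+ i.
    rewrite !horner_poly -!(big_mkord xpredT (fun i => b i * v ^+ i)).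
    by rewrite -big_cat_nat.
  rewrite (nrmDl_eq hC) pv0 //; apply: (nrm_sum_lt hC) => // i.
  rewrite mem_index_iota => /andP[ni _] _.
  by rewrite (nrmM hC) (nrmX hC) v1 expr1n mulr1 b_lt.
have sq : size ('X^2 - 'X - v%:P : {poly C}) != 1%N.
  have -> : 'X^2 - 'X - v%:P = 'X^2 + (- 'X - v%:P) :> {poly C} by rewrite addrA.
  rewrite size_polyDl size_polyXn //.
  by rewrite -opprD size_polyN size_XaddC.
have [u] := closed_rootP _ sq; rewrite /root !hornerE subr_eq0 => /eqP uE.
have prod1 : nrm u * nrm (u - 1) = 1.
  by rewrite -(nrmM hC) -v1 -uE; congr nrm; ring.
have u1 : nrm u = 1.
  have [lt|gt|//] := ltgtP (nrm u) 1.
    have e : nrm (u - 1) = 1.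
      by rewrite (nrmB_sym hC) (nrmBl_eq hC) (nrm1 hC).
    by move: prod1 lt; rewrite e mulr1 => ->; rewrite ltxx.
  have e : nrm (u - 1) = nrm u by rewrite (nrmBl_eq hC) // (nrm1 hC).
  by move: prod1; rewrite e -expr2 => /eqP; rewrite gt_eqF // exprn_egt1.
exists u; split=> //; last by rewrite /f uE.
by rewrite (nrmB_sym hC); move: prod1; rewrite u1 mul1r.
Qed.

Lemma integral_case_false : False.
Proof.
have [u [u1 v1 fu]] := f_large; have := f_small u1 v1.
by rewrite fu leNgt gtr_pMr // invf_lt1 ?ltr1n ?ltr0n.
Qed.

End IntegralCase.

(** * The weight determines s *)

Section Characters.
Variables (R : realType) (C : closedFieldType) (nrm : C -> R).
Hypothesis hC : is_C2 nrm.
Implicit Types (x y l t : C).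

Let char0 := char0_C2 hC.

Lemma cvgC_near (u : nat -> C) l (e : R) : cvgC nrm u l -> 0 < e ->
  exists N : nat, forall n, (N <= n)%N -> nrm (u n - l) < e.
Proof.
move=> /cvgrPdist_lt h e0; have [N _ HN] := h e e0; exists N => n Nn.
by have := HN n Nn; rewrite /= sub0r normrN ger0_norm ?(nrm_ge0 hC).
Qed.

Lemma cvgC_unique (u : nat -> C) l l' : cvgC nrm u l -> cvgC nrm u l' -> l = l'.
Proof.
move=> ul ul'; apply: contrapT => /eqP; rewrite -subr_eq0 => ll'.
have d0 := nrm_gt0 hC ll'; have [N HN] := cvgC_near ul d0; have [N' HN'] := cvgC_near ul' d0.
have := nrmB_lt hC (HN' _ (leq_addl N N')) (HN _ (leq_addr N' N)).
by rewrite opprB addrC addrA subrK ltxx.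
Qed.

Lemma nrm_fact_ge k : (0 < k)%N -> 2^-1 ^+ k.-1 <= nrm (k`!)%:R.
Proof.
move=> k0; rewrite (nrm_nat hC) ?fact_gt0 //.
rewrite ler_wiXn2l ?invr_ge0 ?invf_le1 ?ler1n //.
by have := logn2_fact_lt k0; lia.
Qed.

(** Here l is log 5, and the first term 4 of the series dominates: |4^k / k| < 1/4 for k >= 2. *)
Lemma is_log1p_4_norm l : is_log1p nrm 4%:R l -> nrm l = 4^-1.
Proof.
move=> hl; have n4 : nrm 4%:R = 4^-1.
  by rewrite (_ : 4%:R = 2%:R * 2%:R) ?(nrmM hC) ?(nrm2 hC); [field|rewrite -natrM].
have e0 : 0 < 4^-1 :> R by rewrite invr_gt0.
have [N HN] := cvgC_near hl e0; have := HN _ (leq_addl 2 N).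
set S := \sum_(1 <= k < _) _.
have S4 : nrm (S - 4%:R) < 4^-1.
  rewrite /S addSn big_ltn // expr2 mulrNN !mul1r expr1 divr1 [4%:R + _]addrC addrK.
  apply: (nrm_sum_lt hC) => // k; rewrite mem_index_iota => /andP[k2 _] _.
  have k0 : (0 < k)%N by apply: ltn_trans k2.
  rewrite (nrm_div hC) (nrmM hC) !(nrmX hC) (nrmN hC) (nrm1 hC) expr1n mul1r n4 (nrm_nat hC) //.
  have p2 : (logn 2 k < k)%N.
    apply: (@leq_ltn_trans (logn 2 k`!)); last exact: logn2_fact_lt.
    by rewrite -(prednK k0) factS lognM ?fact_gt0 // leq_addr.
  rewrite -exprVn invrK.
  have q0 : 0 < (2 : R) by [].
  have -> : 4^-1 ^+ k = 2^-1 ^+ k * 2^-1 ^+ k :> R.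
    by rewrite -exprMn; congr (_ ^+ _); field.
  apply: (@le_lt_trans _ _ (2^-1 ^+ k.+1)).
    rewrite exprS -mulrA mulrC ler_wpM2r ?exprn_ge0 ?invr_ge0 //.
    rewrite -{1}(subnK (ltnW p2)) exprD -mulrA -exprMn mulVf ?expr1n ?mulr1 ?pnatr_eq0 //.
    rewrite -[X in _ <= X]expr1 ler_wiXn2l ?invr_ge0 ?invf_le1 ?ler1n // subn_gt0 //.
  have -> : 4^-1 = 2^-1 ^+ 2 :> R by rewrite expr2; field.
  by rewrite ltr_iXn2l ?invr_gt0 // invf_lt1 ?ltr1n.
move=> Sl; have l4 : nrm (l - 4%:R) < 4^-1.
  have -> : l - 4%:R = (S - 4%:R) - (S - l) by ring.
  exact: (nrmB_lt hC).
by rewrite -[l](subrK 4%:R) addrC (nrmDl_eq hC) n4.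
Qed.

(** The partial sums differ by x - x' plus terms (x^n - x'^n) / n! with n >= 2; these are smaller
    than x - x', because |n!| >= 2^(1 - n) and x, x' have norm below 1/2. *)
Lemma is_exp_inj x x' y : nrm x < 2^-1 -> nrm x' < 2^-1 ->
  is_exp nrm x y -> is_exp nrm x' y -> x = x'.
Proof.
move=> x2 x2' ex ex'; apply: contrapT => /eqP; rewrite -subr_eq0 => xx'.
have d0 := nrm_gt0 hC xx'; have [N HN] := cvgC_near ex d0; have [N' HN'] := cvgC_near ex' d0.
pose n := (N + N').+2.
have := nrmB_lt hC (HN n ltac:(rewrite /n; lia)) (HN' n ltac:(rewrite /n; lia)).
rewrite opprB addrA subrK -sumrB /n !big_nat_recl //= !expr0 subrr add0r expr1 expr1 !divr1.
rewrite (nrmDl_eq hC) ?ltxx //; apply: (nrm_sum_lt hC) => // k _ _.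
rewrite -mulrBl subrXX (nrm_div hC) (nrmM hC) -mulrA gtr_pMr //.
have f0 : 0 < nrm (k.+2`!)%:R by apply: (nrm_gt0 hC); apply: fact_neq0.
rewrite ltr_pdivrMr // mul1r; apply: lt_le_trans (nrm_fact_ge (ltn0Sn k.+1)).
rewrite /=; apply: (nrm_sum_lt hC); first by rewrite exprn_gt0 ?invr_gt0.
move=> i _ _; rewrite (nrmM hC) !(nrmX hC).
have xle j : nrm x ^+ j <= 2^-1 ^+ j by apply: lerXn2r; rewrite ?nnegrE ?(nrm_ge0 hC) ?invr_ge0 // ltW.
have xle' j : nrm x' ^+ j <= 2^-1 ^+ j by apply: lerXn2r; rewrite ?nnegrE ?(nrm_ge0 hC) ?invr_ge0 // ltW.
have -> : 2^-1 ^+ k.+1 = 2^-1 ^+ (k.+2.-1 - i) * 2^-1 ^+ i :> R.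
  by rewrite -exprD subnK // -ltnS.
have ge0 z j : 0 <= nrm z ^+ j by rewrite exprn_ge0 ?(nrm_ge0 hC).
have h0 j : 0 < 2^-1 ^+ j :> R by rewrite exprn_gt0 ?invr_gt0.
have xlt z j : nrm z < 2^-1 -> (0 < j)%N -> nrm z ^+ j < 2^-1 ^+ j.
  by move=> z2 j0; rewrite ltrXn2r ?nnegrE ?(nrm_ge0 hC) ?invr_ge0 // -lt0n.
have [->|i0] := posnP i; first by rewrite subn0 !expr0 !mulr1 xlt.
apply: (@le_lt_trans _ _ (2^-1 ^+ (k.+1 - i) * nrm x' ^+ i)); first by rewrite ler_wpM2r.
by rewrite ltr_pM2l // xlt.
Qed.

(** As |log 5| = 1/4, the condition |t| < 2 places t log 5 in the disc of norm below 1/2 where exp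
    is injective. *)
Lemma is_bracket_inj t t' kappa :
  is_bracket nrm t kappa -> is_bracket nrm t' kappa -> t = t'.
Proof.
move=> [t2 _ _ [l hl ex]] [t2' _ _ [l' hl' ex']].
have ll' := cvgC_unique hl hl'; subst l'.
have ln := is_log1p_4_norm hl.
have l0 : l != 0 by rewrite -(nrm_eq0b hC) ln invr_eq0 pnatr_eq0.
have small z : nrm z < 2 -> nrm (z * l) < 2^-1.
  move=> z2; rewrite (nrmM hC) ln ltr_pdivrMr //.
  by have -> : 2^-1 * 4 = 2 :> R by field.
exact: (mulIf l0) (is_exp_inj (small _ t2) (small _ t2') ex ex').
Qed.

End Characters.

(** * Passage from 1/j to w, and conclusion *)

Section NonExtension.
Variables (R : realType) (C : closedFieldType) (nrm : C -> R).
Hypothesis hC : is_C2 nrm.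

Let char0 := char0_C2 hC.

Lemma no_extension_integral (t : C) (b : fps C) :
  nat_limit nrm t -> nrm t < 1 -> b <> 0 -> vanish nrm 1 b ->
  fps_subst (fps_subst b (fpsX + fpsX ^+ 2)) (recip C) =
  - (binser t * fps_subst b (fpsX + fpsX ^+ 2)) -> False.
Proof.
move=> tl t1 b0 vb E; have [N0 [bN0 ble blt]] := max_index hC ltr01 vb b0.
have M0 : 0 < nrm (b N0) by apply: (nrm_gt0 hC).
have [N HN] := vb (nrm (b N0) / 4) ltac:(by rewrite divr_gt0).
have ble' n : nrm (b n) <= nrm (b N0) by have := ble n; rewrite !expr1n !mulr1.
have blt' n : (N0 < n)%N -> nrm (b n) < nrm (b N0) by move=> /blt; rewrite !expr1n !mulr1.
apply: (integral_case_false hC tl t1 E (leq_addr N N0) M0 erefl ble' blt').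
move=> n Nn; have := HN n; rewrite expr1n mulr1 => /(_ _)/ltW; apply.
by apply: leq_trans (ltnW Nn); apply: leq_addl.
Qed.

Section Jser.
Variable r : R.
Hypothesis r01 : 0 <= r <= 1.

Let r0 : 0 <= r. Proof. by case/andP: r01. Qed.
Let r1 : r <= 1. Proof. by case/andP: r01. Qed.

Let inv16 : fps_inv (1 + 16%:R * fpsX) = Fps (fun n => (- 16%:R) ^+ n) :> fps C.
Proof.
apply: fps_inv_eq; first exact: coef0_1addnX.
apply: fpsP => n; rewrite mulrDl mul1r fpsDE -mulrA fps_natM_coef -[fpsX]expr1 fps_XnM fps1E.
case: n => [|n] /=; first by rewrite mulr0 addr0.
by rewrite subn1 exprS /= mulNr addNr.
Qed.

Let n16 : nrm 16%:R = 2^-1 ^+ 4.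
Proof. by rewrite (_ : 16%:R = 2%:R ^+ 4) ?(nrmX hC) ?(nrm2 hC) // -natrX. Qed.

Let gbound_inv16 : gbound nrm r 1 (fps_inv (1 + 16%:R * fpsX)).
Proof.
move=> n; rewrite inv16 /= (nrmX hC) (nrmN hC) n16 -exprM.
by rewrite mulr_ile1 ?exprn_ge0 ?invr_ge0 // exprn_ile1 ?invr_ge0 // invf_le1 ?ler1n.
Qed.

Let vanish_inv16 : vanish nrm r (fps_inv (1 + 16%:R * fpsX)).
Proof.
move=> e e0; have [k ke] := half_exp_lt e0; exists k => n kn.
rewrite inv16 /= (nrmX hC) (nrmN hC) n16 -exprM; apply: le_lt_trans ke.
rewrite -[X in _ <= X]mulr1 ler_pM ?exprn_ge0 ?invr_ge0 ?exprn_ile1 //.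
by rewrite ler_wiXn2l ?invr_ge0 ?invf_le1 ?ler1n //; lia.
Qed.

Let gboundC (c : C) : gbound nrm r (nrm c) (fpsC c).
Proof.
by case=> [|n] /=; rewrite ?expr0 ?mulr1 // (nrm0 hC) mul0r (nrm_ge0 hC).
Qed.

Let gbound_X : gbound nrm r r (fpsX : fps C).
Proof.
case=> [|[|n]] /=; rewrite ?(nrm0 hC) ?mul0r //.
by rewrite (nrm1 hC) expr1 mul1r.
Qed.

Lemma gbound_jser : gbound nrm r (16 * r) (jser C).
Proof.
have -> : 16 * r = nrm 16%:R^-1 * r * 1 ^+ 3.
  by rewrite expr1n mulr1 (nrmV hC) n16 -exprVn invrK; congr (_ * r); ring.
apply: (gboundM hC r0); last exact: (gboundX hC r0).
exact: (gboundM hC r0).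
Qed.

Lemma vanish_jser : vanish nrm r (jser C).
Proof.
apply: (vanishM hC r0); last exact: (vanishX hC r0).
apply: (vanishM hC r0).
  by apply: (@vanish_fin _ _ _ hC _ _ 0) => -[].
by apply: (@vanish_fin _ _ _ hC _ _ 1) => -[|[]].
Qed.

Lemma gbound_XX2 : gbound nrm r r (fpsX + fpsX ^+ 2 : fps C).
Proof.
move=> n; rewrite fpsDE -{1}[fpsX]expr1 !fps_XnE.
case: n => [|[|[|n]]] /=; rewrite ?addr0 ?add0r ?(nrm0 hC) ?(nrm1 hC) ?mul0r ?mul1r ?expr1 //.
by rewrite expr2 -[X in _ <= X]mulr1 ler_wpM2l.
Qed.

Lemma vanish_XX2 : vanish nrm r (fpsX + fpsX ^+ 2 : fps C).
Proof.
apply: (@vanish_fin _ _ _ hC _ _ 2) => n n2; rewrite fpsDE -{1}[fpsX]expr1 !fps_XnE.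
by case: n n2 => [|[|[|n]]] //; rewrite addr0.
Qed.

End Jser.

Lemma form_not_overconvergent (s : C) (G : fps C) :
  ~ Z2unit nrm (2%:R * s) -> G 0%N = 0 -> G 1%N = 1 -> Uop G = 0 ->
  ~ M0 nrm ((3 + nu nrm (2%:R * s)) / 12) (hpow s * G).
Proof.
move=> s2 G0 G1 UG [a ra FE].
set nu_s := nu nrm (2%:R * s) in ra.
pose r : R := 2 `^ (nu_s - 1).
have rE : 2 `^ (12 * ((3 + nu_s) / 12)) = 16 * r.
  have -> : 12 * ((3 + nu_s) / 12) = 4%:R + (nu_s - 1) by field.
  rewrite powRD; last by apply/implyP; rewrite pnatr_eq0.
  by rewrite powR_mulrn //; congr (_ * _); ring.
have r0 : 0 < r by rewrite powR_gt0.
have nu1 : nu_s <= 1.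
  rewrite /nu_s /nu; case: (beta _ _) => [b| |]; last exact: ler01.
    exact/ltW/(nu_fin_lt1 b).
  exact: lexx.
have r1 : r <= 1 by rewrite /r -[X in _ <= X](powRr0 2) ler_powR ?ler1n // subr_le0.
have r01 : 0 <= r <= 1 by rewrite ltW.
rewrite rE in ra; have va : vanish nrm (16 * r) a.
  by apply/(rigid_vanish hC) => //; rewrite mulr_ge0 // ltW.
pose b := fps_subst a (jser C).
have vb : vanish nrm r b.
  exact: (vanish_subst hC (ltW r0) va (vanish_jser r01) (gbound_jser r01) (jser_coef0 C)).
pose w := hmu C - 1; have w0 : w 0%N = 0 := sub1_coef0 (hmu_coef0 C).
have y0 : (w + w ^+ 2) 0%N = 0 by rewrite fpsDE fps_coef0X w0 expr0n addr0.
have {}FE : hpow s * G = fps_subst b (w + w ^+ 2).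
  by rewrite FE (jinv_jser char0) (fps_subst_comp _ (jser_coef0 C) y0).
(* The q-coefficient 1 shows that the form is nonzero, hence that [Phi] and [b] are. *)
have F1 : (hpow s * G) 1%N = 1.
  by rewrite fps_coef1M G0 G1 mulr0 addr0 mulr1 hpowE fps_pow_coef0.
have F0 : hpow s * G <> 0 by move=> e; move: F1; rewrite e => /eqP; rewrite eq_sym oner_eq0.
have id := formal_identity char0 FE UG.
pose Phi := fps_subst b (fpsX + fpsX ^+ 2); rewrite -/Phi in id.
have Phi0 : Phi <> 0.
  move=> e; apply: F0; rewrite FE (subst_XX2 _ w0) -/Phi e.
  exact: fps_subst0.
have b0 : b <> 0 by move=> e; apply: Phi0; rewrite /Phi e; exact: fps_subst0.
have vPhi : vanish nrm r Phi.
  exact: (vanish_subst hC (ltW r0) vb (vanish_XX2 r) (gbound_XX2 r01) (XX2_coef0 C)).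
case E: (beta nrm (2%:R * s)) => [d| |]; last exact: (beta_neq_ninfty hC E).
  have nuE : nu_s = nu_fin d by rewrite /nu_s /nu E.
  by rewrite /r nuE in vPhi; exact: (no_extension_finite hC E Phi0 vPhi id).
have rE1 : r = 1 by rewrite /r /nu_s /nu E subrr powRr0.
rewrite rE1 in vb; have z2 := beta_pinfty hC E.
have n3 : nrm 3%:R = 1 := nrm_odd hC (isT : odd 3).
have tE : 6%:R * s = 3%:R * (2%:R * s) by ring.
apply: (no_extension_integral _ _ b0 vb id); rewrite tE.
  move=> e e0; have [n ne] := Z2_nat_approx hC z2 e0; exists (3 * n)%N.
  by rewrite natrM -mulrBr (nrmM hC) n3 mul1r.
rewrite (nrmM hC) n3 mul1r lt_neqAle; case: z2 => q2 ->; rewrite andbT.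
by apply/eqP => n1; apply: s2.
Qed.

End NonExtension.

Theorem theorem5p3 (R : realType) (C : closedFieldType) (nrm : C -> R)
    (hC : is_C2 nrm) (s : C) (hs : nrm s < 4)
    (h2s : ~ Z2unit nrm (2%:R * s))
    (kappa : C -> C) (hkappa : is_bracket nrm (- 12%:R * s) kappa)
    (G : fps C) (hG0 : G 0%N = 0) (hG1 : G 1%N = 1)
    (rho : rat) (hrho : weightX nrm kappa rho)
    (hG : Mk nrm kappa (ratr rho) G) (hU : Uop G = 0) :
  let r : R := (3 + nu nrm (2%:R * s)) / 12 in
  let F : fps C := hpow s * G in
  [/\ M0 nrm (ratr rho) F, ~ M0 nrm r F & ~ Mk nrm kappa r G].
Proof.
move=> r F.
(* [Mk] only provides some s' with weight [kappa]; injectivity of t -> kappa identifies it with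
   [s]. *)
have weight q : Mk nrm kappa q G -> M0 nrm q F.
  move=> [s' [_ hs' MF]]; have n12 : - 12%:R != 0 :> C.
    by rewrite oppr_eq0 (char0_C2 hC 11).
  have -> : F = G * hpow s' by rewrite /F mulrC (mulfI n12 (is_bracket_inj hC hkappa hs')).
  exact: MF.
have noF : ~ M0 nrm r F by apply: form_not_overconvergent.
by split=> // [|/weight]; first exact: weight.
Qed.
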